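(* Let $p$ be a probability density on $\mathbb{R}^d$ and let $\mathcal{X}\subset\mathbb{R}^d$ be a valid region (in the sense defined in the context) with bottleneck $h$ and minimal density $p_{\min}$. Let $\varepsilon\le h$, let $X_1,\dots,X_n$ be drawn i.i.d. from $p$, and let $G$ be the unweighted $\varepsilon$-graph on $X_1,\dots,X_n$. Fix $i\neq j$. Assume that $X_i$ and $X_j$ have distance at least $h$ from the boundary $\partial\mathcal{X}$, and that $\|X_i-X_j\|\ge 8\varepsilon$. Then there exist constants $c_1,\dots,c_7>0$ (independent of $n$ and $\varepsilon$, depending on the dimension, the geometry of $\mathcal{X}$ and $p$) such that with probability at least $1-c_1 n\exp(-c_2 n\varepsilon^d)-c_3\exp(-c_4 n\varepsilon^d)/\varepsilon^d$ the commute distance satisfies \[ \left|\frac{n\varepsilon^d}{\mathrm{vol}(G)}C_{ij}-\left(\frac{n\varepsilon^d}{d_i}+\frac{n\varepsilon^d}{d_j}\right)\right|\le \begin{cases} c_5/(n\varepsilon^d) & \text{if } d>3,\\ c_6\log(1/\varepsilon)/(n\varepsilon^3) & \text{if } d=3,\\ c_7/(n\varepsilon^3) & \text{if } d=2.\end{cases} \] The probability converges to $1$ if $n\to\infty$ and $n\varepsilon^d/\log(n)\to\infty$. The right-hand side of the deviation bound converges to $0$ as $n\to\infty$ if $n\varepsilon^d\to\infty$ (case $d>3$), $n\varepsilon^3/\log(1/\varepsilon)\to\infty$ (case $d=3$), $n\varepsilon^3\to\infty$ (case $d=2$). Under these conditions, if moreover $p$ is continuous and $\varepsilon\to 0$,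 then \[ \frac{n\varepsilon^d}{\mathrm{vol}(G)}C_{ij}\to\frac{1}{\eta_d\, p(X_i)}+\frac{1}{\eta_d\, p(X_j)}\quad\text{almost surely.} \]
   Context: A connected set $\mathcal{X}\subset\mathbb{R}^d$ is a valid region for the density $p$ if: (1) $p(x)\ge p_{\min}>0$ for all $x\in\mathcal{X}$; (2) it has bottleneck larger than $h>0$: the set $\{x\in\mathcal{X}: \mathrm{dist}(x,\partial\mathcal{X})>h/2\}$ is connected; (3) there exist $\alpha>0$, $\varepsilon_0>0$ such that for all $\varepsilon<\varepsilon_0$ and all $x\in\partial\mathcal{X}$, $\mathrm{vol}(B_\varepsilon(x)\cap\mathcal{X})\ge\alpha\,\mathrm{vol}(B_\varepsilon(x))$ (Lebesgue volume). The unweighted $\varepsilon$-graph has vertices $X_1,\dots,X_n$ and an edge between two points iff their Euclidean distance is at most $\varepsilon$. For a graph with weights $w_{ij}\ge 0$, $d_i=\sum_j w_{ij}$ is the degree, $\mathrm{vol}(G)=\sum_i d_i$. The natural random walk has transition matrix $P=D^{-1}W$; the hitting time $H_{uv}$ is the expected time for this walk started at $u$ to reach $v$ ($H_{uu}=0$), and the commute distance is $C_{uv}=H_{uv}+H_{vu}$. $\eta_d$ is the volume of the unit ball in $\mathbb{R}^d$.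
   Formalization: X_i, X_j are taken in X; the bound and limit are claimed only when every connected component of G meets X (false otherwise, e.g. p on two far-apart balls); for d=3, ε ≤ ε_max with a fixed ε_max < 1, on which the constants may depend, as the bound with log(1/ε) vanishes at ε=1. *)

(* Defs.v *)
From HB Require Import structures.
From mathcomp Require Import all_boot all_order all_algebra.
From mathcomp Require Import all_classical all_reals all_analysis.

Set Implicit Arguments.
Unset Strict Implicit.
Unset Printing Implicit Defensive.

Import Order.TTheory GRing.Theory Num.Theory.
Import numFieldNormedType.Exports.

Local Open Scope classical_set_scope.
Local Open Scope ring_scope.

Definition measure_rV_display : measure_display -> measure_display.
Proof. exact. Qed.

(* 'rV[R]_n carries the sigma-algebra generated by the coordinates, that is,
   its Borel sigma-algebra. *)
Section measurable_rV.
Context {R : realType} (n : nat).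

Definition rV_coord (i : 'I_n) (x : 'rV[R]_n) : measurableTypeR R := x ord0 i.

Let rV_set0 : g_sigma_preimage rV_coord set0.
Proof. exact: sigma_algebra0. Qed.

Let rV_setC A : g_sigma_preimage rV_coord A -> g_sigma_preimage rV_coord (~` A).
Proof. exact: sigma_algebraC. Qed.

Let rV_bigcup (F : _^nat) : (forall i, g_sigma_preimage rV_coord (F i)) ->
  g_sigma_preimage rV_coord (\bigcup_i (F i)).
Proof. exact: sigma_algebra_bigcup. Qed.

HB.instance Definition _ := @isMeasurable.Build
  (measure_rV_display (R.-ocitv.-measurable).-sigma) 'rV[R]_n
  (g_sigma_preimage rV_coord) rV_set0 rV_setC rV_bigcup.

End measurable_rV.

Section lebesgue_rV.
Context {R : realType}.

Lemma measurable_fun_rVP d (T : measurableType d) n (f : T -> 'rV[R]_n) :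
  measurable_fun [set: T] f <->
  forall i, measurable_fun [set: T] (rV_coord i \o f).
Proof.
apply: (@iff_trans _ (g_sigma_preimage (fun i => rV_coord i \o f)
    `<=` measurable)).
  rewrite g_sigma_preimage_comp; split=> [mf A [/= C preC <-]|prefS].
    exact: mf.
  by move=> _ A mA; apply: prefS; exists A.
split=> [fS i|mf].
- move=> _ A mA; apply: fS; apply: sub_sigma_algebra.
  rewrite -bigcup_seq/=; exists i => /=; first by rewrite mem_index_enum.
  by exists A.
- apply: smallest_sub; first exact: sigma_algebra_measurable.
  rewrite -bigcup_seq; apply: bigcup_sub => i _ A [B mB <-]; exact: mf.
Qed.

Lemma measurable_rV_coord n (i : 'I_n) :
  measurable_fun [set: 'rV[R]_n] (rV_coord i).
Proof.
by have /measurable_fun_rVP := @measurable_id _ 'rV[R]_n setT; apply.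
Qed.

Definition rV_cons n (z : measurableTypeR R * 'rV[R]_n) : 'rV[R]_n.+1 :=
  \row_i oapp (z.2 ord0) z.1 (unlift ord0 i).

Definition rV_uncons n (x : 'rV[R]_n.+1) : measurableTypeR R * 'rV[R]_n :=
  (x ord0 ord0, \row_j x ord0 (lift ord0 j)).

Lemma rV_consK n : cancel (@rV_cons n) (@rV_uncons n).
Proof.
case=> a x; rewrite /rV_uncons/= mxE unlift_none/=; congr pair.
by apply/rowP => j; rewrite !mxE liftK.
Qed.

Lemma measurable_rV_cons n : measurable_fun setT (@rV_cons n).
Proof.
apply/measurable_fun_rVP => i; rewrite /rV_coord /comp.
case: (unliftP ord0 i) => [j|] ->.
  under eq_fun do rewrite mxE liftK /=.
  exact: (measurableT_comp (measurable_rV_coord j) measurable_snd).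
under eq_fun do rewrite mxE unlift_none /=.
exact: measurable_fst.
Qed.

Lemma measurable_rV_uncons n : measurable_fun setT (@rV_uncons n).
Proof.
apply/measurable_fun_pairP; split; first exact: measurable_rV_coord.
apply/measurable_fun_rVP => i; rewrite /rV_coord /comp.
under eq_fun do rewrite mxE /=.
exact: measurable_rV_coord.
Qed.

Section step.
Context n (mu : {sigma_finite_measure set 'rV[R]_n -> \bar R}).

(* lebesgue_measure \x mu, transported along R * 'rV[R]_n ~ 'rV[R]_n.+1 *)
Definition rV_cons_measure : set 'rV[R]_n.+1 -> \bar R :=
  pushforward (lebesgue_measure \x mu)%E (@rV_cons n).

Let rV_cons_measure0 : rV_cons_measure set0 = 0%E.
Proof. by rewrite /rV_cons_measure /pushforward preimage_set0 measure0. Qed.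

Let rV_cons_measure_ge0 A : (0 <= rV_cons_measure A)%E.
Proof. by rewrite /rV_cons_measure /pushforward measure_ge0. Qed.

Let rV_cons_measure_sigma_additive : semi_sigma_additive rV_cons_measure.
Proof.
move=> F mF tF mUF; rewrite /rV_cons_measure /pushforward preimage_bigcup.
have mcons A : measurable A -> measurable (@rV_cons n @^-1` A).
  by move=> mA; rewrite -[X in measurable X]setTI; exact: measurable_rV_cons.
apply: measure_semi_sigma_additive.
- by move=> k; exact: mcons.
- apply/trivIsetP => /= i j _ _ ij; rewrite -preimage_setI.
  by move/trivIsetP : tF => /(_ _ _ _ _ ij) ->//; rewrite preimage_set0.
- by rewrite -preimage_bigcup; exact: mcons.
Qed.

HB.instance Definition _ := isMeasure.Build _ _ _ rV_cons_measure
  rV_cons_measure0 rV_cons_measure_ge0 rV_cons_measure_sigma_additive.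

Let rV_cons_measure_sigma_finite : sigma_finite setT rV_cons_measure.
Proof.
have /sigma_finiteP[F [TF ndF Foo]] := sigma_finiteT (@lebesgue_measure R).
have /sigma_finiteP[G [TG ndG Goo]] := sigma_finiteT mu.
exists (fun k => @rV_uncons n @^-1` (F k `*` G k)).
  rewrite -preimage_bigcup -[LHS](preimage_setT (@rV_uncons n)); congr preimage.
  rewrite -setXTT TF TG predeqE => -[x y]; split.
    move=> [/= [k _ Fkx] [l _ Gly]]; exists (maxn k l) => //; split.
    - by move: x Fkx; exact/subsetPset/ndF/leq_maxl.
    - by move: y Gly; exact/subsetPset/ndG/leq_maxr.
  by move=> [k _ []/= ? ?]; split; exists k.
move=> k; have [? ?] := Foo k; have [? ?] := Goo k.
have mFG : measurable (F k `*` G k) by exact: measurableX.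
split; first by rewrite -[X in measurable X]setTI; exact: measurable_rV_uncons.
rewrite /rV_cons_measure /pushforward -comp_preimage.
rewrite (_ : _ \o _ = idfun); last by apply/funext => z; exact: rV_consK.
by rewrite preimage_id product_measure1E// lte_mul_pinfty// ge0_fin_numE.
Qed.

HB.instance Definition _ := Measure_isSigmaFinite.Build _ _ _ rV_cons_measure
  rV_cons_measure_sigma_finite.
End step.

Let dirac0_sigma_finite :
  sigma_finite setT (dirac (0 : 'rV[R]_0) : set 'rV[R]_0 -> \bar R).
Proof.
exists (fun=> setT); first by rewrite bigcup_const//; exists 0%N.
by move=> _; split => //; rewrite diracT ltry.
Qed.

HB.instance Definition _ := Measure_isSigmaFinite.Build _ _ _
  (dirac (0 : 'rV[R]_0) : set 'rV[R]_0 -> \bar R) dirac0_sigma_finite.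

Fixpoint lebesgue_rV n : {sigma_finite_measure set 'rV[R]_n -> \bar R} :=
  match n with
  | 0%N => dirac (0 : 'rV[R]_0)
  | n'.+1 => rV_cons_measure (lebesgue_rV n')
  end.

Lemma lebesgue_rV_box n (A : 'I_n -> set (measurableTypeR R)) :
  (forall i, measurable (A i)) ->
  lebesgue_rV n [set x | forall i, A i (x ord0 i)] =
  (\prod_(i < n) lebesgue_measure (A i))%E.
Proof.
elim: n A => [|n IH] A mA.
  by rewrite big_ord0 /= diracE mem_set//= => -[].
rewrite big_ord_recl /= /rV_cons_measure /pushforward.
have mB : measurable [set x : 'rV[R]_n | forall i, A (lift ord0 i) (x ord0 i)].
  rewrite (_ : [set _ | _] =
      \bigcap_(i in setT) (rV_coord i @^-1` A (lift ord0 i))).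
    apply: fin_bigcap_measurable => // i _.
    by rewrite -[X in measurable X]setTI; exact: measurable_rV_coord.
  by apply/seteqP; split=> [x Ax i _|x Ax i]; [exact: Ax|exact: (Ax i I)].
rewrite -(IH (fun i => A (lift ord0 i)))// -product_measure1E//.
congr (product_measure1 _ _ _); apply/seteqP; split => -[a x] /=.
  move=> H; split; first by have := H ord0; rewrite mxE unlift_none.
  by move=> i; have := H (lift ord0 i); rewrite mxE liftK.
move=> [Aa Ax] i; rewrite mxE /=.
by case: (unliftP ord0 i) => [j|] ->.
Qed.

End lebesgue_rV.

Section euclidean.
Context {R : realType} (d : nat).
Implicit Types (x y : 'rV[R]_d) (A : set 'rV[R]_d).

(* The library norm on 'rV[R]_d is the sup norm; it induces the Euclidean
   topology but not the Euclidean distance. *)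
Definition enorm x : R := Num.sqrt (\sum_(i < d) x ord0 i ^+ 2).

Definition edistance x y : R := enorm (x - y).

Definition eball x (r : R) : set 'rV[R]_d := [set y | edistance x y < r].

Definition unit_ball_volume : R := fine (lebesgue_rV d (eball 0 1)).

Definition frontier A : set 'rV[R]_d := closure A `\` A°.

(* +oo when A is empty *)
Definition dist_to_set x A : \bar R :=
  ereal_inf [set (edistance x y)%:E | y in A].

End euclidean.

Section regions.
Context {R : realType} (d : nat).
Implicit Types (p : 'rV[R]_d -> R) (X : set 'rV[R]_d).

Definition is_density p : Prop :=
  [/\ measurable_fun setT p, forall x, 0 <= p x &
      (\int[lebesgue_rV d]_x (p x)%:E)%E = 1%E].

(* Measurability of X is implicit in speaking of the volumes in the last
   condition. *)
Record valid_region p X (pmin h : R) : Prop := ValidRegion {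
  region_measurable : measurable X;
  region_connected : connected X;
  region_pmin_gt0 : 0 < pmin;
  region_density : forall x, X x -> pmin <= p x;
  region_h_gt0 : 0 < h;
  region_bottleneck :
    connected [set x | X x /\ ((h / 2)%:E < dist_to_set x (frontier X))%E];
  region_regular : exists alpha eps0 : R, [/\ 0 < alpha, 0 < eps0 &
    forall eps x, 0 < eps -> eps < eps0 -> frontier X x ->
      (alpha%:E * lebesgue_rV d (eball x eps)
         <= lebesgue_rV d (eball x eps `&` X))%E] }.

Definition deep_point X (h : R) (x : 'rV[R]_d) : Prop :=
  X x /\ (h%:E <= dist_to_set x (frontier X))%E.

End regions.

Section sampling.
Context {R : realType} (d : nat) {dOmega : measure_display}.
Context {Omega : measurableType dOmega}.

(* Taking B k = setT for some k < n yields the product rule for every finite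
   subfamily. *)
Definition mutually_independent (P : probability Omega R)
    (Z : nat -> Omega -> 'rV[R]_d) : Prop :=
  forall (n : nat) (B : nat -> set 'rV[R]_d), (forall k, measurable (B k)) ->
  P (\bigcap_(k in `I_n) (Z k @^-1` B k)) =
  (\prod_(k < n) P (Z k @^-1` B k))%E.

Definition iid_with_density (P : probability Omega R) (p : 'rV[R]_d -> R)
    (Z : nat -> Omega -> 'rV[R]_d) : Prop :=
  [/\ forall k, measurable_fun setT (Z k),
      forall k B, measurable B ->
        P (Z k @^-1` B) = (\int[lebesgue_rV d]_(x in B) (p x)%:E)%E &
      mutually_independent P Z].

End sampling.

Section random_walk.
Context {R : realType} (n : nat).
Implicit Types (W P : 'M[R]_n) (u v : 'I_n).

Definition degree W u : R := \sum_v W u v.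

Definition graph_volume W : R := \sum_u degree W u.

(* D^-1 W; the row of a vertex of degree 0 is 0, so that a walk starting there
   reaches no other vertex. *)
Definition walk_matrix W : 'M[R]_n := \matrix_(u, v) (W u v / degree W u).

(* The probability that the first time at which the Markov chain with
   transition matrix P started at u visits v is t: the sum of the
   probabilities of the trajectories (w 0, ..., w t) from u to v that avoid v
   before time t. *)
Definition first_passage P u v (t : nat) : R :=
  \sum_(w : {ffun 'I_t.+1 -> 'I_n} |
        [&& w ord0 == u, w ord_max == v &
            [forall s : 'I_t.+1, (s < t)%N ==> (w s != v)]])
    \prod_(s < t) P (w (widen_ord (leqnSn t) s)) (w (lift ord0 s)).

(* The expectation of the first passage time T, with values in [0, +oo]:
   \sum_t t * Pr(T = t) + (+oo) * Pr(T = +oo), where (+oo) * 0 = 0. *)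
Definition hitting_time P u v : \bar R :=
  (\sum_(0 <= t <oo) (t%:R * first_passage P u v t)%:E
   + +oo * (1 - \sum_(0 <= t <oo) (first_passage P u v t)%:E))%E.

Definition commute_distance W u v : \bar R :=
  (hitting_time (walk_matrix W) u v + hitting_time (walk_matrix W) v u)%E.

End random_walk.

Section eps_graph.
Context {R : realType} (d n : nat).
Implicit Types (x : 'I_n -> 'rV[R]_d) (eps : R).

Definition eps_edge x eps : rel 'I_n :=
  [rel u v | (u != v) && (edistance (x u) (x v) <= eps)].

Definition eps_graph x eps : 'M[R]_n := \matrix_(u, v) (eps_edge x eps u v)%:R.

(* n eps^d / vol(G) * C_uv; meaningful when C_uv is finite *)
Definition scaled_commute x eps u v : R :=
  n%:R * eps ^+ d / graph_volume (eps_graph x eps)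
    * fine (commute_distance (eps_graph x eps) u v).

Definition scaled_inverse_degree x eps u : R :=
  n%:R * eps ^+ d / degree (eps_graph x eps) u.

(* No connected component of the graph lies entirely outside X. This holds
   in particular when the graph is connected and has a vertex in X, or when all
   vertices lie in X. Without it the graph may have a component that is never
   seen by the walk from u to v, but whose degrees contribute to vol(G). *)
Definition components_meet (X : set 'rV[R]_d) x eps : Prop :=
  forall k, exists2 l, connect (eps_edge x eps) k l & X (x l).

End eps_graph.

Section bounds.
Context {R : realType} (d : nat).

Definition failure_bound (c1 c2 c3 c4 : R) (n : nat) (eps : R) : R :=
  c1 * n%:R * expR (- (c2 * (n%:R * eps ^+ d)))
  + c3 * expR (- (c4 * (n%:R * eps ^+ d))) / eps ^+ d.

(* used for 2 <= d only *)
Definition deviation_bound (c5 c6 c7 : R) (n : nat) (eps : R) : R :=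
  if (3 < d)%N then c5 / (n%:R * eps ^+ d)
  else if d == 3%N then c6 * ln (eps^-1) / (n%:R * eps ^+ 3)
  else c7 / (n%:R * eps ^+ 3).

Definition rate_condition (eps : nat -> R) : Prop :=
  if (3 < d)%N then (n%:R * eps n ^+ d) @[n --> \oo] --> +oo
  else if d == 3%N then
    (n%:R * eps n ^+ 3 / ln ((eps n)^-1)) @[n --> \oo] --> +oo
  else (n%:R * eps n ^+ 3) @[n --> \oo] --> +oo.

Definition log_condition (eps : nat -> R) : Prop :=
  (n%:R * eps n ^+ d / ln n%:R) @[n --> \oo] --> +oo.

End bounds.

(* Main.v *)
(* Let phi be the potential of the flow of strength vol(G) from i to j, so that
   C_ij = phi_i - phi_j.  The quantity D = C_ij - vol(G)/d_i - vol(G)/d_j equals the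
   difference of the means of phi over the neighbours of i and of j, and the edges
   not touching i or j carry energy E <= 2 vol(G) D.  So an inequality
   D^2 <= M E, that is, a bound on the resistance between the two neighbourhoods,
   gives 0 <= C_ij/vol(G) - 1/d_i - 1/d_j <= 2 M.

   For this inequality, cut space into cubic cells of side proportional to eps and
   average phi over the sample points of the cells met by a random path from X_i to
   X_j: a fixed path through the deep part of X, translated by a vector that is
   uniform in a grid whose size grows linearly from 0 up to about h away from
   the end points.  At step t the path sits in a given cell with probability of
   order t^-d, so each step costs t^(-d/2) (sqrt E)/(n eps^d), and sum_t t^(-d/2)
   over t <= 1/eps is bounded for d >= 3 and of order eps^(-1/2) for d = 2.

   All this needs only a lower bound on the number of sample points other than X_i
   and X_j in each cell inside X, and the connectedness of the graph: the points
   near a net of X form a connected set that is adjacent to every point of X, and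
   every component of the graph meets X.  The counts involved are controlled by
   Chernoff's bound outside an event independent of (X_i, X_j).  The almost sure
   statement follows by Borel-Cantelli, with Chernoff's bounds applied to the balls
   of a fine net to estimate the degrees uniformly in the position of X_i and X_j. *)

Require Import Defs.
From HB Require Import structures.
From mathcomp Require Import all_boot all_order all_algebra.
From mathcomp Require Import all_classical all_reals all_analysis.
From mathcomp Require Import measurable_realfun.
From mathcomp Require Import ring lra zify.

Set Implicit Arguments.
Unset Strict Implicit.
Unset Printing Implicit Defensive.

Import Order.TTheory GRing.Theory Num.Theory.
Import numFieldNormedType.Exports.

Local Open Scope classical_set_scope.
Local Open Scope ring_scope.

(** What is added up along the random path is square roots of energy. Jensen's inequality bounds the
    mean change of the averaged potential in one step by [rho t / m * sqrt E], where [rho t ^+ 2]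
    bounds the probability that the path sits in a given cell. The steps combine by the triangle
    inequality, whatever the overlap between different times. One deterministic path would have
    [rho t = 1] over about 1/eps steps and would lose a factor eps^-2. All paths must leave the same
    cell, and a step of length at most eps/2 lets the grid grow by one unit at a time, hence the
    linear growth.

    [X] may be unbounded, so every finite count (net points, cells, balls of a covering) comes from
    the total mass 1 of the density, which is at least [pmin] on [X].

    The first claim compares [P (A]&[good)] with [P A], which may be arbitrarily small. So the
    exceptional event must be independent of the pair, not merely rare.

    In the almost sure part the position of X_i is itself random, so a null set must serve all
    positions at once. This is why the counts are uniform in position and localised to countably
    many rational balls. *)

(** * First passage and hitting times of a finite Markov chain *)

Section first_passage_recursion.
Context {R : realType} (n : nat) (P : 'M[R]_n).

Let ffun_cons t (z : 'I_n * {ffun 'I_t.+1 -> 'I_n}) : {ffun 'I_t.+2 -> 'I_n} :=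
  [ffun s => oapp z.2 z.1 (unlift ord0 s)].

Let ffun_cons_bij t : bijective (@ffun_cons t).
Proof.
exists (fun w : {ffun 'I_t.+2 -> 'I_n} => (w ord0, [ffun s => w (lift ord0 s)])).
  by case=> a w; rewrite /ffun_cons ffunE unlift_none; congr pair;
    apply/ffunP => s; rewrite !ffunE liftK.
by move=> w; apply/ffunP => s; rewrite ffunE; case: unliftP => [s'|] ->;
  rewrite //= ffunE.
Qed.

Lemma first_passage0 u v : first_passage P u v 0 = (u == v)%:R.
Proof.
rewrite /first_passage (eq_bigr (fun=> 1)); last by move=> w _; rewrite big_ord0.
case: eqVneq => [<-|uv].
  rewrite (big_pred1 [ffun => u]) // => w /=.
  rewrite (_ : ord_max = ord0); last exact/val_inj.
  apply/and3P/eqP => [[/eqP wu _ _]|->].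
    by apply/ffunP => s; rewrite ffunE -wu (ord1 s).
  by rewrite ffunE eqxx; split=> //; apply/forallP.
rewrite big_pred0 // => w; rewrite (_ : ord_max = ord0); last exact/val_inj.
by apply: contra_neqF uv => /and3P[/eqP <- /eqP <-].
Qed.

(** One-step analysis: [ffun_cons] splits a trajectory into its starting vertex and the rest. The
    factor [u != v] is there because a trajectory of positive length starting at [v] has already
    visited [v] at time 0. *)
Lemma first_passageS u v t :
  first_passage P u v t.+1 =
  (u != v)%:R * \sum_w P u w * first_passage P w v t.
Proof.
rewrite /first_passage (reindex _ (onW_bij _ (ffun_cons_bij t))) /=.
have maxE : (ord_max : 'I_t.+2) = lift ord0 (ord_max : 'I_t.+1) by exact/val_inj.
rewrite (eq_bigl (fun z : 'I_n * {ffun 'I_t.+1 -> 'I_n} => (z.1 == u) && [&& z.2 ord_max == v, z.1 != v &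
    [forall s : 'I_t.+1, (s < t)%N ==> (z.2 s != v)]])); last first.
  move=> -[a w] /=; rewrite maxE !ffunE unlift_none liftK /=.
  do 2 congr (_ && _); apply/forallP/andP => [H|[av /forallP H] s].
    split; first by have := H ord0; rewrite ffunE unlift_none.
    apply/forallP => s; have := H (lift ord0 s); rewrite ffunE liftK /=.
    by rewrite /bump /= add1n ltnS.
  rewrite ffunE; case: unliftP => [s'|] -> //=.
  by rewrite /bump /= add1n ltnS; exact: H.
rewrite -(pair_big_dep (fun a => a == u) (fun a (w : {ffun 'I_t.+1 -> 'I_n}) =>
  [&& w ord_max == v, a != v & [forall s : 'I_t.+1, (s < t)%N ==> (w s != v)]])
  (fun a w => \prod_(s < t.+1)
     P (ffun_cons (a, w) (widen_ord (leqnSn t.+1) s))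
       (ffun_cons (a, w) (lift ord0 s)))) /= big_pred1_eq.
rewrite big_distrr /=; case: (eqVneq u v) => [uv|uv] /=.
  under [RHS]eq_bigr do rewrite mul0r.
  by rewrite big1_eq big_pred0 // => w; rewrite !andbF.
under [RHS]eq_bigr do rewrite mul1r big_distrr /=.
(* A pair (next vertex, trajectory from that vertex) is determined by the trajectory alone. *)
rewrite pair_big_dep /= [RHS](reindex_omap (fun w : {ffun 'I_t.+1 -> 'I_n} =>
  (w ord0, w)) (fun z => Some z.2)) /=; last first.
  by case=> b w /= /andP[/eqP <-].
apply: eq_big => [w|w _]; first by rewrite !eqxx andbT.
rewrite big_ord_recl; congr (P _ _ * _).
- by rewrite ffunE (_ : widen_ord _ _ = ord0) ?unlift_none //; exact/val_inj.
- by rewrite ffunE liftK.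
apply: eq_bigr => s _; rewrite !ffunE !liftK; congr (P _ _).
rewrite (_ : widen_ord _ _ = lift ord0 (widen_ord (leqnSn t) s)) ?liftK //.
exact/val_inj.
Qed.

End first_passage_recursion.

Section hitting_time_system.
Context {R : realType} (n : nat) (P : 'M[R]_n) (v : 'I_n).
Hypothesis P_ge0 : forall u w, 0 <= P u w.
Hypothesis P_sum1 : forall u, \sum_w P u w = 1.
(** Reachability of [v] from every vertex, stated as an induction principle along reversed
    transitions; this is the form in which it is used. *)
Hypothesis reach : forall B : pred 'I_n,
  B v -> (forall u w, 0 < P u w -> B w -> B u) -> forall u, B u.

Let f t u := first_passage P u v t.
(* the probability that the first passage time exceeds t *)
Let surv t u := 1 - \sum_(s < t.+1) f s u.

Let f_ge0 t u : 0 <= f t u.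
Proof. by apply: sumr_ge0 => w _; apply: prodr_ge0. Qed.

Let f0E u : f 0 u = (u == v)%:R. Proof. exact: first_passage0. Qed.

Let fSE t u : f t.+1 u = (u != v)%:R * \sum_w P u w * f t w.
Proof. exact: first_passageS. Qed.

Let surv0E u : surv 0 u = (u != v)%:R.
Proof. by rewrite /surv big_ord1 f0E; case: eqP; rewrite /= ?subrr ?subr0. Qed.

Let survSE t u : surv t.+1 u = (u != v)%:R * \sum_w P u w * surv t w.
Proof.
rewrite /surv big_ord_recl f0E.
under eq_bigr do rewrite fSE.
rewrite -big_distrr /= exchange_big /=.
under [in RHS]eq_bigr do rewrite mulrBr mulr1.
rewrite sumrB P_sum1; under [in LHS]eq_bigr do rewrite -big_distrr.
by case: eqP => _ /=; rewrite ?mul0r ?mul1r; ring.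
Qed.

Let surv_ge0 t u : 0 <= surv t u.
Proof.
elim: t u => [|t IH] u; first by rewrite surv0E.
by rewrite survSE mulr_ge0 // sumr_ge0 // => w _; rewrite mulr_ge0.
Qed.

Let survS_le t u : surv t.+1 u <= surv t u.
Proof. by rewrite /surv [X in 1 - X <= _]big_ord_recr /= lerD2l lerN2 lerDl. Qed.

Let surv_homo u s t : (s <= t)%N -> surv t u <= surv s u.
Proof.
move=> /subnK <-; elim: (t - s)%N => // k IH; exact: le_trans (survS_le _ _) IH.
Qed.

Let surv_le1 t u : surv t u <= 1.
Proof. by apply: le_trans (surv_homo u (leq0n t)) _; rewrite surv0E lern1 leq_b1. Qed.

Let surv_lt1 u : exists t, surv t u < 1.
Proof.
pose B u := `[< exists t, surv t u < 1 >].
suff : B u by move/asboolP.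
move: u; apply: reach => [|u w Puw /asboolP[t tw]]; apply/asboolP.
  by exists 0%N; rewrite surv0E eqxx ltr01.
exists t.+1; rewrite survSE; apply: (@le_lt_trans _ _ (\sum_w P u w * surv t w)).
  by rewrite ler_piMl ?lern1 ?leq_b1 // sumr_ge0 // => x _; rewrite mulr_ge0.
rewrite -(P_sum1 u) [ltLHS](bigD1 w) //= [ltRHS](bigD1 w) //= ltr_leD //.
  by rewrite gtr_pMr.
by apply: ler_sum => x _; rewrite ler_piMr.
Qed.

(** There are finitely many vertices, so a single time makes all survival probabilities smaller than
    one [rho < 1]. The recursion then propagates this contraction to every [t]. *)
Let surv_contract : exists N rho, [/\ rho < 1, 0 <= rho &
  forall t u, surv (t + N) u <= rho * surv t u].
Proof.
have [T hT] := choice surv_lt1.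
pose N := (\max_u T u)%N; pose rho := \big[Num.max/0]_u surv N u.
have rho1 : rho < 1.
  apply/bigmax_ltP; split=> // u _; apply: le_lt_trans (hT u).
  by apply: surv_homo; exact: leq_bigmax.
(* The extra step produces the factor [u != v], that is [surv 0 u], needed at [t = 0]. *)
exists N.+1, rho; split=> //; first exact: bigmax_ge_id.
elim=> [|t IH] u.
  rewrite add0n survSE surv0E mulrC ler_wpM2r //.
  rewrite -[leRHS]mulr1 -(P_sum1 u) mulr_sumr; apply: ler_sum => w _.
  by rewrite mulrC ler_wpM2r //; exact: le_bigmax.
rewrite addSn !survSE mulrCA ler_wpM2l // mulr_sumr; apply: ler_sum => w _.
by rewrite mulrCA ler_wpM2l.
Qed.

Let surv_sum_le : exists C, forall t u, \sum_(s < t) surv s u <= C.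
Proof.
have [N [rho [rho1 rho0 H]]] := surv_contract.
(* The partial sum S satisfies S <= N + rho * S: the first N terms are at most 1, and the others
   contract. *)
exists (N%:R / (1 - rho)) => t u; rewrite ler_pdivlMr ?subr_gt0 //.
rewrite mulrBr mulr1 lerBlDr; apply: (@le_trans _ _ (\sum_(s < t + N) surv s u)).
  by rewrite big_split_ord /= lerDl sumr_ge0.
rewrite addnC big_split_ord /= lerD //.
  rewrite -[N in leRHS]card_ord -sumr_const; exact: ler_sum.
by rewrite mulrC mulr_sumr; apply: ler_sum => s _; rewrite addnC.
Qed.

Let f_sumE t u : \sum_(s < t.+1) f s u = 1 - surv t u.
Proof. by rewrite /surv opprB addrC subrK. Qed.

(** Abel summation: the tail sum formula for the expectation, truncated at time [t]. *)
Let moment_sumE t u :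
  \sum_(s < t.+1) s%:R * f s u = \sum_(s < t) surv s u - t%:R * surv t u.
Proof.
elim: t => [|t IH]; first by rewrite big_ord1 big_ord0 !mul0r subr0.
rewrite big_ord_recr IH [in RHS]big_ord_recr /= /surv (big_ord_recr t.+1) /=.
by rewrite -natr1; ring.
Qed.

Let surv_cvg0 u : surv t u @[t --> \oo] --> 0.
Proof.
have [C HC] := surv_sum_le.
(* [surv] is nonincreasing, so t + 1 times its value at [t] is at most a bounded partial sum. *)
have le t : surv t u <= C * harmonic t.
  rewrite ler_pdivlMr ?ltr0n //; apply: le_trans (HC t.+1 u).
  rewrite mulrC -[t.+1 in leLHS]card_ord mulr_natl -sumr_const.
  by apply: ler_sum => s _; apply: surv_homo; rewrite -ltnS.
apply: (@squeeze_cvgr _ _ _ _ (fun=> 0) (fun t => C * harmonic t)).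
- by near=> t; rewrite surv_ge0 le.
- exact: cvg_cst.
- by rewrite -[0](mulr0 C); apply: cvgMr; exact: cvg_harmonic.
Unshelve. all: by end_near. Qed.

Let f_cvg1 u : \sum_(0 <= s < t) f s u @[t --> \oo] --> (1 : R).
Proof.
rewrite -cvg_shiftS; under eq_fun do rewrite big_mkord f_sumE.
by have := cvgB (cvg_cst (1 : R)) (@surv_cvg0 u); rewrite subr0; apply.
Qed.

Let moment t u := \sum_(0 <= s < t) s%:R * f s u.

Let moment_cvg u : cvgn (moment ^~ u).
Proof.
have [C HC] := surv_sum_le.
apply: nondecreasing_is_cvgn.
  move=> s t st; rewrite /moment [leRHS](@big_cat_nat _ _ _ s) //=.
  by rewrite lerDl sumr_ge0 // => i _; rewrite mulr_ge0.
exists (Num.max 0 C) => _ [t _ <-]; rewrite /moment big_mkord.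
case: t => [|t]; first by rewrite big_ord0 le_max lexx.
rewrite moment_sumE le_max; apply/orP; right.
by apply: le_trans (HC t u); rewrite gerBl mulr_ge0.
Qed.

Let H u := limn (moment ^~ u).

Let H_v : H v = 0.
Proof.
rewrite /H (_ : moment ^~ v = cst 0) ?lim_cst //; apply/funext => t.
rewrite /moment big1 // => -[|s] _; first by rewrite mul0r.
by rewrite fSE eqxx /= mul0r mulr0.
Qed.

Let H_rec u : u != v -> H u = 1 + \sum_w P u w * H w.
Proof.
move=> uv; apply/cvg_lim => //; rewrite -cvg_shiftS.
rewrite -[X in X + _](P_sum1 u) -big_split /=.
(* The weight s + 1 splits into a mass, which tends to 1, and a moment one step later. *)
have -> : (fun t => moment t.+1 u) = fun t =>
    \sum_w (P u w * (\sum_(0 <= s < t) f s w) + P u w * moment t w).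
  apply/funext => t; rewrite /moment big_nat_recl //= mul0r add0r.
  under eq_bigr do rewrite fSE uv mul1r big_distrr.
  rewrite exchange_big; apply: eq_bigr => w _.
  rewrite -mulrDr -big_split /=; rewrite mulr_sumr; apply: eq_bigr => s _.
  by rewrite -natr1; ring.
apply: cvg_big => [|w _]; first exact: add_continuous.
have -> : P u w + P u w * H w = P u w * 1 + P u w * H w by rewrite mulr1.
apply: cvgD; first by apply: cvgMr; exact: f_cvg1.
by apply: cvgMr; exact: moment_cvg.
Qed.

(** The passage probabilities sum to 1, so the infinite term of [hitting_time] is +oo * 0 = 0 and
    the limit of the truncated moments remains. The linear equations are inherited from the one-step
    recursion. *)
Lemma hitting_time_system : exists H : 'I_n -> R,
  [/\ H v = 0, forall u, u != v -> H u = 1 + \sum_w P u w * H w &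
      forall u, hitting_time P u v = (H u)%:E].
Proof.
exists H; split=> // u; rewrite /hitting_time.
have -> : (\sum_(0 <= t <oo) (first_passage P u v t)%:E = 1)%E.
  under eq_fun do rewrite sumEFin.
  rewrite (EFin_lim (f := fun t => \sum_(0 <= s < t) f s u)); last first.
    by apply/cvg_ex; exists 1; exact: f_cvg1.
  by congr EFin; apply/cvg_lim => //; exact: f_cvg1.
rewrite subee // mule0 adde0.
under eq_fun do rewrite sumEFin.
by rewrite (EFin_lim (f := moment ^~ u)) //; exact: moment_cvg.
Qed.

End hitting_time_system.

(** * The commute distance as a potential difference *)

Section commute_distance_bound.
Context {R : realType} (n : nat) (W : 'M[R]_n).
Hypothesis W_ge0 : forall u w, 0 <= W u w.
Hypothesis W_sym : forall u w, W u w = W w u.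
Hypothesis W_connect : forall u w, connect [rel x y | 0 < W x y] u w.
Hypothesis n_gt1 : (1 < n)%N.

Notation deg := (degree W).
Notation vol := (graph_volume W).

Let deg_ge0 u : 0 <= deg u. Proof. exact: sumr_ge0. Qed.

Lemma connected_degree_gt0 u : 0 < deg u.
Proof.
have [w uw] : exists w, u != w.
  apply/existsP; apply: contraLR n_gt1; rewrite negb_exists -leqNgt => /forallP H.
  rewrite -[n]card_ord; apply/card_le1P => x _ y; rewrite !inE.
  move: (H x) (H y); rewrite !negbK => /eqP <- /eqP <-.
  by rewrite eqxx.
have /connectP[[|x p] /= pth e] := W_connect u w; first by rewrite e eqxx in uw.
case/andP: pth => /= ux _; rewrite /degree (bigD1 x) //=.
by rewrite ltr_wpDr // sumr_ge0.
Qed.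

Let deg_neq0 u : deg u != 0. Proof. exact: lt0r_neq0 (connected_degree_gt0 u). Qed.

Let laplace_sum (g : 'I_n -> R) : \sum_u (deg u * g u - \sum_w W u w * g w) = 0.
Proof.
rewrite sumrB [X in _ - X]exchange_big /=.
apply/eqP; rewrite subr_eq0; apply/eqP; apply: eq_bigr => u _.
by rewrite -mulr_suml; congr (_ * _); apply: eq_bigr => w _.
Qed.

Lemma hitting_time_laplace v : exists H : 'I_n -> R,
  [/\ H v = 0, forall u, hitting_time (walk_matrix W) u v = (H u)%:E &
      forall u, deg u * H u - \sum_w W u w * H w = deg u - (u == v)%:R * vol].
Proof.
have PE u w : walk_matrix W u w = W u w / deg u by rewrite mxE.
have [||B Bv Bs u|H [Hv Hrec Hh]] := @hitting_time_system R n (walk_matrix W) v.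
- by move=> u w; rewrite PE divr_ge0.
- by move=> u; under eq_bigr do rewrite PE; rewrite -mulr_suml -/(deg u) divff.
- have /connectP[p] := W_connect u v; elim: p u => [|x p IH] u /=.
    by move=> _ <-.
  case/andP => ux px e; apply: (Bs _ x); first by rewrite PE divr_gt0 // connected_degree_gt0.
  exact: IH.
have lap u : u != v -> deg u * H u - \sum_w W u w * H w = deg u.
  move=> uv; rewrite Hrec // mulrDr mulr1 mulr_sumr.
  under eq_bigr => w _ do rewrite PE mulrA [_ / _]mulrC mulrA divff // mul1r.
  by rewrite addrK.
exists H; split=> // u; case: eqVneq => [->|uv]; last by rewrite mul0r subr0 lap.
(* The recursion says nothing at [v]; the value there is forced because a Laplacian with symmetric
   weights sums to 0. *)
have /eqP := laplace_sum H; rewrite (bigD1 v) //= addr_eq0 => /eqP ->.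
rewrite (eq_bigr deg) => [|w]; last exact: lap.
by rewrite mul1r /graph_volume [in RHS](bigD1 v) //= opprD addrA subrr add0r.
Qed.

Variables i j : 'I_n.
Hypothesis ij : i != j.

(** Take the difference of the hitting times of [j] and of [i]. The terms [deg u] cancel, leaving a
    source of strength [vol] at [i] and a sink at [j]. *)
Lemma commute_potential : exists phi : 'I_n -> R,
  commute_distance W i j = (phi i - phi j)%:E /\
  forall u, deg u * phi u - \sum_w W u w * phi w = ((u == i)%:R - (u == j)%:R) * vol.
Proof.
have [H [Hj HE Hl]] := hitting_time_laplace j.
have [G [Gi GE Gl]] := hitting_time_laplace i.
exists (fun u => H u - G u); split.
  by rewrite /commute_distance HE GE Hj Gi -EFinD; congr EFin; ring.
move=> u; under eq_bigr do rewrite mulrBr.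
rewrite sumrB mulrBr.
transitivity ((deg u * H u - \sum_w W u w * H w) - (deg u * G u - \sum_w W u w * G w)).
  by ring.
by rewrite Hl Gl; ring.
Qed.

Hypothesis Wij0 : W i j = 0.
Hypothesis Wii0 : W i i = 0.
Hypothesis Wjj0 : W j j = 0.

(** The sum runs over ordered pairs, so each edge avoiding [i] and [j] counts twice. The factors 2
    in front of the stars and in the energy identity below match this. *)
Definition inner_energy (phi : 'I_n -> R) : R :=
  \sum_(u | u \notin [:: i; j]) \sum_(w | w \notin [:: i; j])
     W u w * (phi u - phi w) ^+ 2.

Let star phi u : R := \sum_w W u w * (phi u - phi w) ^+ 2.

Let energy_split phi :
  \sum_u \sum_w W u w * (phi u - phi w) ^+ 2 =
  inner_energy phi + 2 * star phi i + 2 * star phi j.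
Proof.
have ji : j != i by rewrite eq_sym.
have rest (F : 'I_n -> R) :
    \sum_u F u = F i + F j + \sum_(u | u \notin [:: i; j]) F u.
  rewrite (bigD1 i) //= (bigD1 j) ?ji //= addrA; congr (_ + _).
  by apply: eq_bigl => u; rewrite !inE negb_or.
rewrite rest -/(star phi i) -/(star phi j).
under eq_bigr do rewrite rest.
rewrite !big_split /= -/(inner_energy phi).
have starE k : \sum_(u | u \notin [:: i; j]) W u k * (phi u - phi k) ^+ 2 =
    star phi k - W k i * (phi k - phi i) ^+ 2 - W k j * (phi k - phi j) ^+ 2.
  rewrite /star rest (eq_bigr (fun u => W k u * (phi k - phi u) ^+ 2)); first by ring.
  by move=> u _; rewrite W_sym -[phi u - _]opprB sqrrN.
by rewrite !starE Wii0 Wjj0 [W j i]W_sym Wij0; ring.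
Qed.

(** Cauchy-Schwarz, obtained by expanding the nonnegative weighted variance of the potential drops
    at [u] around their mean [a / deg u]. *)
Let star_ge phi u : \sum_w W u w * (phi u - phi w) = vol \/
    \sum_w W u w * (phi u - phi w) = - vol ->
  vol ^+ 2 / deg u <= star phi u.
Proof.
move=> Hs; pose a := \sum_w W u w * (phi u - phi w).
have a2 : a ^+ 2 = vol ^+ 2 by rewrite /a; case: Hs => ->; rewrite ?sqrrN.
have : 0 <= \sum_w W u w * (phi u - phi w - a / deg u) ^+ 2.
  by apply: sumr_ge0 => w _; rewrite mulr_ge0 // sqr_ge0.
have sqE w : W u w * (phi u - phi w - a / deg u) ^+ 2 = W u w * (phi u - phi w) ^+ 2
  - 2 * (a / deg u) * (W u w * (phi u - phi w)) + W u w * (a / deg u) ^+ 2 by ring.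
under eq_bigr do rewrite sqE.
rewrite big_split sumrB /= -mulr_sumr -mulr_suml -/(deg u) -/a -/(star phi u) -a2.
rewrite (_ : _ - _ + _ = star phi u - a ^+ 2 / deg u) ?subr_ge0 //.
by field; exact: deg_neq0.
Qed.

(* With phi the potential of the unit flow from i to j scaled by vol, the number
   D = phi i - phi j - vol / deg i - vol / deg j is the difference of the means of
   phi over the neighbours of i and of j, while the edges avoiding i and j carry
   energy at most 2 * vol * D by Cauchy-Schwarz at i and j. *)
Lemma commute_distance_bound (M : R) : 0 <= M ->
  (forall phi : 'I_n -> R,
    ((\sum_w W i w * phi w) / deg i - (\sum_w W j w * phi w) / deg j) ^+ 2
      <= M * inner_energy phi) ->
  commute_distance W i j \is a fin_num /\
  0 <= fine (commute_distance W i j) / vol - ((deg i)^-1 + (deg j)^-1) <= 2 * M.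
Proof.
move=> M0 HM; have [phi [CE lap]] := commute_potential.
have vol_gt0 : 0 < vol.
  by rewrite /graph_volume (bigD1 i) //= ltr_wpDr ?sumr_ge0 // connected_degree_gt0.
have lapD u : \sum_w W u w * (phi u - phi w) = ((u == i)%:R - (u == j)%:R) * vol.
  by rewrite -lap; under eq_bigr do rewrite mulrBr; rewrite sumrB -mulr_suml.
have [lapi lapj] := (lap i, lap j); have [dlapi dlapj] := (lapD i, lapD j).
rewrite eqxx (negbTE ij) subr0 mul1r in lapi dlapi.
rewrite eqxx [j == i]eq_sym (negbTE ij) sub0r mulN1r in lapj dlapj.
(* Summation by parts: the energy pairs [phi] with its Laplacian, which lives on [i] and [j]
   only. *)
have energyE : \sum_u \sum_w W u w * (phi u - phi w) ^+ 2 =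
    2 * vol * (phi i - phi j).
  pose g u := phi u * (deg u * phi u - \sum_w W u w * phi w).
  transitivity (2 * \sum_u g u).
    rewrite mulr_sumr.
    transitivity (\sum_u (\sum_w W u w * phi u ^+ 2 + \sum_w W u w * phi w ^+ 2
        - 2 * \sum_w W u w * (phi u * phi w))).
      apply: eq_bigr => u _; rewrite mulr_sumr -big_split -sumrB /=.
      by apply: eq_bigr => w _; ring.
    rewrite sumrB big_split /= [X in _ + X - _]exchange_big /=.
    rewrite -big_split -sumrB /=; apply: eq_bigr => u _.
    under [X in _ + X - _]eq_bigr do rewrite W_sym.
    rewrite -mulr_suml -/(deg u) /g mulrBr.
    rewrite [X in _ - X](_ : _ = 2 * (phi u * \sum_w W u w * phi w)); first by ring.
    by congr (_ * _); rewrite mulr_sumr; apply: eq_bigr => w _; ring.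
  have ji : j != i by rewrite eq_sym.
  rewrite /g; under eq_bigr do rewrite lap.
  rewrite (bigD1 i) //= (bigD1 j) //= big1 ?addr0 => [|u].
    by rewrite !eqxx (negbTE ij) (negbTE ji) /=; ring.
  by case/andP => /negbTE -> /negbTE ->; rewrite subrr mul0r mulr0.
pose D := phi i - phi j - vol / deg i - vol / deg j.
have innerD : inner_energy phi <= 2 * vol * D.
  have si := star_ge (or_introl dlapi); have sj := star_ge (or_intror dlapj).
  have := energy_split phi; rewrite energyE => e.
  rewrite /D; move: e si sj; set E := inner_energy phi => e si sj.
  have -> : 2 * vol * (phi i - phi j - vol / deg i - vol / deg j) =
    2 * vol * (phi i - phi j) - 2 * (vol ^+ 2 / deg i) - 2 * (vol ^+ 2 / deg j) by ring.
  by rewrite e; lra.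
have D0 : 0 <= D.
  rewrite -(pmulr_rge0 _ (mulr_gt0 (ltr0n _ 2) vol_gt0)); apply: le_trans innerD.
  by do 2 apply: sumr_ge0 => ? _; rewrite mulr_ge0 // sqr_ge0.
have DE : (\sum_w W i w * phi w) / deg i - (\sum_w W j w * phi w) / deg j = D.
  rewrite /D.
  have -> : \sum_w W i w * phi w = deg i * phi i - vol.
    by rewrite -lapi; ring.
  have -> : \sum_w W j w * phi w = deg j * phi j + vol.
    by rewrite -[vol]opprK -lapj; ring.
  by field; rewrite !deg_neq0.
have D2 : D ^+ 2 <= M * (2 * vol * D).
  by rewrite -{1}DE; apply: le_trans (HM phi) _; rewrite ler_wpM2l.
(* D^2 <= 2 * M * vol * D is divided by D; the case D = 0 is separate. *)
have DM : D <= 2 * M * vol.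
  move: D0; rewrite le_eqVlt => /predU1P[<-|Dp]; first by rewrite !mulr_ge0 // ltW.
  by rewrite -(ler_pM2r Dp) -expr2; apply: le_trans D2 _; rewrite le_eqVlt; apply/orP; left; apply/eqP; ring.
rewrite CE; split=> //=.
have -> : (phi i - phi j) / vol - ((deg i)^-1 + (deg j)^-1) = D / vol.
  by rewrite /D; field; rewrite !deg_neq0 lt0r_neq0.
by rewrite divr_ge0 // ?ler_pdivrMr // ltW.
Qed.

End commute_distance_bound.

(** * Euclidean norm and cubic cells *)

Section euclidean_norm.
Context {R : realType} (d : nat).
Implicit Types x y z : 'rV[R]_d.

Lemma enorm_ge0 x : 0 <= enorm x. Proof. exact: sqrtr_ge0. Qed.

Let sumsq_ge0 x : 0 <= \sum_(l < d) x ord0 l ^+ 2.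
Proof. by apply: sumr_ge0 => l _; exact: sqr_ge0. Qed.

Lemma sqr_enorm x : enorm x ^+ 2 = \sum_(l < d) x ord0 l ^+ 2.
Proof. exact: sqr_sqrtr. Qed.

Lemma enormZ a x : enorm (a *: x) = `|a| * enorm x.
Proof.
rewrite /enorm -sqrtr_sqr -sqrtrM ?sqr_ge0 // mulr_sumr.
by congr Num.sqrt; apply: eq_bigr => l _; rewrite mxE exprMn.
Qed.

Lemma enormN x : enorm (- x) = enorm x.
Proof. by rewrite -scaleN1r enormZ normrN1 mul1r. Qed.

Lemma enormD x y : enorm (x + y) <= enorm x + enorm y.
Proof.
pose a := enorm x; pose b := enorm y.
have a0 : 0 <= a := enorm_ge0 x; have b0 : 0 <= b := enorm_ge0 y.
have CS : \sum_(l < d) x ord0 l * y ord0 l <= a * b.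
  have [ab0|ab0] := eqVneq (a * b) 0.
    have z0 (u : 'rV[R]_d) : enorm u = 0 -> forall l, u ord0 l = 0.
      move=> u0 l; have /eqP := sqr_enorm u; rewrite u0 expr0n /= eq_sym.
      rewrite psumr_eq0 => [/allP/(_ l)|k _]; last exact: sqr_ge0.
      by rewrite mem_index_enum sqrf_eq0 => /(_ isT)/eqP.
    rewrite ab0 big1 // => l _.
    by move/eqP: ab0; rewrite mulf_eq0 => /orP[] /eqP /z0 -> ; rewrite ?mul0r ?mulr0.
  have ab : 0 < a * b by rewrite lt_neqAle eq_sym ab0 mulr_ge0.
  have : 0 <= \sum_(l < d) (b * x ord0 l - a * y ord0 l) ^+ 2.
    by apply: sumr_ge0 => l _; exact: sqr_ge0.
  have sqE l : (b * x ord0 l - a * y ord0 l) ^+ 2 = b ^+ 2 * x ord0 l ^+ 2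
    + a ^+ 2 * y ord0 l ^+ 2 - 2 * (a * b) * (x ord0 l * y ord0 l) by ring.
  under eq_bigr do rewrite sqE.
  rewrite sumrB big_split /= -!mulr_sumr -!sqr_enorm -/a -/b.
  set c := \sum_(l < d) _ => h; rewrite -(ler_pM2l ab) -subr_ge0.
  by rewrite -(pmulr_rge0 _ (ltr0n _ 2)) (le_trans h) // le_eqVlt; apply/orP; left; apply/eqP; ring.
rewrite -(@ler_pXn2r _ 2) ?nnegrE ?addr_ge0 ?enorm_ge0 //.
rewrite sqr_enorm sqrrD -/a -/b [a ^+ 2]sqr_enorm [b ^+ 2]sqr_enorm.
have sqE l : (x + y) ord0 l ^+ 2 = x ord0 l ^+ 2 + 2 * (x ord0 l * y ord0 l) + y ord0 l ^+ 2.
  by rewrite mxE; ring.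
under eq_bigr do rewrite sqE.
by rewrite !big_split /= -mulr_sumr lerD2r lerD2l -[leRHS]mulr_natl ler_wpM2l.
Qed.

Lemma ler_coord_enorm x l : `|x ord0 l| <= enorm x.
Proof.
rewrite -sqrtr_sqr ler_sqrt // (bigD1 l) //= lerDl.
by apply: sumr_ge0 => k _; exact: sqr_ge0.
Qed.

Lemma ler_enorm_coord x c : 0 <= c -> (forall l, `|x ord0 l| <= c) ->
  enorm x <= Num.sqrt d%:R * c.
Proof.
move=> c0 xc; rewrite -{1}(ger0_norm c0) -sqrtr_sqr -sqrtrM ?ler0n //.
rewrite ler_sqrt ?mulr_ge0 ?ler0n ?sqr_ge0 //.
rewrite -[d in leRHS]card_ord mulr_natl -sumr_const; apply: ler_sum => l _.
by rewrite -real_normK ?num_real // lerXn2r ?nnegrE.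
Qed.

Lemma edistance_ge0 x y : 0 <= edistance x y. Proof. exact: enorm_ge0. Qed.

Lemma edistancexx x : edistance x x = 0.
Proof. by rewrite /edistance subrr -(scale0r (0 : 'rV[R]_d)) enormZ normr0 mul0r. Qed.

Lemma edistanceC x y : edistance x y = edistance y x.
Proof. by rewrite /edistance -enormN opprB. Qed.

Lemma edistance_triangle y x z : edistance x z <= edistance x y + edistance y z.
Proof. by rewrite /edistance (le_trans _ (enormD _ _)) // addrA subrK. Qed.

Lemma edistance_midpoint x y : edistance (2^-1 *: (x + y)) x = edistance x y / 2.
Proof.
rewrite /edistance (_ : _ - x = 2^-1 *: (y - x)).
  by rewrite enormZ ger0_norm ?invr_ge0 // -[y - x]opprB enormN mulrC.
by apply/rowP => l; rewrite !mxE; field.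
Qed.

Definition cell (s : R) (x : 'rV[R]_d) : 'rV[int]_d := \row_l Num.floor (x ord0 l / s).

Lemma cell_coord s x y l : 0 < s -> cell s x = cell s y ->
  `|x ord0 l - y ord0 l| < s.
Proof.
move=> s0 /rowP/(_ l); rewrite !mxE => e.
have := floor_le (x ord0 l / s); have := lt_succ_floor (x ord0 l / s).
have := floor_le (y ord0 l / s); have := lt_succ_floor (y ord0 l / s).
rewrite -e !intrD !ltr_pdivrMr // !ler_pdivlMr // => h1 h2 h3 h4.
by rewrite ltr_norml; apply/andP; split; lra.
Qed.

Lemma cell_edistance s x y : 0 < s -> cell s x = cell s y ->
  edistance x y <= Num.sqrt d%:R * s.
Proof.
move=> s0 e; apply: ler_enorm_coord; first exact: ltW.
by move=> l; rewrite !mxE ltW // cell_coord.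
Qed.

End euclidean_norm.

(** * Differences of averages against the energy *)

Section averages.
Context {R : realType} (n : nat) (W : 'M[R]_n) (i j : 'I_n).
Hypothesis W_ge0 : forall u w, 0 <= W u w.
Implicit Types (S : {set 'I_n}) (phi : 'I_n -> R).

Definition average S phi : R := (\sum_(k in S) phi k) / #|S|%:R.

(* Jensen's inequality for the random pair obtained by drawing a uniformly in J,
   then independent uniform points of S a and S' a: each pair (x, y) has
   probability at most r / (m * m'). *)
Lemma average_diff_sqr_le (I : finType) (J : {set I}) (S S' : I -> {set 'I_n})
    (m m' r : R) phi :
  (0 < #|J|)%N -> 0 < m -> 0 < m' -> 0 <= r ->
  (forall a, a \in J -> m <= #|S a|%:R) ->
  (forall a, a \in J -> m' <= #|S' a|%:R) ->
  (forall a x y, a \in J -> x \in S a -> y \in S' a ->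
     [/\ x \notin [:: i; j], y \notin [:: i; j] & x = y \/ 1 <= W x y]) ->
  (forall x y, #|[set a in J | (x \in S a) && (y \in S' a)]|%:R <= r * #|J|%:R) ->
  ((\sum_(a in J) (average (S a) phi - average (S' a) phi)) / #|J|%:R) ^+ 2
    <= r / (m * m') * inner_energy W i j phi.
Proof.
move=> J0 m0 m'0 r0 mS mS' SW Sr.
have JR0 : 0 < #|J|%:R :> R by rewrite ltr0n.
have cS a : a \in J -> 0 < #|S a|%:R :> R by move=> /mS; exact: lt_le_trans.
have cS' a : a \in J -> 0 < #|S' a|%:R :> R by move=> /mS'; exact: lt_le_trans.
(* The law of the random pair given [a]; [pi] is its mixture over [J], and [z] below is the mean
   potential drop under [pi]. *)
pose g a x y : R := (x \in S a)%:R * (y \in S' a)%:R / (#|S a|%:R * #|S' a|%:R).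
pose pi x y := (\sum_(a in J) g a x y) / #|J|%:R.
have g_ge0 a x y : 0 <= g a x y by rewrite /g divr_ge0 // mulr_ge0.
have pi_ge0 x y : 0 <= pi x y by apply: divr_ge0; [exact: sumr_ge0|exact: ltW].
have mem_sum (A : {set 'I_n}) (F : 'I_n -> R) :
    \sum_x (x \in A)%:R * F x = \sum_(x in A) F x.
  rewrite [RHS]big_mkcond; apply: eq_bigr => x _.
  by case: (x \in A); rewrite ?mul1r ?mul0r.
have piE (F : 'I_n -> 'I_n -> R) : \sum_x \sum_y pi x y * F x y =
    (\sum_(a in J) (\sum_(x in S a) \sum_(y in S' a) F x y)
        / (#|S a|%:R * #|S' a|%:R)) / #|J|%:R.
  rewrite /pi; under eq_bigr do under eq_bigr do rewrite mulrAC mulr_suml.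
  under eq_bigr do rewrite -mulr_suml exchange_big.
  rewrite -mulr_suml exchange_big; congr (_ / _); apply: eq_bigr => a _.
  rewrite -(mem_sum (S a)) mulr_suml; apply: eq_bigr => x _.
  rewrite -mem_sum -mulrA mulr_suml mulr_sumr; apply: eq_bigr => y _.
  by rewrite /g; ring.
have pi1 : \sum_x \sum_y pi x y = 1.
  transitivity (\sum_x \sum_y pi x y * 1).
    by do 2 (apply: eq_bigr => ? _); rewrite mulr1.
  rewrite piE (eq_bigr (fun=> 1)) => [|a aJ].
    by rewrite sumr_const divff // lt0r_neq0.
  by rewrite !sumr_const -[_ *+ #|S a|]mulr_natl divff // mulf_neq0 ?lt0r_neq0 ?cS ?cS'.
pose D x y := phi x - phi y.
have piD : \sum_x \sum_y pi x y * D x y =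
    (\sum_(a in J) (average (S a) phi - average (S' a) phi)) / #|J|%:R.
  rewrite piE; congr (_ / _); apply: eq_bigr => a aJ.
  rewrite /D; under eq_bigr do rewrite sumrB sumr_const.
  rewrite sumrB sumr_const.
  under eq_bigr do rewrite -[_ *+ _]mulr_natr.
  rewrite -mulr_suml -[X in _ - X]mulr_natr /average.
  by field; rewrite !lt0r_neq0 ?cS ?cS'.
rewrite -piD; set z := \sum_x _.
apply: (@le_trans _ _ (\sum_x \sum_y pi x y * D x y ^+ 2)).
  (* The variance of [D] under [pi] is nonnegative, which is Jensen's inequality for the square. *)
  have : 0 <= \sum_x \sum_y pi x y * (D x y - z) ^+ 2.
    by do 2 apply: sumr_ge0 => ? _; rewrite mulr_ge0 ?sqr_ge0.
  have sqE x y : pi x y * (D x y - z) ^+ 2 =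
    pi x y * D x y ^+ 2 - 2 * z * (pi x y * D x y) + z ^+ 2 * pi x y by ring.
  under eq_bigr do under eq_bigr do rewrite sqE.
  under eq_bigr do rewrite big_split sumrB -!mulr_sumr.
  rewrite big_split sumrB /= -!mulr_sumr pi1 -/z.
  by set q := \sum_x _; nra.
rewrite /inner_energy mulr_sumr [leRHS]big_mkcond; apply: ler_sum => x _.
rewrite [leRHS](_ : _ = \sum_y if (x \notin [:: i; j]) && (y \notin [:: i; j]) then
   r / (m * m') * (W x y * (phi x - phi y) ^+ 2) else 0); last first.
  case: (x \notin _); last by rewrite big1.
  rewrite mulr_sumr [LHS]big_mkcond /=; apply: eq_bigr => y _.
  by case: (y \notin _).
apply: ler_sum => y _.
have E0 : 0 <= r / (m * m') * (W x y * (phi x - phi y) ^+ 2).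
  by rewrite mulr_ge0 ?[0 <= _ * _ ^+ 2]mulr_ge0 ?sqr_ge0 // divr_ge0 // mulr_ge0 // ltW.
(* A pair met by no [a] has probability 0. For any other pair one such [a] supplies the edge, or the
   equality x = y that makes the term vanish. *)
have [/existsP[a /and3P[aJ xa ya]]|no] :=
    boolP [exists a, [&& a \in J, x \in S a & y \in S' a]]; last first.
  rewrite /pi big1 ?mul0r; last first.
    move=> a aJ; rewrite /g; move: no; rewrite negb_exists => /forallP/(_ a).
    by rewrite aJ /= negb_and => /orP[] /negbTE ->; rewrite ?mul0r ?mulr0 ?mul0r.
  by case: ifP.
have [-> -> xyW] := SW a x y aJ xa ya.
case: xyW => [->|W1] /=; first by rewrite /D subrr expr0n !mulr0.
apply: ler_pM => //; [exact: sqr_ge0| |by rewrite ler_peMl ?sqr_ge0].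
rewrite /pi ler_pdivrMr //.
(* Each [a] charging the pair gives it at most 1 / (m * m'), and at most [r * #|J|] of them do. *)
apply: (@le_trans _ _ (\sum_(a in J | (x \in S a) && (y \in S' a)) (m * m')^-1)).
  rewrite [leRHS]big_mkcondr /=; apply: ler_sum => b bJ.
  rewrite /g; case: (x \in S b); case: (y \in S' b);
    rewrite /= ?mul0r ?mulr0 ?mul0r ?mul1r ?mulr1 //.
  rewrite lef_pV2 ?posrE ?mulr_gt0 ?cS ?cS' // ler_pM ?mS ?mS' // ltW //.
have -> : \sum_(a in J | (x \in S a) && (y \in S' a)) (m * m')^-1 =
    #|[set a in J | (x \in S a) && (y \in S' a)]|%:R * (m * m')^-1.
  by rewrite mulr_natl -sumr_const; apply: eq_bigl => b; rewrite inE.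
by rewrite mulrAC ler_wpM2r // invr_ge0 mulr_ge0 // ltW.
Qed.

(** The square-root form, in which consecutive steps can be added by the triangle inequality. *)
Lemma average_diff_le (I : finType) (J : {set I}) (S S' : I -> {set 'I_n})
    (m m' r rho : R) phi :
  (0 < #|J|)%N -> 0 < m -> 0 < m' -> 0 <= r -> 0 <= rho -> r / (m * m') <= rho ^+ 2 ->
  (forall a, a \in J -> m <= #|S a|%:R) ->
  (forall a, a \in J -> m' <= #|S' a|%:R) ->
  (forall a x y, a \in J -> x \in S a -> y \in S' a ->
     [/\ x \notin [:: i; j], y \notin [:: i; j] & x = y \/ 1 <= W x y]) ->
  (forall x y, #|[set a in J | (x \in S a) && (y \in S' a)]|%:R <= r * #|J|%:R) ->
  `|(\sum_(a in J) (average (S a) phi - average (S' a) phi)) / #|J|%:R|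
    <= rho * Num.sqrt (inner_energy W i j phi).
Proof.
move=> J0 m0 m'0 r0 rho0 rrho mS mS' SW Sr.
have E0 : 0 <= inner_energy W i j phi.
  by do 2 apply: sumr_ge0 => ? _; rewrite mulr_ge0 ?sqr_ge0.
rewrite -(@ler_pXn2r _ 2) ?nnegrE ?mulr_ge0 ?sqrtr_ge0 //.
rewrite real_normK ?num_real // [leRHS]exprMn sqr_sqrtr //.
apply: le_trans (ler_wpM2r E0 rrho); exact: average_diff_sqr_le.
Qed.

End averages.

(** * Transport of averages along a random path of cells *)

Section random_path_flow.
Context {R : realType} (d n : nat) (x : 'I_n -> 'rV[R]_d) (eps s m : R) (i j : 'I_n).
Hypothesis s_gt0 : 0 < s.
Hypothesis s_eps : 8 * (Num.sqrt d%:R * s) <= eps.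
Hypothesis m_gt0 : 0 < m.
Hypothesis far : eps < edistance (x i) (x j).

Notation W := (eps_graph x eps).

(** Leaving out [i] and [j] keeps every edge used inside [inner_energy], and makes the counts
    independent of these two points. *)
Definition cell_points (q : 'rV[R]_d) : {set 'I_n} :=
  [set k | (k \notin [:: i; j]) && (cell s (x k) == cell s q)].

Definition neighbors (k : 'I_n) : {set 'I_n} := [set l | eps_edge x eps k l].

Lemma degree_neighbors k : degree W k = #|neighbors k|%:R.
Proof.
rewrite /degree -sumr_const [RHS]big_mkcond; apply: eq_bigr => l _.
by rewrite mxE inE; case: eps_edge.
Qed.

Lemma average_neighbors k phi :
  (\sum_w W k w * phi w) / degree W k = average (neighbors k) phi.
Proof.
rewrite degree_neighbors /average; congr (_ / _).
rewrite [RHS]big_mkcond; apply: eq_bigr => l _.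
by rewrite mxE inE; case: eps_edge; rewrite ?mul1r ?mul0r.
Qed.

Let D := Num.sqrt d%:R * s.
Let D_ge0 : 0 <= D. Proof. by rewrite mulr_ge0 ?sqrtr_ge0 // ltW. Qed.

Let W_ge0 u w : 0 <= W u w. Proof. by rewrite mxE. Qed.

Let close_edge k l : edistance (x k) (x l) <= eps -> k = l \/ 1 <= W k l.
Proof.
move=> kl; have [->|ne] := eqVneq k l; [by left|right].
by rewrite mxE /eps_edge /= ne kl.
Qed.

Let cell_points_close k q : k \in cell_points q ->
  k \notin [:: i; j] /\ edistance (x k) q <= D.
Proof. by rewrite inE => /andP[-> /eqP]; split => //; exact: cell_edistance. Qed.

(** A cell has diameter at most eps/8, and eps/8 + eps/2 + eps/8 <= eps. *)
Let cell_points_edge k l q q' : edistance q q' <= eps / 2 ->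
  k \in cell_points q -> l \in cell_points q' ->
  [/\ k \notin [:: i; j], l \notin [:: i; j] & k = l \/ 1 <= W k l].
Proof.
move=> qq' /cell_points_close[ki kq] /cell_points_close[li lq]; split=> //.
apply: close_edge.
have h1 := edistance_triangle q (x k) (x l).
have h2 := edistance_triangle q' q (x l).
by move: lq D_ge0 s_eps; rewrite edistanceC -/D => lq D0 s8; lra.
Qed.

Section endpoint.
Variable c : 'I_n.
Hypothesis c_end : c \in [:: i; j].
Hypothesis c_count : m <= #|cell_points (x c)|%:R.
Let mid k := 2^-1 *: (x c + x k).
Hypothesis mid_count :
  forall k, edistance (x c) (x k) <= eps -> m <= #|cell_points (mid k)|%:R.

Let neighbor_inner k : k \in neighbors c ->
  k \notin [:: i; j] /\ edistance (x c) (x k) <= eps.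
Proof.
rewrite inE /eps_edge /= => /andP[ck cke]; split => //.
move: c_end ck cke; rewrite !inE => /orP[] /eqP ->; rewrite [_ == k]eq_sym => /negbTE -> /=; rewrite ?orbF.
  by apply: contraTneq => ->; rewrite -ltNge.
by apply: contraTneq => ->; rewrite -ltNge edistanceC.
Qed.

Let cell_sub : cell_points (x c) \subset neighbors c.
Proof.
apply/fintype.subsetP => k kc; have [ki kd] := cell_points_close kc.
rewrite inE /eps_edge /= edistanceC (le_trans kd) ?andbT; last by move: D_ge0 s_eps; rewrite -/D; lra.
by apply: contraNneq ki => <-.
Qed.

Let degree_ge : m <= #|neighbors c|%:R.
Proof. by apply: le_trans c_count _; rewrite ler_nat subset_leq_card. Qed.

Let degree_pos : (0 < #|neighbors c|)%N.
Proof. by rewrite -(ltr0n R); exact: lt_le_trans degree_ge. Qed.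

(** A neighbour of [c] may be at distance eps, too far to be adjacent to all points of the cell of
    [x c]. The comparison therefore goes through the cell of the midpoint, at distance at most eps/2
    from both. Each half costs 1/m. *)
Lemma endpoint_average_bound phi :
  `|average (neighbors c) phi - average (cell_points (x c)) phi|
    <= 2 / m * Num.sqrt (inner_energy W i j phi).
Proof.
set E := Num.sqrt _; set N := neighbors c; have N0 := degree_pos.
have NR : #|N|%:R != 0 :> R by rewrite pnatr_eq0 -lt0n.
have im0 : 0 <= m^-1 by rewrite invr_ge0 ltW.
have step1 : `|(\sum_(k in N) (average [set k] phi - average (cell_points (mid k)) phi))
     / #|N|%:R| <= m^-1 * E.
  (* A given neighbour is drawn with probability 1/#|N|, at most 1/m since the cell of [x c]
     consists of neighbours of [c]. *)
  apply: (@average_diff_le _ _ _ i j W_ge0 _ N _ _ 1 m (#|N|%:R)^-1) => //.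
  - rewrite mul1r expr2 ler_wpM2r // lef_pV2 ?posrE ?ltr0n //.
  - by move=> k _; rewrite cards1.
  - by move=> k /neighbor_inner[_]; exact: mid_count.
  - move=> k k' l /neighbor_inner[ki ke] /set1P -> lk.
    have [li ld] := cell_points_close lk; split=> //; apply: close_edge.
    rewrite edistanceC; apply: le_trans (edistance_triangle (mid k) _ _) _.
    have -> : edistance (mid k) (x k) = edistance (x c) (x k) / 2.
      by rewrite /mid addrC edistance_midpoint edistanceC.
    by move: ld ke s_eps D_ge0; rewrite -/D; lra.
  move=> k l; rewrite mulVf // -[leRHS]/(1%:R) ler_nat -(cards1 k) subset_leq_card //.
  by apply/fintype.subsetP => a; rewrite !inE => /and3P[_ /eqP -> _].
have step2 : `|(\sum_(k in N) (average (cell_points (mid k)) phi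
      - average (cell_points (x c)) phi)) / #|N|%:R| <= m^-1 * E.
  (* The trivial collision bound r = 1 is enough here, because both sets have at least [m]
     points. *)
  apply: (@average_diff_le _ _ _ i j W_ge0 _ N _ _ m m 1) => //.
  - by rewrite mul1r invfM expr2.
  - by move=> k /neighbor_inner[_]; exact: mid_count.
  - move=> k l l' /neighbor_inner[_ ke]; apply: cell_points_edge.
    by rewrite edistance_midpoint ler_pM2r ?invr_gt0.
  - by move=> k l; rewrite mul1r ler_nat subset_leq_card //; apply/fintype.subsetP => a; rewrite inE => /andP[].
have -> : average N phi - average (cell_points (x c)) phi =
   (\sum_(k in N) (average [set k] phi - average (cell_points (mid k)) phi)) / #|N|%:R +
   (\sum_(k in N) (average (cell_points (mid k)) phi
      - average (cell_points (x c)) phi)) / #|N|%:R.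
  rewrite -mulrDl -big_split /=.
  under eq_bigr do rewrite addrA subrK {1}/average big_set1 cards1 divr1.
  rewrite sumrB mulrBl; congr (_ - _).
  by rewrite sumr_const -[_ *+ _]mulr_natr mulfK.
apply: le_trans (ler_normD _ _) _; rewrite (_ : 2 / m * E = m^-1 * E + m^-1 * E); last by ring.
exact: lerD.
Qed.

End endpoint.

(** [u] is uniform in [U], and all paths share their end points. The 4 is made of 2/m at each end,
    from passing between neighbours and the cell of the end point. *)
Lemma random_path_flow (U : finType) (T : nat) (q : nat -> U -> 'rV[R]_d)
    (rho : nat -> R) phi :
  (0 < #|U|)%N ->
  (forall u, q 0 u = x i) -> (forall u, q T u = x j) ->
  (forall t u, (t < T)%N -> edistance (q t u) (q t.+1 u) <= eps / 2) ->
  (forall t u, (t <= T)%N -> m <= #|cell_points (q t u)|%:R) ->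
  (forall c k, c \in [:: i; j] -> edistance (x c) (x k) <= eps ->
     m <= #|cell_points (2^-1 *: (x c + x k))|%:R) ->
  (forall t, 0 <= rho t) ->
  (forall t z, (t < T)%N ->
     #|[set u | cell s (q t u) == z]%SET|%:R <= rho t ^+ 2 * #|U|%:R) ->
  ((\sum_w W i w * phi w) / degree W i - (\sum_w W j w * phi w) / degree W j) ^+ 2
    <= ((4 + \sum_(t < T) rho t) / m) ^+ 2 * inner_energy W i j phi.
Proof.
move=> U0 q0 qT qstep qcount midcount rho0 coll.
rewrite !average_neighbors.
have E0 : 0 <= inner_energy W i j phi.
  by do 2 apply: sumr_ge0 => ? _; rewrite mulr_ge0 ?sqr_ge0.
have im0 : 0 <= m^-1 by rewrite invr_ge0 ltW.
rewrite -[inner_energy _ _ _ _]sqr_sqrtr // -exprMn.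
set E := Num.sqrt _.
have [u0 _] := card_gt0P U0.
have UR : #|U|%:R != 0 :> R by rewrite pnatr_eq0 -lt0n.
pose Phi t u := average (cell_points (q t u)) phi.
have step t : (t < T)%N ->
    `|(\sum_(u in [set: U]%SET) (Phi t u - Phi t.+1 u)) / #|[set: U]%SET|%:R| <= rho t / m * E.
  move=> tT; apply: (@average_diff_le _ _ _ i j W_ge0 _ _ (fun u => cell_points (q t u))
    (fun u => cell_points (q t.+1 u)) m m (rho t ^+ 2)) => //.
  - by rewrite cardsT.
  - exact: sqr_ge0.
  - by rewrite divr_ge0 // ltW.
  - by rewrite expr_div_n -expr2.
  - by move=> u _; apply: qcount; exact: ltnW.
  - by move=> u _; exact: qcount.
  - by move=> u k l _; apply: cell_points_edge; exact: qstep.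
  (* Only the first point of the pair is used: the path must sit in its cell at time [t]. *)
  move=> k l; rewrite cardsT; apply: le_trans (coll t (cell s (x k)) tT).
  rewrite ler_nat subset_leq_card //; apply/fintype.subsetP => u; rewrite !inE /=.
  by case/andP => /andP[_ /eqP ->]; rewrite eqxx.
(* For each [u] the sum over time telescopes to the same value, since the end points do not depend
   on [u]. *)
have tele : \sum_(t < T) (\sum_(u in [set: U]%SET) (Phi t u - Phi t.+1 u)) / #|[set: U]%SET|%:R =
    average (cell_points (x i)) phi - average (cell_points (x j)) phi.
  rewrite -mulr_suml exchange_big /=.
  rewrite (eq_bigr (fun=> average (cell_points (x i)) phi - average (cell_points (x j)) phi)).
    by rewrite sumr_const cardsT -[_ *+ _]mulr_natr mulfK.
  move=> u _; rewrite -(big_mkord xpredT (fun t => Phi t u - Phi t.+1 u)).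
  rewrite -[LHS]opprK -sumrN; under eq_bigr do rewrite opprB.
  by rewrite telescope_sumr // /Phi q0 qT opprB.
have endb c : c \in [:: i; j] -> m <= #|cell_points (x c)|%:R ->
    `|average (neighbors c) phi - average (cell_points (x c)) phi| <= 2 / m * E.
  by move=> cij cm; apply: endpoint_average_bound => // k; exact: midcount.
have endi := endb i (mem_head _ _) _.
have endj := endb j _ _.
rewrite -[leLHS]real_normK ?num_real // lerXn2r ?nnegrE //.
  by rewrite mulr_ge0 ?sqrtr_ge0 // mulr_ge0 // addr_ge0 // sumr_ge0.
have -> : average (neighbors i) phi - average (neighbors j) phi =
   (average (neighbors i) phi - average (cell_points (x i)) phi) +
   \sum_(t < T) (\sum_(u in [set: U]%SET) (Phi t u - Phi t.+1 u)) / #|[set: U]%SET|%:R -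
   (average (neighbors j) phi - average (cell_points (x j)) phi).
  by rewrite tele; ring.
apply: le_trans (ler_normB _ _) _.
rewrite (_ : _ * E = 2 / m * E + (\sum_(t < T) rho t) / m * E + 2 / m * E); last by ring.
apply: lerD; last by apply: endj; rewrite ?inE ?eqxx ?orbT // -(qT u0) qcount.
apply: le_trans (ler_normD _ _) _; apply: lerD.
  by apply: endi; rewrite -(q0 u0) qcount.
apply: le_trans (ler_norm_sum _ _ _) _; rewrite !mulr_suml.
by apply: ler_sum => t _; exact: step.
Qed.

End random_path_flow.

(** * Sums of the step costs *)

Section ramp_sums.
Context {R : realType}.

(** The grid size at step [t]: 0 at both ends, changing by at most 1 per step, and capped at [K],
    where the translation has length of order h. *)
Definition ramp (K T t : nat) : nat := minn t (minn K (T - t)).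

(* The square root of the probability that a random point of a cubic grid with
   a ^ d cells lies in a given cell, up to a constant; maxn only guards a = 0. *)
Definition spread (d a : nat) : R := Num.sqrt ((2 / (maxn a 1)%:R) ^+ d).

Lemma spread_ge0 d a : 0 <= spread d a. Proof. exact: sqrtr_ge0. Qed.

Let spreadE d a : (0 < a)%N -> spread d a = Num.sqrt (2 ^+ d) * Num.sqrt (a%:R ^- d).
Proof.
by move=> a0; rewrite /spread (maxn_idPl a0) expr_div_n sqrtrM ?exprn_ge0.
Qed.

Let spread0 d : spread d 0 = Num.sqrt (2 ^+ d).
Proof. by rewrite /spread max0n divr1. Qed.

(** The minimum is one of its three arguments, and the costs are nonnegative. *)
Let spread_ramp d K T t : spread d (ramp K T t) <= spread d t + spread d (T - t) + spread d K.
Proof.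
have [s1 s2 s3] := And3 (spread_ge0 d t) (spread_ge0 d (T - t)) (spread_ge0 d K).
rewrite /ramp; case: (leqP t (minn K (T - t))) => _; first by rewrite -addrA lerDl addr_ge0.
case: (leqP K (T - t)) => _; last by rewrite addrAC lerDr addr_ge0.
by rewrite lerDr addr_ge0.
Qed.

Let sqrt_step (t : nat) : (Num.sqrt t.+1%:R)^-1 <= 2 * (Num.sqrt t.+1%:R - Num.sqrt t%:R) :> R.
Proof.
set a := Num.sqrt _; set b := Num.sqrt _.
have a0 : 0 < a by rewrite sqrtr_gt0 ltr0n.
have b0 : 0 <= b := sqrtr_ge0 _.
have ab : a ^+ 2 = b ^+ 2 + 1 by rewrite !sqr_sqrtr ?ler0n // natr1.
by rewrite -(ler_pM2l a0) divff ?lt0r_neq0 //; nra.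
Qed.

Let sum_inv_sqrt (T : nat) : \sum_(t < T) (Num.sqrt t.+1%:R)^-1 <= 2 * Num.sqrt T%:R :> R.
Proof.
elim: T => [|T IH]; first by rewrite big_ord0 sqrtr0 mulr0.
by rewrite big_ord_recr /=; have := sqrt_step T; lra.
Qed.

(** A discrete form of the antiderivative -2 / sqrt t of t^(-3/2), so that the sum telescopes;
    [sqrt_step] does the same for 1 / sqrt t. *)
Let sqrt_step3 (t : nat) : (0 < t)%N -> Num.sqrt (t.+1%:R ^- 3) <=
  2 * ((Num.sqrt t%:R)^-1 - (Num.sqrt t.+1%:R)^-1) :> R.
Proof.
move=> t0; rewrite sqrtrV ?exprn_ge0 // exprS sqrtrM ?ler0n // sqrtr_sqr ger0_norm ?ler0n //.
set a := Num.sqrt t.+1%:R; set b := Num.sqrt t%:R.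
have a0 : 0 < a by rewrite sqrtr_gt0 ltr0n.
have b0 : 0 < b by rewrite sqrtr_gt0 ltr0n.
have ta : t.+1%:R = a ^+ 2 by rewrite sqr_sqrtr ?ler0n.
have ab : a ^+ 2 = b ^+ 2 + 1 by rewrite !sqr_sqrtr ?ler0n // natr1.
have ba : b <= a by rewrite ler_sqrt ?ler0n // ler_nat.
rewrite ta -[leLHS]mul1r ler_pdivrMr ?mulr_gt0 ?exprn_gt0 //.
have -> : 2 * (b^-1 - a^-1) * (a * a ^+ 2) = 2 * (a - b) * a ^+ 2 / b.
  by field; rewrite !lt0r_neq0.
rewrite ler_pdivlMr // mul1r.
have e : (a - b) * (a + b) = 1 by ring: ab.
have h : (a - b) * (a + b) <= (a - b) * (2 * a) by rewrite ler_wpM2l ?subr_ge0 //; lra.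
apply: (le_trans ba); rewrite -[leLHS]mul1r expr2 mulrA; apply: ler_wpM2r; first exact: ltW.
by move: h; rewrite e (_ : 2 * (a - b) * a = (a - b) * (2 * a)) //; ring.
Qed.

Let sum_sqrt3 (T : nat) : \sum_(t < T) Num.sqrt (t.+1%:R ^- 3) <= 3 :> R.
Proof.
suff H (n : nat) : \sum_(t < n.+1) Num.sqrt (t.+1%:R ^- 3) <= 3 - 2 / Num.sqrt n.+1%:R :> R.
  case: T => [|T]; first by rewrite big_ord0.
  by apply: le_trans (H T) _; rewrite gerBl divr_ge0 ?sqrtr_ge0.
elim: n => [|n IH].
  by rewrite big_ord1 /= !(mulr1n, expr1n, invr1, sqrtr1); lra.
by rewrite big_ord_recr /=; have := sqrt_step3 (ltn0Sn n); lra.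
Qed.

Let sqrt_invn (d e a : nat) : (0 < a)%N -> (e <= d)%N ->
  Num.sqrt (a%:R ^- d) <= Num.sqrt (a%:R ^- e) :> R.
Proof.
move=> a0 ed; rewrite ler_sqrt ?invr_ge0 ?exprn_ge0 ?ler0n //.
by rewrite lef_pV2 ?posrE ?exprn_gt0 ?ltr0n // ler_weXn2l // ler1n.
Qed.

(** The two slopes give the sum of t^(-d/2). The plateau gives at most T * K^(-d/2), up to a
    constant, which stays bounded because d >= 2 and T is of order K. *)
Lemma ramp_sum (d : nat) (CT : R) : (2 <= d)%N -> 0 <= CT ->
  exists2 C0 : R, 0 < C0 & forall K T : nat, (0 < K)%N -> T%:R <= CT * K%:R ->
    (4 + \sum_(t < T) spread d (ramp K T t)) ^+ 2
      <= C0 * (if d == 2%N then K%:R else 1).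
Proof.
move=> d2 CT0; pose b : R := Num.sqrt (2 ^+ d).
have b0 : 0 <= b := sqrtr_ge0 _.
pose S T : R := \sum_(t < T) Num.sqrt (t.+1%:R ^- d).
have sumS T : \sum_(t < T) spread d t <= b * (1 + S T).
  case: T => [|T]; first by rewrite big_ord0 /S big_ord0 addr0 mulr1.
  rewrite big_ord_recl spread0 /= mulrDr mulr1 lerD2l mulr_sumr /S big_ord_recr /=.
  rewrite ler_wpDr ?mulr_ge0 ?sqrtr_ge0 //.
  by apply: ler_sum => t _; rewrite spreadE.
have sumS' T : \sum_(t < T) spread d (T - t) <= b * S T.
  rewrite /S mulr_sumr (reindex_inj rev_ord_inj) /=; apply: ler_sum => t _.
  by rewrite subKn ?ltn_ord // spreadE.
have sumR K T : (0 < K)%N ->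
    \sum_(t < T) spread d (ramp K T t) <= b * (1 + 2 * S T + T%:R * Num.sqrt (K%:R ^- d)).
  move=> K0; apply: (@le_trans _ _ (\sum_(t < T) (spread d t + spread d (T - t) + spread d K))).
    by apply: ler_sum => t _; exact: spread_ramp.
  rewrite !big_split /= sumr_const card_ord -[_ *+ _]mulr_natl [X in _ + T%:R * X]spreadE //.
  by have := sumS T; have := sumS' T; rewrite -/b; lra.
have KK (K : nat) : (0 < K)%N -> K%:R * Num.sqrt (K%:R ^- d) <= 1 :> R.
  move=> K0; apply: (@le_trans _ _ (K%:R * Num.sqrt (K%:R ^- 2))).
    by rewrite ler_wpM2l ?ler0n // sqrt_invn.
  by rewrite -exprVn sqrtr_sqr ger0_norm ?invr_ge0 ?ler0n // divff // pnatr_eq0 -lt0n.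
have TK K T : (0 < K)%N -> T%:R <= CT * K%:R -> T%:R * Num.sqrt (K%:R ^- d) <= CT.
  move=> K0 TK; apply: (@le_trans _ _ (CT * K%:R * Num.sqrt (K%:R ^- d))).
    by rewrite ler_wpM2r ?sqrtr_ge0.
  by rewrite -mulrA ler_piMr // KK.
have [d2E|dN2] := eqVneq d 2%N.
- pose c := 4 + b * (1 + 4 * Num.sqrt CT + CT).
  have c4 : 4 <= c by rewrite /c lerDl mulr_ge0 // !addr_ge0 ?mulr_ge0 ?sqrtr_ge0.
  exists (c ^+ 2); first by rewrite exprn_gt0 // (lt_le_trans _ c4).
  move=> K T K0 hT.
  (* For d = 2 the terms are 1/t, with a logarithmic sum. Comparing them with 1 / sqrt t costs a
     factor K after squaring, which the rate 1/(n eps^3) allows. *)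
  have ST : S T <= 2 * Num.sqrt T%:R.
    apply: le_trans (sum_inv_sqrt T); apply: ler_sum => t _.
    by rewrite -sqrtrV ?ler0n // -[X in _ <= Num.sqrt X^-1]expr1 sqrt_invn // (leq_trans _ d2).
  have sqK : 1 <= Num.sqrt K%:R :> R by rewrite -[leLHS]sqrtr1 ler_sqrt ?ler0n // ler1n.
  have sT : Num.sqrt T%:R <= Num.sqrt CT * Num.sqrt K%:R.
    by rewrite -sqrtrM // ler_sqrt // mulr_ge0 ?ler0n.
  have := sumR K T K0; have := TK K T K0 hT; set A := _ * Num.sqrt (K%:R ^- d) => hA hs.
  rewrite -[X in c ^+ 2 * X](sqr_sqrtr (ler0n R K)) -exprMn lerXn2r ?nnegrE //.
  + by rewrite addr_ge0 // sumr_ge0 // => t _; exact: spread_ge0.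
  + by rewrite mulr_ge0 ?sqrtr_ge0 // (le_trans _ c4).
  rewrite /c mulrDl; apply: lerD; first by rewrite ler_peMr.
  apply: le_trans hs _; rewrite -mulrA ler_wpM2l // !mulrDl mul1r.
  have hC : CT <= CT * Num.sqrt K%:R by rewrite ler_peMr.
  by move: ST sT hA hC sqK; lra.
pose c := 4 + b * (7 + CT).
exists (c ^+ 2).
  by rewrite exprn_gt0 // /c ltr_wpDr // mulr_ge0 // addr_ge0.
move=> K T K0 hT.
have d3 : (3 <= d)%N by rewrite ltn_neqAle eq_sym dN2.
have ST : S T <= 3.
  by apply: le_trans (sum_sqrt3 T); apply: ler_sum => t _; exact: sqrt_invn.
have := sumR K T K0; have := TK K T K0 hT; set A := _ * Num.sqrt (K%:R ^- d) => hA hs.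
rewrite mulr1 lerXn2r ?nnegrE //.
+ by rewrite addr_ge0 // sumr_ge0 // => t _; exact: spread_ge0.
+ by rewrite /c addr_ge0 // mulr_ge0 // addr_ge0.
rewrite /c lerD2l; apply: le_trans hs _; rewrite ler_wpM2l //.
by move: ST hA; lra.
Qed.

End ramp_sums.

(** * Euclidean balls: topology, measurability, connectedness *)

Section euclidean_topology.
Context {R : realType} (d : nat).
Implicit Types (x y z : 'rV[R]_d) (A X : set 'rV[R]_d).

Lemma nbhs_eball x A : (nbhs x) A <-> exists2 r : R, 0 < r & eball x r `<=` A.
Proof.
split=> [/nbhs_ballP[e /= e0 xA]|[r r0 rA]].
  exists e => // y xy; apply: xA; split => // a b; rewrite (ord1 a) /ball /=.
  by have := ler_coord_enorm (x - y) b; rewrite !mxE; move/le_lt_trans; exact.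
(* The sup norm and the Euclidean norm differ by at most sqrt d; adding 1 keeps [c] positive and the
   inequality strict. *)
apply/nbhs_ballP; pose c := Num.sqrt d%:R + 1 : R.
have c0 : 0 < c by rewrite ltr_wpDl ?sqrtr_ge0.
exists (r / c) => /= [|y xy]; first exact: divr_gt0.
apply: rA; apply: (@le_lt_trans _ _ (Num.sqrt d%:R * (r / c))).
  apply: ler_enorm_coord => [|l]; first by rewrite divr_ge0 // ltW.
  by have := xy.2 ord0 l; rewrite /ball /= !mxE => /ltW.
by rewrite mulrCA gtr_pMr // ltr_pdivrMr // mul1r ltrDl.
Qed.

Lemma open_eball x r : open (eball x r).
Proof.
rewrite openE => y xy; apply/nbhs_eball; exists (r - edistance x y).
  by rewrite subr_gt0.
move=> z yz; apply: le_lt_trans (edistance_triangle y x z) _.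
by move: yz; rewrite /eball /= ltrBrDl.
Qed.

(** The sigma-algebra is generated by the coordinates, so an open set is written as the union of the
    countably many open boxes with rational data that it contains. *)
Lemma open_measurable_rV A :
  (forall x, A x -> exists2 r : R, 0 < r & eball x r `<=` A) -> measurable A.
Proof.
move=> oA; pose box (c : 'rV[rat]_d) (q : rat) : set 'rV[R]_d :=
  [set y | forall l, `](ratr (c ord0 l - q) : R), ratr (c ord0 l + q)[%classic (y ord0 l)].
have mbox c q : measurable (box c q).
  rewrite (_ : box c q = \bigcap_(l in setT)
      (rV_coord l @^-1` `](ratr (c ord0 l - q) : R), ratr (c ord0 l + q)[%classic)).
    apply: fin_bigcap_measurable => // l _; rewrite -[X in measurable X]setTI.
    by apply: measurable_rV_coord => //; exact: measurable_itv.
  by apply/seteqP; split=> [y yb l _|y yb l]; [exact: yb|exact: (yb l I)].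
pose F (k : 'rV[rat]_d * rat) : set 'rV[R]_d :=
  if `[< box k.1 k.2 `<=` A >] then box k.1 k.2 else set0.
rewrite (_ : A = \bigcup_k F k).
  apply: countable_bigcupT_measurable => [|k]; first exact: countableP.
  rewrite /F.
  by case: asboolP.
apply/seteqP; split=> [x Ax|x [k _]]; last first.
  by rewrite /F; case: asboolP => // + ?; exact.
have [r r0 rA] := oA x Ax.
pose c := Num.sqrt d%:R + 1 : R.
have c0 : 0 < c by rewrite ltr_wpDl ?sqrtr_ge0.
(* The rational centre is within [q] of [x] in each coordinate, so the box stays within 2q of [x];
   hence the bound r / (2c). *)
have [q] := rat_in_itvoo (divr_gt0 r0 (mulr_gt0 (ltr0n _ 2) c0)).
rewrite in_itv /= => /andP[q0 qr].
have [u hu] : exists u : 'rV[rat]_d, forall l, `|x ord0 l - ratr (u ord0 l)| < ratr q.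
  have H l : exists v : rat, `|x ord0 l - ratr v| < ratr q.
    have [|v] := @rat_in_itvoo R (x ord0 l - ratr q) (x ord0 l + ratr q).
      by rewrite ltrBlDr -addrA ltrDl addr_gt0.
    rewrite in_itv /= => /andP[h1 h2]; exists v.
    by rewrite ltr_norml; apply/andP; split; lra.
  by have [v hv] := choice H; exists (\row_l v l) => l; rewrite mxE.
exists (u, q) => //; rewrite /F /=; case: asboolP => [_ l|]; rewrite ?in_itv /=.
  have := hu l; rewrite /= in_itv /= raddfB raddfD ltr_norml => /andP[h1 h2].
  by apply/andP; split; lra.
case=> y ybox; apply: rA; rewrite /eball /=.
apply: (@le_lt_trans _ _ (Num.sqrt d%:R * (2 * ratr q))).
  apply: ler_enorm_coord => [|l]; first by rewrite mulr_ge0 // ltW.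
  have := hu l; have := ybox l; rewrite /= in_itv /= raddfB raddfD !mxE !ltr_norml.
  by case/andP => h1 h2 /andP[h3 h4]; rewrite ler_norml; apply/andP; split; lra.
have h : 2 * ratr q < r / c.
  by move: qr; rewrite !ltr_pdivlMr ?mulr_gt0 // (_ : 2 * _ * c = ratr q * (2 * c)) //; ring.
apply: le_lt_trans (ler_wpM2l (sqrtr_ge0 _) (ltW h)) _.
by rewrite mulrCA gtr_pMr // ltr_pdivrMr // mul1r ltrDl.
Qed.

Lemma measurable_eball x r : measurable (eball x r).
Proof.
apply: open_measurable_rV => y xy; have := @open_eball x r.
by rewrite openE => /(_ _ xy) /nbhs_eball.
Qed.

Lemma dist_to_setP x A r :
  (r%:E <= dist_to_set x A)%E <-> forall y, A y -> r <= edistance x y.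
Proof.
split=> [h y Ay|h].
  by rewrite -lee_fin (le_trans h) //; apply: ereal_inf_lbound; exists y.
by apply: le_ereal_inf_tmp => _ [y Ay <-]; rewrite lee_fin h.
Qed.

(** The segment from [x] to a point of the ball avoids the frontier. On it [X] agrees with both its
    interior and its closure, so it is open and closed there and contains the whole connected
    segment. *)
Lemma eball_sub_region X x r : X x ->
  (forall y, frontier X y -> r <= edistance x y) -> eball x r `<=` X.
Proof.
move=> Xx far y xy.
pose S := [set x + t *: (y - x) | t in `[0, 1]%classic] : set 'rV[R]_d.
have cS : connected S.
  apply: connected_continuous_connected; first exact: segment_connected.
  apply: continuous_subspaceT => t; apply: cvgD; first exact: cvg_cst.
  by apply: cvgZr_tmp; exact: cvg_id.
have nF z : S z -> ~ frontier X z.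
  move=> [t /=]; rewrite in_itv /= => /andP[t0 t1] <- /far; apply/negP; rewrite -ltNge.
  apply: le_lt_trans xy; rewrite /edistance (_ : x - _ = - t *: (y - x)).
    by rewrite enormZ normrN ger0_norm // -[x - y]opprB enormN ler_piMl ?enorm_ge0.
  by rewrite opprD addNKr scaleNr.
have Sx : S x by exists 0; rewrite /= ?in_itv /= ?lexx ?ler01 // scale0r addr0.
have Sy : S y by exists 1; rewrite /= ?in_itv /= ?lexx ?ler01 // scale1r addrC subrK.
suff e : S `&` X = S by move: Sy; rewrite -e => -[].
apply: cS; first by exists x.
- exists X°; first exact: open_interior.
  apply/seteqP; split=> z [Sz zX]; split => //; last exact: interior_subset.
  by apply: contrapT => nz; apply: (nF z Sz); split => //; exact: subset_closure.
exists (closure X); first exact: closed_closure.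
apply/seteqP; split=> z [Sz zX]; split => //; first exact: subset_closure.
by apply: interior_subset; apply: contrapT => nz; exact: (nF z Sz).
Qed.

(** Otherwise the [r]-balls around the net points reachable from [k], and those around the others,
    would split [X] into two disjoint open pieces. *)
Lemma connected_net X (N : nat) (y : 'I_N -> 'rV[R]_d) r :
  connected X -> (forall k, X (y k)) -> 0 < r ->
  (forall x, X x -> exists k, edistance x (y k) < r) ->
  forall k l, connect [rel a b | edistance (y a) (y b) < 2 * r] k l.
Proof.
move=> cX Xy r0 cover k l; set e := [rel a b | _].
pose U := \bigcup_(a in [set a | connect e k a]) eball (y a) r.
pose V := \bigcup_(a in [set a | ~~ connect e k a]) eball (y a) r.
have oU : open U by apply: bigcup_open => a _; exact: open_eball.
have oV : open V by apply: bigcup_open => a _; exact: open_eball.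
have yball a : eball (y a) r (y a) by rewrite /eball /= edistancexx.
have XUV : X `&` U = X `&` ~` V.
  apply/seteqP; split=> z [Xz]; last first.
    move=> nV; split => //; have [a za] := cover z Xz; exists a.
      apply: contrapT => /= /negP ka; apply: nV; exists a => //.
      by rewrite /eball /= edistanceC.
    by rewrite /eball /= edistanceC.
  move=> [a /= ka az]; split => // -[b /= /negP kb bz]; apply: kb.
  apply: (connect_trans ka); apply: connect1.
  rewrite /e /=; apply: le_lt_trans (edistance_triangle z _ _) _.
  by rewrite [edistance z _]edistanceC mulr_natl ltrD.
have : X `&` U = X.
  apply: cX; first by exists (y k); split => //; exists k => //=; exact: connect0.
  - by exists U.
  - by exists (~` V) => //; exact: open_closedC.
move=> e1; apply: contrapT => /negP kl.
have [_] : (X `&` ~` V) (y l) by rewrite -XUV e1; exact: Xy.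
by apply; exists l.
Qed.

End euclidean_topology.

(** * Volumes of cells and balls, and packings bounded by mass *)

Section affine_volume.
Context {R : realType}.

(** The push-forward by the affine map, multiplied by [a], has the right value on intervals, hence
    is Lebesgue measure by uniqueness. *)
Lemma lebesgue_measure_affine (a c : R) (A : set (measurableTypeR R)) :
  0 < a -> measurable A ->
  lebesgue_measure ((fun x : measurableTypeR R => a * x + c : measurableTypeR R) @^-1` A)
    = (a^-1%:E * lebesgue_measure A)%E.
Proof.
move=> a0 mA; pose f := fun x : measurableTypeR R => (a * x + c : measurableTypeR R).
have mf : measurable_fun setT f.
  by apply: continuous_measurable_fun => x; apply: cvgD;
    [apply: cvgMr; exact: cvg_id|exact: cvg_cst].
have := @lebesgue_measure_unique R (mscale (NngNum (ltW a0))
  (pushforward lebesgue_measure f)).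
move=> /(_ mf) H; rewrite (H _ A mA); last first.
  move=> _ [[u v] _ <-]; transitivity (a%:E * lebesgue_measure (f @^-1` `]u, v]))%E; last by [].
  rewrite (_ : f @^-1` _ = `](u - c) / a, (v - c) / a]%classic); last first.
    apply/seteqP; split=> x; rewrite /= !in_itv /= /f ltr_pdivrMr // ler_pdivlMr //;
      by rewrite ltrBlDr lerBrDr mulrC.
  rewrite !lebesgue_measure_itv /= !lte_fin ltr_pM2r ?invr_gt0 // ltrD2r.
  case: ifP => _; last by rewrite mule0.
  by rewrite -!EFinB -EFinM; congr EFin; field; exact: lt0r_neq0.
transitivity (a^-1%:E * (a%:E * lebesgue_measure (f @^-1` A)))%E; last by [].
by rewrite muleA -EFinM mulVf ?mul1e // lt0r_neq0.
Qed.

Variable d : nat.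
Notation leb := (lebesgue_rV d : set 'rV[R]_d -> \bar R).

Let rect (B : 'I_d -> set (measurableTypeR R)) : set 'rV[R]_d :=
  [set x | forall l, B l (x ord0 l)].

Lemma measurable_rect (B : 'I_d -> set (measurableTypeR R)) :
  (forall l, measurable (B l)) ->
  measurable ([set x | forall l, B l (x ord0 l)] : set 'rV[R]_d).
Proof.
move=> mB; rewrite [X in measurable X](_ : _ = \bigcap_(l in setT) (rV_coord l @^-1` B l)).
  apply: fin_bigcap_measurable => // l _; rewrite -[X in measurable X]setTI.
  exact: measurable_rV_coord.
by apply/seteqP; split=> [x xB l _|x xB l]; [exact: xB|exact: (xB l I)].
Qed.

Let rects : set (set 'rV[R]_d) :=
  [set A | exists2 B, forall l, measurable (B l) & A = rect B].

Let rects_generate : @measurable _ 'rV[R]_d = <<s rects >>.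
Proof.
apply/seteqP; split.
  apply: smallest_sub; first exact: smallest_sigma_algebra.
  rewrite -bigcup_seq; apply: bigcup_sub => l _ _ [B mB <-].
  apply: sub_sigma_algebra; exists (fun k => if k == l then B else setT).
    by move=> k; case: eqP.
  apply/seteqP; split=> [x [_ xB] k|x xB]; first by case: eqP => // ->.
  by split => //; have := xB l; rewrite /= eqxx.
apply: smallest_sub; first exact: sigma_algebra_measurable.
by move=> _ [B mB ->]; exact: measurable_rect.
Qed.

Let rects_setI : setI_closed rects.
Proof.
move=> _ _ [B mB ->] [C mC ->]; exists (fun l => B l `&` C l).
  by move=> l; exact: measurableI.
apply/seteqP; split=> [x [xB xC] l|x xBC]; first by split; [exact: xB|exact: xC].
by split=> l; have [] := xBC l.
Qed.

(** Both sides are measures in [A]. They agree on rectangles by the one-dimensional formula, and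
    rectangles form a generating family closed under intersection. *)
Lemma lebesgue_rV_affine (a : R) (c : 'rV[R]_d) (A : set 'rV[R]_d) :
  0 < a -> measurable A ->
  leb ((fun x => a *: x + c) @^-1` A) = ((a ^- d)%:E * leb A)%E.
Proof.
move=> a0 mA; pose f := fun x : 'rV[R]_d => a *: x + c.
have mfl l : measurable_fun setT
    (fun y : measurableTypeR R => a * y + c ord0 l : measurableTypeR R).
  by apply: continuous_measurable_fun => x; apply: cvgD;
    [apply: cvgMr; exact: cvg_id|exact: cvg_cst].
have mf : measurable_fun setT f.
  apply/measurable_fun_rVP => l.
  rewrite (_ : _ \o _ = fun x : 'rV[R]_d => a * rV_coord l x + c ord0 l); last first.
    by apply/funext => x; rewrite /rV_coord /f /= !mxE.
  exact: measurableT_comp (mfl l) (measurable_rV_coord l).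
have ad0 : 0 <= a ^- d by rewrite invr_ge0 exprn_ge0 // ltW.
(* Cubes exhausting the space, of finite measure, as uniqueness of measures requires. *)
pose g (k : nat) := rect (fun=> `](- k%:R : R), k%:R[%classic).
have := @measure_unique _ _ _ rects g rects_generate rects_setI _ _
  (pushforward leb f) (mscale (NngNum ad0) leb).
move=> H; apply: (H _ _ mf) => // {H}.
- by move=> k; exists (fun=> `](- k%:R : R), k%:R[%classic) => // l; exact: measurable_itv.
- apply/seteqP; split=> // x _; have [k hk] : exists k : nat, enorm x < k%:R.
    by exists (Num.bound (enorm x)); apply: archi_boundP; exact: enorm_ge0.
  exists k => // l; rewrite /= in_itv /= -ltr_norml.
  by apply: le_lt_trans hk; exact: ler_coord_enorm.
- move=> _ [B mB ->].
  transitivity (leb (f @^-1` rect B)); first by [].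
  transitivity ((a ^- d)%:E * leb (rect B))%E; last by [].
  rewrite (_ : f @^-1` rect B = rect (fun l => (fun y : measurableTypeR R =>
     a * y + c ord0 l : measurableTypeR R) @^-1` B l)); last first.
    by apply/seteqP; split=> x xB l; have := xB l; rewrite /= /f !mxE.
  rewrite !lebesgue_rV_box //; last first.
    move=> l; rewrite -[X in measurable X]setTI.
    exact: mfl.
  under eq_bigr do rewrite lebesgue_measure_affine //.
  rewrite big_split /=; congr (_ * _)%E.
  by rewrite -(@big_morph _ _ _ 1%E _ 1 _ EFinM) // prodr_const card_ord exprVn.
- move=> k; change (leb (f @^-1` g k) < +oo)%E.
  rewrite (_ : f @^-1` g k = rect (fun l =>
     `](- k%:R - c ord0 l) / a, (k%:R - c ord0 l) / a[%classic)); last first.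
    apply/seteqP; split=> x xB l; have := xB l;
      rewrite /= !in_itv /= /f !mxE ltr_pdivrMr // ltr_pdivlMr //;
      by rewrite ltrBlDr ltrBrDr [_ * a]mulrC.
  rewrite lebesgue_rV_box //.
  set q := (\prod_(l < d) _)%E; suff : q \is a fin_num by rewrite fin_numElt => /andP[].
  apply: (big_ind (fun u : \bar R => u \is a fin_num)) => // [|l _]; first exact: fin_numM.
  by rewrite lebesgue_measure_itv /=; case: ifP.
Qed.

End affine_volume.

Section volumes.
Context {R : realType} (d : nat).
Notation leb := (lebesgue_rV d : set 'rV[R]_d -> \bar R).
Implicit Types (x y : 'rV[R]_d) (X B : set 'rV[R]_d).

Definition cell_set (s : R) (z : 'rV[int]_d) : set 'rV[R]_d := [set y | cell s y = z].

Let cell_setE s z : 0 < s -> cell_set s z =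
  [set y | forall l, (`[(z ord0 l)%:~R * s, ((z ord0 l)%:~R + 1) * s[%classic
     : set (measurableTypeR R)) (y ord0 l)].
Proof.
move=> s0; apply/seteqP; split=> y.
  move=> <- l; rewrite /= in_itv /= !mxE -ler_pdivlMr // -ltr_pdivrMr //.
  by rewrite floor_le -[1]/(1%:~R) -intrD lt_succ_floor.
move=> H; apply/rowP => l; rewrite mxE; apply: floor_def.
have := H l; rewrite /= in_itv /= -ler_pdivlMr // -ltr_pdivrMr //.
by rewrite -[1]/(1%:~R) -intrD.
Qed.

Lemma measurable_cell_set s z : 0 < s -> measurable (cell_set s z).
Proof.
move=> s0; rewrite cell_setE //; apply: (measurable_rect (B := fun l =>
  `[(z ord0 l)%:~R * s, ((z ord0 l)%:~R + 1) * s[%classic)) => l; exact: measurable_itv.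
Qed.

Lemma volume_cell_set s z : 0 < s -> leb (cell_set s z) = (s ^+ d)%:E.
Proof.
move=> s0; rewrite cell_setE // (lebesgue_rV_box (A := fun l =>
  `[(z ord0 l)%:~R * s, ((z ord0 l)%:~R + 1) * s[%classic)) //.
rewrite (eq_bigr (fun=> s%:E)); last first.
  move=> l _; rewrite lebesgue_measure_itv /= lte_fin ltr_pM2r // ltrDl ltr01.
  by rewrite -EFinB; congr EFin; ring.
by rewrite -(@big_morph _ _ _ 1%E _ 1 _ EFinM) // prodr_const card_ord.
Qed.

Let leb_le A B : A `<=` B -> measurable A -> measurable B -> (leb A <= leb B)%E.
Proof. by move=> AB mA mB; apply: le_measure => //; rewrite inE. Qed.

Let eball01_sub : eball (0 : 'rV[R]_d) 1 `<=`
  [set y | forall l, (`](-1), 1[%classic : set (measurableTypeR R)) (y ord0 l)].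
Proof.
move=> y y1 l; rewrite /= in_itv /= -ltr_norml.
apply: le_lt_trans y1; have := ler_coord_enorm (0 - y) l.
by rewrite !mxE sub0r normrN.
Qed.

Let sub_eball01 :
  [set y : 'rV[R]_d | forall l, (`](- (Num.sqrt d%:R + 1)^-1), (Num.sqrt d%:R + 1)^-1[%classic
     : set (measurableTypeR R)) (y ord0 l)] `<=` eball (0 : 'rV[R]_d) 1.
Proof.
set c := Num.sqrt d%:R + 1; have c0 : 0 < c by rewrite ltr_wpDl ?sqrtr_ge0.
move=> y yc; rewrite /eball /= /edistance.
apply: (@le_lt_trans _ _ (Num.sqrt d%:R * c^-1)).
  apply: ler_enorm_coord => [|l]; first by rewrite invr_ge0 ltW.
  by have := yc l; rewrite /= in_itv /= -ltr_norml !mxE sub0r normrN => /ltW.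
by rewrite ltr_pdivrMr // mul1r ltrDl.
Qed.

(** The point is finiteness, which follows by enclosing the ball in a cube; an inscribed cube gives
    positivity in the next lemma. *)
Lemma unit_ball_volumeE : leb (eball 0 1) = (unit_ball_volume d)%:E.
Proof.
rewrite /unit_ball_volume fineK // ge0_fin_numE //.
apply: le_lt_trans (leb_le eball01_sub _ _) _.
- exact: measurable_eball.
- by apply: (measurable_rect (B := fun=> `](-1), 1[%classic)) => l; exact: measurable_itv.
rewrite (lebesgue_rV_box (A := fun=> `](-1), 1[%classic)) //.
rewrite (eq_bigr (fun=> 2%:E)); last first.
  move=> l _; rewrite lebesgue_measure_itv /= lte_fin gtrN // -EFinB.
  by rewrite opprK.
by rewrite -(@big_morph _ _ _ 1%E _ 1 _ EFinM) // ltry.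
Qed.

Lemma unit_ball_volume_gt0 : 0 < unit_ball_volume d :> R.
Proof.
rewrite -lte_fin -unit_ball_volumeE.
apply: lt_le_trans (leb_le sub_eball01 _ _); first last.
- exact: measurable_eball.
- by apply: (measurable_rect (B := fun=> `](- (Num.sqrt d%:R + 1)^-1),
    (Num.sqrt d%:R + 1)^-1[%classic)) => l; exact: measurable_itv.
set c := Num.sqrt d%:R + 1; have c0 : 0 < c^-1 by rewrite invr_gt0 ltr_wpDl ?sqrtr_ge0.
rewrite (lebesgue_rV_box (A := fun=> `](- c^-1), c^-1[%classic)) //.
rewrite (eq_bigr (fun=> (2 * c^-1)%:E)); last first.
  move=> l _; rewrite lebesgue_measure_itv /= lte_fin gtrN // -EFinB.
  by congr EFin; ring.
by rewrite -(@big_morph _ _ _ 1%E _ 1 _ EFinM) // lte_fin prodr_gt0 // => _ _; rewrite mulr_gt0.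
Qed.

Lemma volume_eball x r : 0 < r -> leb (eball x r) = (unit_ball_volume d * r ^+ d)%:E.
Proof.
move=> r0; have rV0 : 0 < r^-1 by rewrite invr_gt0.
rewrite (_ : eball x r = (fun y => r^-1 *: y - r^-1 *: x) @^-1` eball 0 1).
  rewrite lebesgue_rV_affine //; last exact: measurable_eball.
  by rewrite unit_ball_volumeE -EFinM exprVn invrK mulrC.
apply/seteqP; split=> y; rewrite /eball /= /edistance sub0r enormN -scalerBr enormZ;
  by rewrite gtr0_norm // mulrC ltr_pdivrMr // mul1r -[y - x]opprB enormN.
Qed.

Variable p : 'rV[R]_d -> R.
Hypothesis p_density : is_density p.

Let p_meas B : measurable_fun B (EFin \o p).
Proof.
by case: p_density => mp _ _; apply/measurable_EFinP; exact: measurable_funTS.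
Qed.

Lemma mass_ge a B : measurable B -> 0 <= a -> (forall x, B x -> a <= p x) ->
  (a%:E * leb B <= \int[lebesgue_rV d]_(x in B) (p x)%:E)%E.
Proof.
move=> mB a0 ap; rewrite -integral_cst //; apply: ge0_le_integral => //.
Qed.

Lemma mass_le b B : measurable B -> (forall x, B x -> p x <= b) -> 0 <= b ->
  (\int[lebesgue_rV d]_(x in B) (p x)%:E <= b%:E * leb B)%E.
Proof.
case: p_density => _ p0 _ mB pb b0; rewrite -integral_cst //; apply: ge0_le_integral => //.
all: by move=> x Bx; rewrite lee_fin ?p0 ?pb.
Qed.

Lemma mass_le1 B : measurable B -> (\int[lebesgue_rV d]_(x in B) (p x)%:E <= 1)%E.
Proof.
case: p_density => _ p0 <- mB; apply: ge0_subset_integral => //.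
by move=> x _; rewrite lee_fin.
Qed.

Variables (X : set 'rV[R]_d) (pmin : R).
Hypothesis pmin_gt0 : 0 < pmin.
Hypothesis X_density : forall x, X x -> pmin <= p x.

(** Each set carries mass at least [pmin * v], and the total mass is 1. This stands in for
    compactness of [X]. *)
Lemma disjoint_packing_size (N : nat) (S : 'I_N -> set 'rV[R]_d) v :
  (forall k, measurable (S k)) -> (forall k, S k `<=` X) ->
  (forall k, (v%:E <= leb (S k))%E) -> trivIset setT S -> N%:R * (pmin * v) <= 1.
Proof.
move=> mS SX Sv tS; rewrite -lee_fin.
have mU : measurable (\big[setU/set0]_(k < N) S k) by exact: bigsetU_measurable.
apply: (le_trans _ (mass_le1 mU)).
apply: (le_trans _ (mass_ge mU (ltW pmin_gt0) _)); last first.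
  move=> x; rewrite -bigcup_seq => -[k _ /SX]; exact: X_density.
rewrite (measure_bigsetU_ord (lebesgue_rV d) xpredT) //.
rewrite mulrCA EFinM lee_pmul2l ?lte_fin //.
have -> : (N%:R * v)%:E = (\sum_(k < N) v%:E)%E.
  by rewrite sumEFin sumr_const card_ord mulr_natl.
by apply: lee_sum => k _; exact: Sv.
Qed.

(** The mass bound makes a disjoint family of largest size exist; any further admissible set must
    meet one of its members. All nets and coverings below are instances. *)
Lemma maximal_packing (T : Type) (Q : T -> Prop) (S : T -> set 'rV[R]_d) v :
  0 < v -> (forall t, Q t -> [/\ measurable (S t), S t `<=` X & (v%:E <= leb (S t))%E]) ->
  exists (N : nat) (y : 'I_N -> T), [/\ forall k, Q (y k), N%:R * (pmin * v) <= 1 &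
    forall t, Q t -> exists k, S t `&` S (y k) !=set0].
Proof.
move=> v0 QS.
pose F N := exists y : 'I_N -> T, (forall k, Q (y k)) /\ trivIset setT (fun k => S (y k)).
have FN N : F N -> N%:R * (pmin * v) <= 1.
  by move=> [y [Qy ty]]; apply: disjoint_packing_size ty => k; have [] := QS _ (Qy k).
have F0 : exists N, `[< F N >].
  exists 0%N; apply/asboolP.
  have y (k : 'I_0) : T by case: k.
  by exists y; split=> [[]//|]; apply/trivIsetP => -[].
have Fub N : `[< F N >] -> (N <= Num.bound (pmin * v)^-1)%N.
  move/asboolP/FN; rewrite -ler_pdivlMr ?mulr_gt0 // mul1r => h.
  rewrite -(ler_nat R); apply: le_trans h _; apply: ltW; apply: archi_boundP.
  by rewrite invr_ge0 mulr_ge0 // ltW.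
case: (ex_maxnP F0 Fub) => N /asboolP[y [Qy ty]] Nmax.
exists N, y; split=> //; first by apply: FN; exists y.
move=> t Qt; apply: contrapT => nex.
suff /Nmax : `[< F N.+1 >] by rewrite ltnn.
apply/asboolP; exists (fun k => oapp y t (unlift ord0 k)); split.
  by move=> k; case: unliftP => [k'|] _ /=.
apply/trivIsetP => a b _ _ ab.
have disj k : S t `&` S (y k) = set0.
  by apply/eqP; apply: contrapT => /negP /set0P ne; apply: nex; exists k.
case: (unliftP ord0 a) ab => [a'|] ->; case: (unliftP ord0 b) => [b'|] -> //= ab.
- by move/trivIsetP : ty; apply => //; apply: contraNneq ab => ->.
- by rewrite setIC.
Qed.

End volumes.

(** * Geometry of the region: deep paths, cells and nets *)

Section region_geometry.
Context {R : realType} (d : nat) (p : 'rV[R]_d -> R) (X : set 'rV[R]_d) (pmin h : R).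
Hypothesis p_density : is_density p.
Hypothesis X_valid : valid_region p X pmin h.
Notation leb := (lebesgue_rV d : set 'rV[R]_d -> \bar R).
Implicit Types x y : 'rV[R]_d.

Let mX := region_measurable X_valid.
Let h0 := region_h_gt0 X_valid.
Let pm0 := region_pmin_gt0 X_valid.
Let Xp := region_density X_valid.
Let eta0 := @unit_ball_volume_gt0 R d.

Let Y : set 'rV[R]_d := [set x | X x /\ ((h / 2)%:E < dist_to_set x (frontier X))%E].

Lemma deep_pointW x : deep_point X h x -> Y x.
Proof.
case=> Xx hx; split=> //; apply: lt_le_trans hx.
by rewrite lte_fin ltr_pdivrMr // ltr_pMr // ltr1n.
Qed.

Lemma deep_point_eball x : deep_point X h x -> eball x h `<=` X.
Proof. by case=> Xx /dist_to_setP; exact: eball_sub_region. Qed.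

Let Y_eball x : Y x -> eball x (h / 2) `<=` X.
Proof. by case=> Xx /ltW /dist_to_setP; exact: eball_sub_region. Qed.

(** Points of [Y] have clearance h/2 and the segments between net points have length at most h/8;
    what remains is the clearance 3h/8. *)
Let reach (eps : R) (T : nat) x y := exists gamma : nat -> 'rV[R]_d,
  [/\ gamma 0%N = x, gamma T = y,
   forall t, (t < T)%N -> edistance (gamma t) (gamma t.+1) <= eps / 4 &
   forall t, (t <= T)%N -> eball (gamma t) (3 * h / 8) `<=` X].

Let reach_cat eps T1 T2 x y z :
  reach eps T1 x y -> reach eps T2 y z -> reach eps (T1 + T2) x z.
Proof.
move=> [f [f0 fT fs fX]] [g [g0 gT gs gX]].
exists (fun t => if (t <= T1)%N then f t else g (t - T1)%N); split=> //.
- case: leqP => [|_]; last by rewrite addKn.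
  rewrite -[X in (_ <= X)%N]addn0 leq_add2l leqn0 => /eqP T20.
  by rewrite T20 addn0 fT -gT T20 g0.
- move=> t; case: (ltngtP t T1) => [tT1|tT1|->] tT.
  + by apply: fs.
  + rewrite subSn ?(ltnW tT1) //; apply: gs.
    by move: tT tT1; lia.
  + rewrite fT -g0 subSnn; apply: gs.
    by move: tT; lia.
- move=> t tT; case: leqP => [|tT1]; first exact: fX.
  by apply: gX; rewrite leq_subLR.
Qed.

Let reach_segment eps (L : nat) x y : (0 < L)%N -> h / 8 <= L%:R * (eps / 4) ->
  Y x -> edistance x y <= h / 8 -> reach eps L x y.
Proof.
move=> L0 Leps Yx xy; have LR : 0 < L%:R :> R by rewrite ltr0n.
pose g t := x + (t%:R / L%:R) *: (y - x).
have gE (a b : nat) : edistance (g a) (g b) = `|a%:R - b%:R| / L%:R * edistance x y.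
  rewrite /edistance /g opprD addrACA subrr add0r -scalerBl enormZ -mulrBl normf_div.
  by rewrite -[y - x]opprB enormN [`|L%:R|]gtr0_norm.
exists g; split.
- by rewrite /g mul0r scale0r addr0.
- by rewrite /g divff ?lt0r_neq0 // scale1r addrC subrK.
- move=> t _; rewrite gE -natr1 opprD addNKr normrN1 mul1r mulrC ler_pdivrMr // mulrC.
  exact: le_trans xy Leps.
move=> t tL z zt; apply: (Y_eball Yx); rewrite /eball /=.
apply: le_lt_trans (edistance_triangle (g t) _ _) _.
have <- : g 0%N = x by rewrite /g mul0r scale0r addr0.
rewrite gE sub0r normrN ger0_norm //.
have h1 : t%:R / L%:R * edistance x y <= h / 8.
  apply: le_trans xy; rewrite ler_piMl ?edistance_ge0 // ler_pdivrMr // mul1r.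
  by rewrite ler_nat.
by move: zt h1; rewrite /eball /=; lra.
Qed.

(** The route follows a net of the connected set [Y] whose size depends on h but not on eps. Only
    the subdivision of its segments is of order 1/eps, hence the bound on [T%:R * eps]. *)
Lemma region_path : exists2 C : R, 0 <= C & forall eps x y,
  0 < eps -> eps <= h -> Y x -> Y y ->
  exists T (gamma : nat -> 'rV[R]_d), T%:R * eps <= C /\
  [/\ gamma 0%N = x, gamma T = y,
   forall t, (t < T)%N -> edistance (gamma t) (gamma t.+1) <= eps / 4 &
   forall t, (t <= T)%N -> eball (gamma t) (3 * h / 8) `<=` X].
Proof.
(* Linked net points are then at distance less than 2r = h/8. *)
pose r := h / 16; have r0 : 0 < r by rewrite divr_gt0.
have v0 : 0 < unit_ball_volume d * (r / 2) ^+ d by rewrite mulr_gt0 // exprn_gt0 // divr_gt0.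
have [|N [y [Yy _ cover]]] := @maximal_packing _ _ p p_density X pmin pm0 Xp
  _ Y (fun x => eball x (r / 2)) _ v0.
  move=> x Yx; split; first exact: measurable_eball.
    apply: subset_trans (Y_eball Yx) => z; rewrite /eball /= => /lt_le_trans; apply.
    by rewrite /r; have := h0; lra.
  by rewrite volume_eball // divr_gt0.
have {}cover x : Y x -> exists k, edistance x (y k) < r.
  move=> /cover[k [z [zx zy]]]; exists k.
  apply: le_lt_trans (edistance_triangle z _ _) _; rewrite [r]splitr ltrD //.
  by rewrite edistanceC.
have conn := connected_net (region_bottleneck X_valid) Yy r0 cover.
(* At most N + 2 segments, two of them joining the end points to the net; each has L steps with L *
   eps <= h/2 + eps <= 3h/2. *)
exists ((N + 2)%:R * (3 * h / 2)) => [|eps a b e0 eh Ya Yb].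
  by rewrite mulr_ge0 // divr_ge0 // mulr_ge0 // ltW.
pose L := (Num.truncn (h / (2 * eps))).+1.
have q0 : 0 <= h / (2 * eps) by rewrite divr_ge0 ?mulr_ge0 // ltW.
have Lgt : h / 8 <= L%:R * (eps / 4).
  have : h / (2 * eps) < L%:R by rewrite /L truncnS_gt.
  rewrite ltr_pdivrMr ?mulr_gt0 // => hL.
  have -> : L%:R * (eps / 4) = L%:R * (2 * eps) / 8 by field.
  by rewrite ler_pM2r // ltW.
have Lle : L%:R * eps <= 3 * h / 2.
  have : (Num.truncn (h / (2 * eps)))%:R <= h / (2 * eps) by rewrite truncn_le.
  rewrite ler_pdivlMr ?mulr_gt0 // /L -[X in _ -> X * eps <= _]natr1 => hL.
  have -> : ((Num.truncn (h / (2 * eps)))%:R + 1) * eps =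
    (Num.truncn (h / (2 * eps)))%:R * (2 * eps) / 2 + eps by field.
  by move: hL eh; lra.
have [ka ha] := cover a Ya; have [kb hb] := cover b Yb.
have /connectP[q0' q0p] := conn ka kb.
(* Without repeated vertices the route has fewer than N edges. *)
case: (shortenP q0p) => q qp quniq _ eb {q0' q0p}.
have size_q : (size q < N)%N.
  by have := card_uniqP quniq; rewrite /= => <-; rewrite -[N in (_ <= N)%N]card_ord max_card.
have walk : reach eps (size q * L) (y ka) (y kb).
  rewrite eb; elim: q ka {ha quniq eb size_q} qp => [|k q IH] ka /=.
    move=> _; exists (fun=> y ka); split=> // t _ z zy; apply: (Y_eball (Yy ka)).
    by move: zy h0; rewrite /eball /=; lra.
  case/andP => kak qp; rewrite mulSn; apply: reach_cat (IH _ qp).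
  apply: reach_segment => //.
  by apply: ltW; apply: lt_le_trans kak _; rewrite /r; lra.
have near_le u v : edistance u v < r -> edistance u v <= h / 8.
  by rewrite /r; move: h0; lra.
have [g gP] : reach eps (L + size q * L + L) a b.
  apply: reach_cat; first apply: reach_cat walk.
    by apply: reach_segment => //; exact: near_le.
  by apply: reach_segment => //; rewrite edistanceC; exact: near_le.
exists (L + size q * L + L)%N, g; split=> //.
have -> : (L + size q * L + L = (size q + 2) * L)%N by rewrite mulnDl mul2n -addnn addnA [(L + _)%N]addnC.
rewrite natrM -mulrA ler_pM // ?mulr_ge0 // ?ler_nat ?leq_add2r ?(ltnW size_q) //.
exact: ltW.
Qed.

(** Distinct cells are disjoint, so a maximal packing by cells inside [X] contains all of them. *)
Lemma region_cells s : 0 < s -> exists N (z : 'I_N -> 'rV[int]_d),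
  [/\ N%:R * (pmin * s ^+ d) <= 1, forall k, cell_set s (z k) `<=` X &
      forall q, cell_set s q `<=` X -> exists k, q = z k].
Proof.
move=> s0; have v0 : 0 < s ^+ d by rewrite exprn_gt0.
have [q qX|N [z [zX Nle zmax]]] := @maximal_packing _ _ p p_density X pmin pm0 Xp
  _ (fun q => cell_set s q `<=` X) (cell_set s) _ v0.
  by rewrite volume_cell_set //; split => //; exact: measurable_cell_set.
exists N, z; split=> // q /zmax[k [y [/= <- yz]]].
by exists k.
Qed.

(** The sets are small balls around a net, cut by [X]. The regularity condition keeps their volume
    of order eps^d near the boundary too. One sample point in each is enough to connect all sample
    points of [X]. *)
Lemma region_net : exists C v : R, [/\ 0 < C, 0 < v &
  forall eps, 0 < eps -> eps <= h ->
  exists N (S : 'I_N -> set 'rV[R]_d), [/\ N%:R * eps ^+ d <= C,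
    forall k, measurable (S k) /\ S k `<=` X,
    forall k, ((v * eps ^+ d)%:E <= leb (S k))%E &
    forall n (x : 'I_n -> 'rV[R]_d), (forall k, exists a, S k (x a)) ->
      forall a b, X (x a) -> X (x b) -> connect (eps_edge x eps) a b]].
Proof.
have [alpha [eps0 [al0 e00 reg]]] := region_regular X_valid.
(* The mesh is delta = c * eps. The bound 1/4 puts representatives of linked net points within 3 *
   delta <= eps; the bound eps0/h brings the radius delta/4 below eps0 for every eps <= h. *)
pose c := Num.min (1 / 4) (eps0 / h).
have c0 : 0 < c by rewrite lt_min !divr_gt0.
have c4 : c <= 1 / 4 by rewrite ge_min lexx.
have ce0 : c * h <= eps0 by rewrite -ler_pdivlMr // ge_min lexx orbT.
pose be := Num.min alpha 1.
have be0 : 0 < be by rewrite lt_min al0 ltr01.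
pose v := be * unit_ball_volume d * (c / 4) ^+ d.
have v0 : 0 < v by rewrite !mulr_gt0 // exprn_gt0 // divr_gt0.
exists ((pmin * v)^-1), v; split=> //; first by rewrite invr_gt0 mulr_gt0.
move=> eps e0 eh; pose delta := c * eps.
have de0 : 0 < delta by rewrite mulr_gt0.
have de4 : delta <= eps / 4 by rewrite /delta; move: c4 e0; nra.
have deps0 : delta / 4 < eps0.
  apply: (@lt_le_trans _ _ delta); last by apply: le_trans ce0; rewrite ler_pM2l.
  by rewrite ltr_pdivrMr // ltr_pMr // ltr1n.
have dball y : leb (eball y (delta / 4)) = (unit_ball_volume d * (c / 4) ^+ d * eps ^+ d)%:E.
  by rewrite volume_eball ?divr_gt0 // /delta mulrAC exprMn mulrA.
have u0 : 0 < unit_ball_volume d * (c / 4) ^+ d * eps ^+ d.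
  by rewrite !mulr_gt0 // exprn_gt0 // divr_gt0.
have mEX y r : measurable (eball y r `&` X) by apply: measurableI => //; exact: measurable_eball.
have veps0 : 0 < v * eps ^+ d by rewrite mulr_gt0 // exprn_gt0.
have vol y : X y -> ((v * eps ^+ d)%:E <= leb (eball y (delta / 2) `&` X))%E.
  (* Either the ball of radius delta/4 around [y] lies in [X], or a boundary point [z] is closer
     than delta/4, and its own ball of radius delta/4 lies in that of radius delta/2 around [y]. *)
  move=> Xy; have [yin|] := pselect (forall z, frontier X z -> delta / 4 <= edistance y z).
    apply: (@le_trans _ _ (leb (eball y (delta / 4)))).
      rewrite dball lee_fin /v -!mulrA ler_piMl ?ge_min ?lexx ?orbT //.
      by rewrite mulrA ltW.
    apply: le_measure; rewrite ?inE //; first exact: measurable_eball.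
    move=> z zy; split; last exact: eball_sub_region yin _ zy.
    by move: zy; rewrite /eball /= => /lt_le_trans; apply; move: de0; lra.
  move/existsNP => [z /not_implyP[Fz /negP]]; rewrite -ltNge => yz.
  apply: (@le_trans _ _ (leb (eball z (delta / 4) `&` X))).
    apply: le_trans (reg _ _ _ deps0 Fz); last by rewrite divr_gt0.
    rewrite dball -EFinM lee_fin /v -!mulrA ler_wpM2r ?ge_min ?lexx //.
    by rewrite mulrA ltW.
  apply: le_measure; rewrite ?inE // => w [wz Xw]; split=> //.
  apply: le_lt_trans (edistance_triangle z _ _) _.
  by move: wz yz; rewrite /eball /=; lra.
have [y Xy|N [y [Xy Nle ymax]]] := @maximal_packing _ _ p p_density X pmin pm0 Xp
  _ X (fun y => eball y (delta / 2) `&` X) _ veps0.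
  by split=> //; exact: vol.
exists N, (fun k => eball (y k) (delta / 2) `&` X); split=> //.
- rewrite -[leRHS]mul1r ler_pdivlMr; last exact: mulr_gt0.
  by rewrite -mulrA [eps ^+ d * _]mulrC -[pmin * v * _]mulrA.
- by move=> k; exact: vol.
move=> n x sample; have [a_ ha] := choice sample.
have cover z : X z -> exists k, edistance z (y k) < delta.
  move=> /ymax[k [w [[wz _] [wy _]]]]; exists k.
  apply: le_lt_trans (edistance_triangle w _ _) _; rewrite [delta]splitr ltrD //.
  by rewrite edistanceC.
have conn := connected_net (region_connected X_valid) Xy de0 cover.
have edge a b : edistance (x a) (x b) <= eps -> connect (eps_edge x eps) a b.
  have [-> _|ab xab] := eqVneq a b; first exact: connect0.
  by apply: connect1; rewrite /eps_edge /= ab.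
have toy k : edistance (x (a_ k)) (y k) < delta / 2.
  by have [+ _] := ha k; rewrite /eball /= edistanceC.
have chain k l : connect (eps_edge x eps) (a_ k) (a_ l).
  have /connectP[q] := conn k l; elim: q k => [|k' q IH] k /=; first by move=> _ ->.
  case/andP => kk' qp e; apply: connect_trans (IH _ qp e); apply: edge.
  apply: le_trans (edistance_triangle (y k) _ _) _.
  have := edistance_triangle (y k') (y k) (x (a_ k')).
  have := toy k; have := toy k'; rewrite [edistance _ (y k')]edistanceC => h1 h2 h3.
  by move: kk' de4 h1 h2 h3; rewrite /=; lra.
have local b k : edistance (x b) (y k) < delta -> edistance (x b) (x (a_ k)) <= eps.
  move=> bk; apply: le_trans (edistance_triangle (y k) _ _) _.
  by have := toy k; rewrite edistanceC => h1; move: bk de4 h1 de0; lra.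
move=> a b /cover[k ak] /cover[l bl].
apply: (connect_trans (edge _ _ (local _ _ ak))).
apply: (connect_trans (chain k l)); apply: edge.
by rewrite edistanceC; exact: local.
Qed.

End region_geometry.

Lemma ord_neq_gt1 n (i j : 'I_n) : i != j -> (1 < n)%N.
Proof. by case: n i j => [[]//|[|//]] i j; rewrite (ord1 i) (ord1 j). Qed.

Lemma ramp_step (K T t : nat) : (t < T)%N ->
  (ramp K T t <= (ramp K T t.+1).+1)%N && (ramp K T t.+1 <= (ramp K T t).+1)%N.
Proof. by rewrite /ramp => tT; apply/andP; split; lia. Qed.

(** Distances to the least element [v0] are at most M = (K - 1) / a (integer quotient), so #|C| <= M
    + 1 and a * (M + 1) <= a + K <= 2K. The subtraction is truncated, so one inequality covers both
    orders. *)
Lemma card_clustered_ord (K a : nat) (C : {set 'I_K}) : (0 < a <= K)%N ->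
  (forall v w, v \in C -> w \in C -> (a * (w - v) < K)%N) -> (a * #|C| <= 2 * K)%N.
Proof.
case/andP=> a0 aK HC; have [->|[v1 v1C]] := set_0Vmem C; first by rewrite cards0 muln0.
pose v0 := [arg min_(v < v1 in C) (v : nat)].
have [v0C v0min] : v0 \in C /\ forall v, v \in C -> (v0 <= v)%N.
  by rewrite /v0; case: arg_minnP.
pose M := (K.-1 %/ a)%N.
have lt v : v \in C -> (v - v0 <= M)%N.
  by move=> vC; rewrite leq_divRL // mulnC -ltnS prednK ?HC // (leq_trans a0).
have inj : {in C &, injective (fun v : 'I_K => inord (v - v0) : 'I_M.+1)}.
  move=> v w vC wC /(congr1 val); rewrite /= !inordK ?ltnS ?lt // => e.
  by apply: val_inj; rewrite /= -(subnK (v0min _ vC)) e subnK ?v0min.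
have : (#|C| <= M.+1)%N by rewrite -(card_in_imset inj) (leq_trans (max_card _)) ?card_ord.
move=> /(leq_mul (leqnn a)) /leq_trans; apply.
by rewrite mulnS mulnC (leq_trans (leq_add aK (leq_divM _ _))) //; lia.
Qed.

(** * The deterministic bound from cell counts and connectedness *)

Section deterministic_bound.
Context {R : realType} (d : nat) (p : 'rV[R]_d -> R) (X : set 'rV[R]_d) (pmin h : R).
Hypothesis d_ge2 : (2 <= d)%N.
Hypothesis p_density : is_density p.
Hypothesis X_valid : valid_region p X pmin h.

(** Chosen so that the diagonal of a cell is exactly eps/8. *)
Definition cell_side (eps : R) : R := eps / (8 * Num.sqrt d%:R).

Let sd0 : 0 < Num.sqrt d%:R :> R.
Proof. by rewrite sqrtr_gt0 ltr0n (leq_trans _ d_ge2). Qed.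

Lemma cell_side_gt0 eps : 0 < eps -> 0 < cell_side eps.
Proof. by move=> e0; rewrite divr_gt0 // mulr_gt0. Qed.

Let cell_sideE eps : 8 * (Num.sqrt d%:R * cell_side eps) = eps.
Proof. by rewrite /cell_side; field; exact: lt0r_neq0. Qed.

Lemma deterministic_bound : exists2 C0 : R, 0 < C0 &
  forall n (x : 'I_n -> 'rV[R]_d) eps (i j : 'I_n) m,
  0 < eps -> eps <= h -> i != j -> deep_point X h (x i) -> deep_point X h (x j) ->
  8 * eps <= edistance (x i) (x j) -> 0 < m ->
  (forall z, cell_set (cell_side eps) z `<=` X ->
    m <= #|[set k | (k \notin [:: i; j]) && (cell (cell_side eps) (x k) == z)]%SET|%:R) ->
  (forall k l, connect (eps_edge x eps) k l) ->
  commute_distance (eps_graph x eps) i j \is a fin_num /\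
  `| fine (commute_distance (eps_graph x eps) i j) / graph_volume (eps_graph x eps)
     - ((degree (eps_graph x eps) i)^-1 + (degree (eps_graph x eps) j)^-1) |
    <= C0 / m ^+ 2 * (if d == 2%N then eps^-1 else 1).
Proof.
have h0 := region_h_gt0 X_valid.
have [C C_ge0 path] := region_path p_density X_valid.
have [|C1 C10 sum_le] := @ramp_sum R d (2 * C / h) d_ge2.
  by rewrite divr_ge0 ?mulr_ge0 // ltW.
exists (2 * C1 * (if d == 2%N then h else 1)); first by rewrite !mulr_gt0 //; case: eqP.
move=> n x eps i j m e0 eh ij di dj far m0 cells conn.
move: (cell_side eps) (cell_side_gt0 e0) (cell_sideE eps) cells => s s0 sE cells.
(* The largest grid size: K * eps lies between h/2 and h, so the largest translation, sqrt d * s * K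
   = K * eps / 8, is at most h/8. *)
pose K := Num.truncn (h / eps).
have K0 : (0 < K)%N by rewrite truncn_gt0 ler_pdivlMr // mul1r.
have KR : 0 < K%:R :> R by rewrite ltr0n.
have Kle : K%:R * eps <= h.
  by rewrite -ler_pdivlMr // truncn_le // divr_ge0 // ltW.
have Kge : h <= 2 * (K%:R * eps).
  have : h / eps < K.+1%:R by rewrite truncnS_gt.
  have -> : K.+1%:R = K%:R + 1 :> R by rewrite natr1.
  rewrite ltr_pdivrMr // mulrDl mul1r => hK; have : 1 * eps <= K%:R * eps.
    by rewrite ler_pM2r // ler1n.
  by move: hK; rewrite mul1r; lra.
have [T [gamma [TC [gam0 gamT gam_step gamX]]]] :=
  path eps _ _ e0 eh (deep_pointW X_valid di) (deep_pointW X_valid dj).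
have TK : T%:R <= 2 * C / h * K%:R.
  rewrite mulrAC ler_pdivlMr // -(ler_pM2r e0).
  have h1 : T%:R * eps * h <= C * h by rewrite ler_wpM2r // ltW.
  have h2 : C * h <= C * (2 * (K%:R * eps)) by rewrite ler_wpM2l.
  rewrite (_ : T%:R * h * eps = T%:R * eps * h); last by ring.
  by rewrite (_ : 2 * C * K%:R * eps = C * (2 * (K%:R * eps))) ?(le_trans h1) //; ring.
have {}sum_le := sum_le K T K0 TK.
pose U : finType := {ffun 'I_d -> 'I_K}.
pose dir (u : U) : 'rV[R]_d := \row_l (u l)%:R.
(* a random path u: gamma translated by a random vector that grows from 0 to length
   about h and shrinks back to 0 at the two ends *)
pose q (t : nat) (u : U) := gamma t + ((ramp K T t)%:R / K%:R * s) *: dir u.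
have dirn u : enorm (dir u) <= Num.sqrt d%:R * K%:R.
  apply: ler_enorm_coord => // l; rewrite mxE ger0_norm // ler_nat.
  by rewrite ltnW // ltn_ord.
have diamK : Num.sqrt d%:R * s * K%:R <= h / 8.
  by move: Kle; rewrite -{1}sE (_ : K%:R * _ = 8 * (Num.sqrt d%:R * s * K%:R)); [lra|ring].
have rampK t : (ramp K T t)%:R / K%:R <= 1 :> R.
  by rewrite ler_pdivrMr // mul1r ler_nat /ramp geq_min geq_minl orbT.
have qgam t u : edistance (q t u) (gamma t) <= h / 8.
  rewrite /edistance /q addrC addKr enormZ ger0_norm; last first.
    by rewrite mulr_ge0 ?divr_ge0 // ltW.
  apply: (@le_trans _ _ (s * (Num.sqrt d%:R * K%:R))); last first.
    by rewrite (_ : s * _ = Num.sqrt d%:R * s * K%:R) //; ring.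
  apply: ler_pM => //; first by rewrite mulr_ge0 ?divr_ge0 // ltW.
    exact: enorm_ge0.
  by rewrite ler_piMl // ltW.
have diam : Num.sqrt d%:R * s <= h / 8 by move: sE eh; lra.
have cell_diam (y z : 'rV[R]_d) : cell s y = cell s z -> edistance y z <= h / 8.
  by move/(cell_edistance s0)/le_trans; apply.
have pts y : [set k | (k \notin [:: i; j]) && (cell s (x k) == cell s y)]%SET
    = cell_points x s i j y by [].
have count y r : eball y r `<=` X -> h / 8 < r -> m <= #|cell_points x s i j y|%:R.
  move=> yX hr; apply: (cells (cell s y)) => z zy; apply: yX.
  by rewrite /eball /=; apply: le_lt_trans hr; apply: cell_diam; rewrite zy.
have ball_sub (y z : 'rV[R]_d) r r' : edistance y z <= r' -> eball y r `<=` eball z (r + r').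
  move=> yz w yw; rewrite /eball /=; apply: le_lt_trans (edistance_triangle y _ _) _.
  by rewrite edistanceC addrC ltr_leD.
have U0 : (0 < #|U|)%N.
  by rewrite card_ffun !card_ord expn_gt0 K0.
have deepX c : c \in [:: i; j] -> deep_point X h (x c).
  by rewrite !inE => /orP[] /eqP ->.
have hard := @random_path_flow R d n x eps s m i j s0 _ m0 _ U T q
  (fun t => spread d (ramp K T t)) _ U0.
(* The clearance 3h/8 minus the translation h/8. It exceeds the cell diameter, so the whole cell of
   [q t u] lies in [X] and is populated. *)
have gamma_ball t u : (t <= T)%N -> eball (q t u) (h / 4) `<=` X.
  move=> tT; apply: subset_trans (gamX t tT).
  by apply: subset_trans (ball_sub _ _ _ _ (qgam t u)) _ => w; rewrite /eball /= => /lt_le_trans; apply; lra.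
(* [commute_distance_bound] doubles its constant, whence [M / 2] below. For d = 2 the factor K of
   [ramp_sum] is at most h / eps. *)
pose M : R := (2 * C1 * (if d == 2%N then h else 1)) / m ^+ 2 * (if d == 2%N then eps^-1 else 1).
have ramp0 : ramp K T 0 = 0%N by rewrite /ramp min0n.
have rampT : ramp K T T = 0%N by rewrite /ramp subnn minn0 minn0.
have bound phi :
  ((\sum_w eps_graph x eps i w * phi w) / degree (eps_graph x eps) i
    - (\sum_w eps_graph x eps j w * phi w) / degree (eps_graph x eps) j) ^+ 2
  <= M / 2 * inner_energy (eps_graph x eps) i j phi.
  apply: le_trans (hard _ _ phi _ _ _ _ _ _ _) _.
  - by rewrite sE.
  - by apply: lt_le_trans far; rewrite ltr_pMl // ltr1n.
  - by move=> u; rewrite /q ramp0 mul0r mul0r scale0r addr0.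
  - by move=> u; rewrite /q rampT mul0r mul0r scale0r addr0.
  - move=> t u tT; rewrite /edistance /q opprD addrACA -scalerBl -mulrBl -mulrBl.
    apply: le_trans (enormD _ _) _; rewrite enormZ.
    (* A change of grid size by 1 moves the path by at most eps/8; with eps/4 for [gamma] this stays
       below eps/2. *)
    have r1 : `|(ramp K T t)%:R - (ramp K T t.+1)%:R| <= 1 :> R.
      have /andP[r2 r3] := ramp_step K tT.
      have r2' : (ramp K T t)%:R <= (ramp K T t.+1)%:R + 1 :> R by rewrite natr1 ler_nat.
      have r3' : (ramp K T t.+1)%:R <= (ramp K T t)%:R + 1 :> R by rewrite natr1 ler_nat.
      by rewrite ler_norml; apply/andP; split; move: r2' r3'; lra.
    have : `|((ramp K T t)%:R - (ramp K T t.+1)%:R) / K%:R * s| * enorm (dir u)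
        <= 1 / K%:R * s * (Num.sqrt d%:R * K%:R).
      rewrite !normrM normfV !(gtr0_norm KR) (gtr0_norm s0).
      apply: ler_pM; rewrite ?enorm_ge0 //; first by rewrite !mulr_ge0 ?invr_ge0 // ltW.
      by rewrite !ler_pM2r ?invr_gt0.
    have -> : 1 / K%:R * s * (Num.sqrt d%:R * K%:R) = eps / 8.
      by rewrite -sE; field; exact: lt0r_neq0.
    by have := gam_step t tT; rewrite /edistance; lra.
  - by move=> t u tT; apply: (count _ (h / 4)); [exact: gamma_ball|lra].
  - move=> c k cij ck; apply: (count _ (h / 2)); last by lra.
    apply: subset_trans (deep_point_eball (deepX c cij)).
    apply: subset_trans (ball_sub _ (x c) _ (eps / 2) _) _.
      by rewrite edistance_midpoint ler_pM2r ?invr_gt0.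
    by move=> w; rewrite /eball /= => /lt_le_trans; apply; lra.
  - by move=> t; exact: spread_ge0.
  - move=> t z tT; rewrite card_ffun !card_ord natrX sqr_sqrtr; last first.
      by rewrite exprn_ge0 // divr_ge0.
    set a := maxn _ 1.
    have [a0 aK] : (0 < a)%N /\ (a <= K)%N.
      by rewrite /a leq_maxr geq_max K0 andbT /ramp geq_min geq_minl orbT.
    rewrite -exprMn.
    (* At the ends the grid is a point and the claimed bound 2^d * K^d exceeds the number of all
       [u]. *)
    have [r0|rpos] := posnP (ramp K T t).
      apply: (@le_trans _ _ (K%:R ^+ d)).
        by rewrite -natrX ler_nat (leq_trans (max_card _)) // card_ffun !card_ord.
      rewrite lerXn2r ?nnegrE ?mulr_ge0 ?divr_ge0 //.
      by rewrite /a r0 divr1 ler_peMl // ler1n.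
    have aE : a = ramp K T t by rewrite /a; exact/maxn_idPl.
    (* The cell is a product, so the coordinates of [u] are constrained separately. In each
       coordinate the admissible values [v] and [w] satisfy a * (w - v) < K, which leaves at most
       2K/a of them. *)
    pose Cl l : {set 'I_K} := [set v : 'I_K | Num.floor ((gamma t ord0 l
       + (a%:R / K%:R * s) * v%:R) / s) == z ord0 l]%SET.
    apply: (@le_trans _ _ (\prod_(l < d) #|Cl l|%:R)).
      rewrite -natr_prod ler_nat; apply: (@leq_trans #|family (fun l => mem (Cl l))|).
        apply: subset_leq_card; apply/fintype.subsetP => u; rewrite inE => /eqP uz.
        apply/familyP => l; rewrite !inE; apply/eqP; move/rowP/(_ l): uz.
        by rewrite !mxE aE.
      by rewrite card_family foldrE big_map big_enum.
    rewrite -[d in leRHS]card_ord -prodr_const; apply: ler_prod => l _.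
    rewrite ler0n /= mulrAC ler_pdivlMr ?ltr0n // -!natrM ler_nat mulnC.
    apply: card_clustered_ord; first by rewrite a0.
    move=> v w; rewrite !inE => /eqP <- /eqP e; case: (leqP w v) => [|vw].
      by rewrite -subn_eq0 => /eqP ->; rewrite muln0.
    have := floor_le ((gamma t ord0 l + a%:R / K%:R * s * v%:R) / s).
    have := lt_succ_floor ((gamma t ord0 l + a%:R / K%:R * s * w%:R) / s).
    rewrite e intrD; set fl := (Num.floor _)%:~R => h1 h2.
    have : (gamma t ord0 l + a%:R / K%:R * s * w%:R) / s
       - (gamma t ord0 l + a%:R / K%:R * s * v%:R) / s < 1 by move: h1 h2; lra.
    have -> : (gamma t ord0 l + a%:R / K%:R * s * w%:R) / s
       - (gamma t ord0 l + a%:R / K%:R * s * v%:R) / s = a%:R * (w%:R - v%:R) / K%:R.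
      by field; rewrite !lt0r_neq0.
    by rewrite ltr_pdivrMr // mul1r -natrB ?(ltnW vw) // -natrM ltr_nat.
  rewrite ler_wpM2r //.
    by do 2 apply: sumr_ge0 => ? _; rewrite mulr_ge0 ?sqr_ge0 // mxE.
  rewrite expr_div_n /M; have m2 : 0 < m ^+ 2 by rewrite exprn_gt0.
  rewrite ler_pdivrMr //; apply: le_trans sum_le _.
  case: eqP => _; last by rewrite le_eqVlt; apply/orP; left; apply/eqP; field; exact: lt0r_neq0.
  apply: (@le_trans _ _ (C1 * (h / eps))).
    by rewrite ler_pM2l // ler_pdivlMr.
  by rewrite le_eqVlt; apply/orP; left; apply/eqP; field; rewrite !lt0r_neq0.
have nij : eps_graph x eps i j = 0.
  rewrite mxE /eps_edge /= ij leNgt (_ : eps < _) //.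
  by apply: lt_le_trans far; rewrite ltr_pMl // ltr1n.
have n1 := ord_neq_gt1 ij.
have [||||||fin /andP[b0 b1]] := @commute_distance_bound R n (eps_graph x eps) _ _ _ n1 i j ij nij _ _ (M / 2) _ bound.
- by move=> u w; rewrite mxE.
- by move=> u w; rewrite !mxE /eps_edge /= eq_sym edistanceC.
- move=> u w; rewrite (eq_connect (e' := eps_edge x eps)) // => a b /=.
  by rewrite mxE; case: (eps_edge x eps a b); rewrite ?ltr01 ?ltxx.
- by rewrite mxE /eps_edge /= eqxx.
- by rewrite mxE /eps_edge /= eqxx.
- have h1 : 0 <= (if d == 2%N then h else 1) by case: eqP => // _; exact: ltW.
  have h2 : 0 <= (if d == 2%N then eps^-1 else 1).
    by case: eqP => // _; rewrite invr_ge0 ltW.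
  by rewrite divr_ge0 // mulr_ge0 // divr_ge0 ?sqr_ge0 // mulr_ge0 // mulr_ge0 // ltW.
split => //; rewrite ger0_norm //.
by apply: le_trans b1 _; rewrite mulrC divfK ?pnatr_eq0.
Qed.

End deterministic_bound.

(** * Measurability of graph events *)

Section finite_patterns.
Context {dOmega : measure_display} {Omega : measurableType dOmega}.

(* Yields the measurability of events about commute distances, which depend only on
   the finitely many edge indicators. *)
Lemma measurable_finite_determined (K : finType) (E : K -> set Omega) (G : set Omega) :
  (forall k, measurable (E k)) ->
  (forall w w', (forall k, E k w <-> E k w') -> G w -> G w') -> measurable G.
Proof.
move=> mE detG; pose pat w : {set K} := [set k | `[< E k w >]]%SET.
pose cell_of (S : {set K}) := \bigcap_(k in setT) (if k \in S then E k else ~` E k).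
have cellP S w : cell_of S w <-> pat w = S.
  split=> [H|<- k _].
    apply/setP => k; rewrite inE; have := H k I.
    by case: (k \in S); [move/asboolP->|move=> ?; apply/asboolP].
  by rewrite inE; case: asboolP.
rewrite (_ : G = \big[setU/set0]_(S : {set K} | `[< exists2 w, G w & pat w = S >]) cell_of S).
  apply: bigsetU_measurable => S _; apply: fin_bigcap_measurable => // k _.
  by case: ifP => _ //; exact: measurableC.
apply/seteqP; split=> [w Gw|w].
  rewrite -bigcup_seq_cond; exists (pat w); last exact/cellP.
  by rewrite /= mem_index_enum; apply/asboolP; exists w.
rewrite -bigcup_seq_cond => -[S /= /andP[_ /asboolP[w' Gw' e]] /cellP e'].
apply: detG Gw' => k; have : (k \in pat w') = (k \in pat w) by rewrite e e'.
by rewrite !inE => H; split=> /asboolP; [rewrite H|rewrite -H] => /asboolP.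
Qed.

Context {R : realType} (d : nat).

Lemma measurable_edistance_le (f g : Omega -> 'rV[R]_d) (r : R) :
  measurable_fun setT f -> measurable_fun setT g ->
  measurable [set w | edistance (f w) (g w) <= r].
Proof.
move=> /measurable_fun_rVP mf /measurable_fun_rVP mg.
have [r0|r0] := leP 0 r; last first.
  rewrite (_ : [set _ | _] = set0) //; apply/seteqP; split=> w //= /le_lt_trans/(_ r0).
  by rewrite ltNge edistance_ge0.
pose D (w : Omega) : R := \sum_(l < d) (f w ord0 l - g w ord0 l) ^+ 2.
have mD : measurable_fun setT D.
  apply: measurable_sum => l; apply: measurable_funX; apply: measurable_funB.
    exact: mf.
  exact: mg.
rewrite (_ : [set _ | _] = D @^-1` `]-oo, r ^+ 2]); last first.
  apply/seteqP; split=> w; rewrite /= in_itv /=.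
    rewrite -(@ler_pXn2r _ 2) ?nnegrE ?edistance_ge0 // sqr_enorm.
    by under eq_bigr do rewrite !mxE.
  rewrite -[edistance _ _ <= _](@ler_pXn2r _ 2) ?nnegrE ?edistance_ge0 // sqr_enorm.
  by under [X in _ -> X <= _]eq_bigr do rewrite !mxE.
by rewrite -[X in measurable X]setTI; apply: mD => //; exact: measurable_itv.
Qed.

Lemma measurable_edistance_ge (f g : Omega -> 'rV[R]_d) (r : R) :
  measurable_fun setT f -> measurable_fun setT g ->
  measurable [set w | r <= edistance (f w) (g w)].
Proof.
move=> mf mg.
rewrite (_ : [set _ | _] = \bigcap_(k : nat)
   ~` [set w | edistance (f w) (g w) <= r - k.+1%:R^-1]).
  by apply: bigcapT_measurable => k; apply: measurableC; exact: measurable_edistance_le.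
apply/seteqP; split=> w /= => [h k _ /= h'|h].
  by have := le_trans h h'; rewrite lerBrDl gerDr leNgt invr_gt0 ltr0n.
rewrite leNgt; apply/negP => hr.
have [k hk] := ltr_add_invr hr.
by apply: (h k I) => /=; rewrite lerBrDr ltW.
Qed.

End finite_patterns.

Section deep_points.
Context {R : realType} (d : nat) (X : set 'rV[R]_d) (h : R).

Lemma measurable_deep_point : measurable X -> measurable (deep_point X h).
Proof.
move=> mX; rewrite (_ : deep_point X h =
    X `&` ~` (\bigcup_(y in frontier X) eball y h)); last first.
  apply/seteqP; split=> x [Xx]; [move=> /dist_to_setP hx|move=> hx]; split => //.
    by move=> [y Fy]; rewrite /eball /= edistanceC ltNge hx.
  apply/dist_to_setP => y Fy; rewrite leNgt; apply/negP => xy; apply: hx; exists y => //.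
  by rewrite /eball /= edistanceC.
apply: measurableI => //; apply: measurableC; apply: open_measurable_rV => x Ux.
have : open (\bigcup_(y in frontier X) eball y h).
  by apply: bigcup_open => y _; exact: open_eball.
by rewrite openE => /(_ _ Ux) /nbhs_eball.
Qed.

End deep_points.

(** * Independence of the pair and Chernoff bounds *)

Section concentration.
Context {R : realType} (d : nat) {dOmega : measure_display} {Omega : measurableType dOmega}.
Context (P : probability Omega R) (p : 'rV[R]_d -> R) (Z : nat -> Omega -> 'rV[R]_d).
Hypothesis Z_iid : iid_with_density P p Z.
Variables (n : nat) (i j : 'I_n).
Hypothesis ij : i != j.

Let mZ k : measurable_fun setT (Z k). Proof. by case: Z_iid. Qed.

Let mpre k B : measurable B -> measurable (Z k @^-1` B).
Proof. by move=> mB; rewrite -[X in measurable X]setTI; exact: mZ. Qed.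

Let pairZ w := (Z i w, Z j w).

Let m_pairZ : measurable_fun setT pairZ.
Proof. by apply/measurable_fun_pairP; split; exact: mZ. Qed.

Let fin_P A : measurable A -> P A \is a fin_num.
Proof. exact: fin_num_measure. Qed.

Let inner k := (k != i :> nat) && (k != j :> nat).

Let prod_split (F : nat -> \bar R) : (\prod_(k < n) F k =
  F i * F j * \prod_(k < n | inner k) F k)%E.
Proof.
rewrite (bigD1 i) //= (bigD1 j) /=; last by rewrite eq_sym.
by rewrite muleA; congr (_ * _)%E.
Qed.

Let ji : (j : nat) != i :> nat. Proof. by rewrite eq_sym. Qed.

Let rect_independent (B1 B2 : set 'rV[R]_d) (D : nat -> set 'rV[R]_d) :
  measurable B1 -> measurable B2 -> (forall k, measurable (D k)) ->
  P (((Z i @^-1` B1) `&` (Z j @^-1` B2)) `&`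
     \bigcap_(k in [set k | (k < n)%N && inner k]) (Z k @^-1` D k)) =
  (P (Z i @^-1` B1) * P (Z j @^-1` B2) * \prod_(k < n | inner k) P (Z k @^-1` D k))%E.
Proof.
move=> mB1 mB2 mD; case: Z_iid => _ _ indep.
pose D' (k : nat) := if k == i :> nat then B1 else if k == j :> nat then B2 else D k.
have mD' k : measurable (D' k) by rewrite /D'; case: eqP => // _; case: eqP.
have := indep n D' mD'; rewrite (prod_split (fun k => P (Z k @^-1` D' k))).
rewrite /D' eqxx (negbTE ji) eqxx => e.
transitivity (P (\bigcap_(k in `I_n) (Z k @^-1` D' k))).
  congr (P _); apply/seteqP; split=> w.
    move=> [[w1 w2] w3] k /= kn; rewrite /D'; case: eqP => [->//|/eqP ki].
    by case: eqP => [->//|/eqP kj]; apply: w3; rewrite /= kn /inner ki.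
  move=> H; split; first split.
  - by have := H i (ltn_ord i); rewrite /= /D' eqxx.
  - by have := H j (ltn_ord j); rewrite /= /D' (negbTE ji) eqxx.
  move=> k /= /and3P[kn ki kj]; have := H k kn.
  by rewrite /= /D' (negbTE ki) (negbTE kj).
rewrite e; congr (_ * _)%E; apply: eq_bigr => k /andP[ki kj].
by rewrite (negbTE ki) (negbTE kj).
Qed.

Lemma two_independent (B1 B2 : set 'rV[R]_d) : measurable B1 -> measurable B2 ->
  P ((Z i @^-1` B1) `&` (Z j @^-1` B2)) = (P (Z i @^-1` B1) * P (Z j @^-1` B2))%E.
Proof.
move=> mB1 mB2; have := @rect_independent B1 B2 (fun=> setT) mB1 mB2 (fun=> measurableT).
rewrite [X in _ `&` X](_ : _ = setT); last by apply/seteqP; split.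
rewrite setIT => ->; rewrite big1 ?mule1 // => k _.
by rewrite preimage_setT probability_setT.
Qed.

(** The event that the pair is deep and far apart is not a rectangle, so the product rule is
    extended from rectangles to all measurable [C] by uniqueness of finite measures. *)
Lemma pair_independent (C : set ('rV[R]_d * 'rV[R]_d)) (B : nat -> set 'rV[R]_d) :
  measurable C -> (forall k, measurable (B k)) ->
  P ((pairZ @^-1` C) `&` \bigcap_(k in [set k | (k < n)%N && inner k]) (Z k @^-1` B k)) =
  (P (pairZ @^-1` C) * \prod_(k < n | inner k) P (Z k @^-1` B k))%E.
Proof.
move=> mC mB; set F := \bigcap_(k in _) _.
have mF : measurable F by apply: bigcap_measurableType => k _; exact: mpre.
have PF : P F = (\prod_(k < n | inner k) P (Z k @^-1` B k))%E.
  have := @rect_independent setT setT B measurableT measurableT mB.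
  by rewrite !preimage_setT !setTI probability_setT !mul1e.
rewrite -PF.
have PF0 : 0 <= fine (P F) by rewrite fine_ge0.
have uniq := @measure_unique _ _ _
  [set A `*` B | A in @measurable _ 'rV[R]_d & B in @measurable _ 'rV[R]_d] (fun=> setT)
  (measurable_prod_measurableType _ _) _ _ _
  (pushforward (mrestr P mF) pairZ) (mscale (NngNum PF0) (pushforward P pairZ)).
have -> : (P ((pairZ @^-1` C) `&` F) = (fine (P F))%:E * P (pairZ @^-1` C))%E.
  apply: (uniq _ _ _ m_pairZ m_pairZ _ _ C mC).
  - move=> _ _ [A1 mA1 [A2 mA2 <-]] [A3 mA3 [A4 mA4 <-]].
    exists (A1 `&` A3); first exact: measurableI.
    by exists (A2 `&` A4); [exact: measurableI|rewrite setXI].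
  - by move=> _; exists setT => //; exists setT => //; rewrite setXTT.
  - by rewrite bigcup_const //; exists 0%N.
  - move=> _ [A1 mA1 [A2 mA2 <-]].
    change (P ((Z i @^-1` A1 `&` Z j @^-1` A2) `&` F) =
      (fine (P F))%:E * P (Z i @^-1` A1 `&` Z j @^-1` A2))%E.
    by rewrite rect_independent // -PF two_independent // fineK ?fin_P // muleC.
  - move=> _; change (P (setT `&` F) < +oo)%E.
    by rewrite setTI -ge0_fin_numE // fin_P.
by rewrite fineK ?fin_P // muleC.
Qed.


Definition inner_count (B : set 'rV[R]_d) (w : Omega) : nat :=
  #|[set k : 'I_n | (k \notin [:: i; j]) && `[< B (Z k w) >]]%SET|.

Let innerE (k : 'I_n) : inner k = (k \notin [:: i; j]).
Proof. by rewrite !inE negb_or. Qed.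

Let card_inner : #|[pred k : 'I_n | inner k]| = (n - 2)%N.
Proof.
have := cardC (pred2 i j); rewrite card2 ij card_ord => e.
rewrite -[X in (X - 2)%N]e addKn; apply: eq_card => k.
by rewrite !inE /inner negb_or.
Qed.

Lemma measurable_inner_count B (Q : pred nat) : measurable B ->
  measurable [set w | Q (inner_count B w)].
Proof.
move=> mB; apply: (@measurable_finite_determined _ _ 'I_n (fun k => Z k @^-1` B)).
  by move=> k; exact: mpre.
move=> w w' ww'; rewrite /= /inner_count (_ : [set k | _]%SET =
  [set k : 'I_n | (k \notin [:: i; j]) && `[< B (Z k w') >]]%SET) //.
by apply/setP => k; rewrite !inE; congr (_ && _); apply: asbool_equiv_eq; exact: ww'.
Qed.

Let measure_union_le (I : finType) (Q : pred I) (E : I -> set Omega) :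
  (forall k, measurable (E k)) ->
  (P (\big[setU/set0]_(k | Q k) E k) <= \sum_(k | Q k) P (E k))%E.
Proof.
move=> mE; elim: (index_enum I) => [|k r IH]; first by rewrite !big_nil measure0.
rewrite !big_cons; case: (Q k) => //; apply: le_trans (measureU2 _ _ _) _ => //.
  exact: bigsetU_measurable.
by rewrite leeD2l.
Qed.

(** The exponential Markov inequality in finite form: the event is split by the set [S] of inner
    points lying in [B], and a bad pattern has t * x^#|S| >= 1. Summing the weights over all
    patterns gives the binomial generating function. An arbitrary [bad] serves both tails. *)
Lemma count_tail C B (q x t : R) (bad : pred nat) :
  measurable C -> measurable B -> (forall k, P (Z k @^-1` B) = q%:E) ->
  0 <= x -> 0 <= t -> (forall c : nat, bad c -> 1 <= t * x ^+ c) ->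
  (P ((pairZ @^-1` C) `&` [set w | bad (inner_count B w)])
    <= P (pairZ @^-1` C) * (t * (1 - q + q * x) ^+ (n - 2))%:E)%E.
Proof.
move=> mC mB Pq x0 t0 hbad; set A := pairZ @^-1` C.
have mA : measurable A by rewrite -[X in measurable X]setTI; exact: m_pairZ.
have q0 : 0 <= q by rewrite -lee_fin -(Pq 0%N).
have q1 : q <= 1 by rewrite -lee_fin -(Pq 0%N) probability_le1 //; exact: mpre.
pose B' (S : {set 'I_n}) (k : nat) :=
  if oapp (fun l : 'I_n => l \in S) false (insub k) then B else ~` B.
have mB' S k : measurable (B' S k).
  by rewrite /B'; case: ifP => _ //; exact: measurableC.
pose E S := A `&` \bigcap_(k in [set k | (k < n)%N && inner k]) (Z k @^-1` B' S k).
have mE S : measurable (E S).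
  by apply: measurableI => //; apply: bigcap_measurableType => k _; exact: mpre.
pose wt (S : {set 'I_n}) : R := \prod_(k < n | inner k) (if k \in S then q else 1 - q).
have PE S : P (E S) = (P A * (wt S)%:E)%E.
  rewrite /E pair_independent //; congr (_ * _)%E.
  rewrite /wt (@big_morph _ _ _ 1%E _ 1 _ EFinM) //; apply: eq_bigr => k _.
  rewrite /B' valK /=; case: ifP => _ //.
  by rewrite preimage_setC probability_setC ?Pq //; exact: mpre.
pose I0 : {set 'I_n} := [set k : 'I_n | inner k]%SET.
pose Q (S : {set 'I_n}) := (S \subset I0) && bad #|S|.
have sub : A `&` [set w | bad (inner_count B w)] `<=` \big[setU/set0]_(S | Q S) E S.
  move=> w [Aw bw]; rewrite -bigcup_seq_cond.
  exists [set k : 'I_n | (k \notin [:: i; j]) && `[< B (Z k w) >]]%SET.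
    rewrite /= mem_index_enum /=; apply/andP; split => //.
    by apply/fintype.subsetP => k; rewrite !finset.in_set innerE => /andP[].
  split=> // k /= /andP[kn ik]; rewrite /B' (insubT (fun m => (m < n)%N) kn) /= finset.in_set.
  by rewrite -innerE /= ik /=; case: asboolP.
apply: (@le_trans _ _ (\sum_(S | Q S) P (E S))%E).
  apply: le_trans (measure_union_le _ mE); apply: le_measure => //; rewrite inE.
    by apply: measurableI => //; exact: measurable_inner_count.
  exact: bigsetU_measurable.
under eq_bigr do rewrite PE.
rewrite -ge0_sume_distrr; last first.
  by move=> S _; rewrite lee_fin prodr_ge0 // => k _; case: ifP => _ //; rewrite subr_ge0.
apply: lee_wpmul2l => //; rewrite sumEFin lee_fin.
(* The values 0 in [F] and 1 in [G] at [i] and [j] cancel every [S] containing one of them, so the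
   product over all indices expands correctly. *)
pose F k : R := if inner k then q * x else 0.
pose G k : R := if inner k then 1 - q else 1.
have F0 k : 0 <= F k by rewrite /F; case: ifP => // _; rewrite mulr_ge0.
have G0 k : 0 <= G k by rewrite /G; case: ifP => // _; rewrite subr_ge0.
have FG0 (S : {set 'I_n}) : 0 <= \prod_(k < n) (if k \in S then F k else G k).
  by apply: prodr_ge0 => k _; case: ifP.
have total : (1 - q + q * x) ^+ (n - 2) = \sum_(S : {set 'I_n}) \prod_(k < n) (if k \in S then F k else G k).
  rewrite -(@bigA_distr _ 0 1 *%R +%R 'I_n (fun k => F k) (fun k => G k)) /=.
  rewrite -card_inner -prodr_const big_mkcond; apply: eq_bigr => k _.
  by rewrite /F /G inE; case: (inner k); rewrite ?add0r // addrC.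
rewrite total mulr_sumr big_mkcond; apply: ler_sum => S _.
case: ifP => [/andP[SI bS]|_]; last by rewrite mulr_ge0.
have wt0 : 0 <= wt S.
  by apply: prodr_ge0 => k _; case: ifP => // _; rewrite subr_ge0.
have -> : \prod_(k < n) (if k \in S then F k else G k) = x ^+ #|S| * wt S.
  have -> : x ^+ #|S| = \prod_(k < n | inner k) (if k \in S then x else 1).
    rewrite -prodr_const -big_mkcondr; apply: eq_bigl => k.
    have [kS|] := boolP (k \in S); last by rewrite andbF.
    by move/fintype.subsetP : SI => /(_ k kS); rewrite inE => ->.
  rewrite -big_split big_mkcond [RHS]big_mkcond /= big_mkcond.
  apply: eq_bigr => k _; rewrite /F /G.
  have [ik|nik] := boolP (inner k).
    by case: ifP => _; rewrite ?mul1r // mulrC.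
  case: ifP => // kS; move/fintype.subsetP : SI => /(_ k kS).
  by rewrite inE (negbTE nik).
by rewrite mulrA ler_peMl // hbad.
Qed.

Let exp_taylor_le (y : R) : 0 <= y -> y <= 1 / 2 -> expR y <= 1 + y + 2 * y ^+ 2.
Proof.
move=> y0 y2; have h := expR_ge1Dx (- y); rewrite expRN in h.
have e0 := expR_gt0 y.
have h2 : (1 - y) * expR y <= 1.
  by rewrite -[leRHS](mulVf (lt0r_neq0 e0)) ler_wpM2r // ltW.
by rewrite -(@ler_pM2l _ (1 - y)) ?(le_trans h2) //; nra.
Qed.

Let expN_taylor_le (y : R) : 0 <= y -> expR (- y) <= 1 - y + y ^+ 2.
Proof.
move=> y0; have h := expR_ge1Dx y; rewrite expRN.
have e0 := expR_gt0 y; rewrite -[leLHS]mul1r ler_pdivrMr //.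
apply: (@le_trans _ _ ((1 - y + y ^+ 2) * (1 + y))).
  by rewrite (_ : _ * (1 + y) = 1 + y ^+ 3) ?lerDl ?exprn_ge0 //; ring.
by rewrite ler_wpM2l //; nra.
Qed.

Let base_le (q x : R) : 0 <= 1 - q + q * x ->
  (1 - q + q * x) ^+ (n - 2) <= expR ((n - 2)%:R * (q * (x - 1))).
Proof.
move=> b0; rewrite expRM_natl lerXn2r ?nnegrE ?expR_ge0 //.
by apply: le_trans (expR_ge1Dx _); rewrite le_eqVlt; apply/orP; left; apply/eqP; ring.
Qed.

Lemma chernoff_lower C B (q delta : R) :
  measurable C -> measurable B -> (forall k, P (Z k @^-1` B) = q%:E) ->
  0 < delta -> delta <= 1 ->
  (P ((pairZ @^-1` C) `&` [set w | ((inner_count B w)%:R <= (1 - delta) * ((n - 2)%:R * q))%R])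
    <= P (pairZ @^-1` C) * (expR (- (delta ^+ 2 / 8 * ((n - 2)%:R * q))))%:E)%E.
Proof.
move=> mC mB Pq d0 d1; pose M := (n - 2)%:R * q.
have q0 : 0 <= q by rewrite -lee_fin -(Pq 0%N).
have q1 : q <= 1 by rewrite -lee_fin -(Pq 0%N) probability_le1 //; exact: mpre.
have M0 : 0 <= M by rewrite mulr_ge0.
have l0 : 0 <= delta / 4 by rewrite divr_ge0 // ltW.
(* With this tilt the second-order expansion gives the exponent -3/16 * delta^2 * M, below the
   claimed -delta^2/8 * M. *)
pose x := expR (- (delta / 4)); pose t := expR (delta / 4 * ((1 - delta) * M)).
apply: le_trans (@count_tail C B q x t (fun c => c%:R <= (1 - delta) * M) mC mB Pq _ _ _) _.
- exact: expR_ge0.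
- exact: expR_ge0.
- move=> c hc; rewrite /x /t -expRM_natl -expRD -[leLHS]expR0 ler_expR.
  have -> : delta / 4 * ((1 - delta) * M) + c%:R * - (delta / 4) =
    delta / 4 * ((1 - delta) * M - c%:R) by ring.
  by rewrite mulr_ge0 // subr_ge0.
apply: lee_wpmul2l => //; rewrite lee_fin.
apply: (@le_trans _ _ (t * expR ((n - 2)%:R * (q * (x - 1))))).
  rewrite ler_wpM2l ?expR_ge0 // base_le // addr_ge0 ?subr_ge0 // mulr_ge0 //; exact: expR_ge0.
rewrite /t -expRD ler_expR (_ : (n - 2)%:R * _ = M * (x - 1)); last by rewrite /M; ring.
have h := expN_taylor_le l0.
apply: (@le_trans _ _ (delta / 4 * ((1 - delta) * M) + M * (- (delta / 4) + (delta / 4) ^+ 2))).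
  by rewrite lerD2l ler_wpM2l // lerBlDl addrA.
rewrite -/M -subr_ge0 (_ : _ - _ = M * (delta ^+ 2 / 16)); last by field.
by rewrite mulr_ge0 // divr_ge0 // sqr_ge0.
Qed.

Lemma chernoff_upper C B (q delta : R) :
  measurable C -> measurable B -> (forall k, P (Z k @^-1` B) = q%:E) ->
  0 < delta -> delta <= 1 ->
  (P ((pairZ @^-1` C) `&` [set w | ((1 + delta) * ((n - 2)%:R * q) <= (inner_count B w)%:R)%R])
    <= P (pairZ @^-1` C) * (expR (- (delta ^+ 2 / 8 * ((n - 2)%:R * q))))%:E)%E.
Proof.
move=> mC mB Pq d0 d1; pose M := (n - 2)%:R * q.
have q0 : 0 <= q by rewrite -lee_fin -(Pq 0%N).
have q1 : q <= 1 by rewrite -lee_fin -(Pq 0%N) probability_le1 //; exact: mpre.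
have M0 : 0 <= M by rewrite mulr_ge0.
have l0 : 0 <= delta / 4 by rewrite divr_ge0 // ltW.
have l1 : delta / 4 <= 1 / 2 by move: d1; lra.
(* Here the expansion gives exactly -delta^2/8 * M. *)
pose x := expR (delta / 4); pose t := expR (- (delta / 4 * ((1 + delta) * M))).
apply: le_trans (@count_tail C B q x t (fun c => (1 + delta) * M <= c%:R) mC mB Pq _ _ _) _.
- exact: expR_ge0.
- exact: expR_ge0.
- move=> c hc; rewrite /x /t -expRM_natl -expRD -[leLHS]expR0 ler_expR.
  have -> : - (delta / 4 * ((1 + delta) * M)) + c%:R * (delta / 4) =
    delta / 4 * (c%:R - (1 + delta) * M) by ring.
  by rewrite mulr_ge0 // subr_ge0.
apply: lee_wpmul2l => //; rewrite lee_fin.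
apply: (@le_trans _ _ (t * expR ((n - 2)%:R * (q * (x - 1))))).
  rewrite ler_wpM2l ?expR_ge0 // base_le // addr_ge0 ?subr_ge0 // mulr_ge0 //; exact: expR_ge0.
rewrite /t -expRD ler_expR (_ : (n - 2)%:R * _ = M * (x - 1)); last by rewrite /M; ring.
have h := exp_taylor_le l0 l1.
apply: (@le_trans _ _ (- (delta / 4 * ((1 + delta) * M)) + M * (delta / 4 + 2 * (delta / 4) ^+ 2))).
  by rewrite lerD2l ler_wpM2l // lerBlDl addrA.
by rewrite -/M -subr_ge0 (_ : _ - _ = 0) //; field.
Qed.

End concentration.

Lemma leq_sub2_double n : (4 <= n)%N -> (n <= (n - 2) * 2)%N.
Proof. by move=> n4; lia. Qed.

(** * The exceptional event for the commute distance *)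

Section commute_concentration.
Context {R : realType} (d : nat) (p : 'rV[R]_d -> R) (X : set 'rV[R]_d) (pmin h : R).
Hypothesis d_ge2 : (2 <= d)%N.
Hypothesis p_density : is_density p.
Hypothesis X_valid : valid_region p X pmin h.
Notation leb := (lebesgue_rV d : set 'rV[R]_d -> \bar R).

Let h0 := region_h_gt0 X_valid.
Let pm0 := region_pmin_gt0 X_valid.
Let Xp := region_density X_valid.

Section family.
Context {dOmega : measure_display} {Omega : measurableType dOmega}.
Context (P : probability Omega R) (Z : nat -> Omega -> 'rV[R]_d).
Hypothesis Z_iid : iid_with_density P p Z.
Variables (n : nat) (i j : 'I_n).
Hypothesis ij : i != j.

Lemma law_fine B : measurable B -> forall k, P (Z k @^-1` B) = (fine (P (Z 0%N @^-1` B)))%:E.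
Proof.
move=> mB k; case: Z_iid => mZ law _; rewrite law // -(law 0%N) // fineK //.
by apply: fin_num_measure; rewrite -[X in measurable X]setTI; exact: mZ.
Qed.

(** The union bound over the family, with Chernoff's bound at delta = 1/2: the rate is (1/2)^2 / 8 =
    1/32. *)
Lemma family_event (N : nat) (F : 'I_N -> set 'rV[R]_d) (u : R) : 0 <= u ->
  (forall k, measurable (F k)) -> (forall k, F k `<=` X) ->
  (forall k, (u%:E <= leb (F k))%E) ->
  exists Bad : set Omega, [/\ measurable Bad,
    forall C, measurable C ->
      (P ([set w | C (Z i w, Z j w)] `&` Bad) <= P [set w | C (Z i w, Z j w)] *
        (N%:R * expR (- (32^-1 * ((n - 2)%:R * (pmin * u)))))%:E)%E &
    forall w, ~ Bad w -> forall k,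
      2^-1 * ((n - 2)%:R * (pmin * u)) < (inner_count Z i j (F k) w)%:R].
Proof.
move=> u0 mF FX Fu; case: (Z_iid) => mZ law _.
pose q k := fine (P (Z 0%N @^-1` F k)).
have Pq k l : P (Z l @^-1` F k) = (q k)%:E by exact: law_fine.
have qge k : pmin * u <= q k.
  rewrite -lee_fin -(Pq k 0%N) law // EFinM.
  apply: le_trans (mass_ge p_density (mF k) (ltW pm0) _); last by move=> x /FX; exact: Xp.
  by rewrite lee_pmul2l ?lte_fin.
pose E k := [set w | (inner_count Z i j (F k) w)%:R <= (1 - 2^-1) * ((n - 2)%:R * q k)].
have mE k : measurable (E k).
  exact: (measurable_inner_count Z_iid i j (fun c => c%:R <= (1 - 2^-1) * ((n - 2)%:R * q k)) (mF k)).
exists (\big[setU/set0]_k E k); split.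
- exact: bigsetU_measurable.
- move=> C mC; set A := [set w | _].
  have mA : measurable A.
    rewrite -[X in measurable X]setTI.
    have mp : measurable_fun setT (fun w => (Z i w, Z j w)).
      by apply/measurable_fun_pairP; split; exact: mZ.
    exact: (mp measurableT C mC).
  rewrite -bigcup_seq setI_bigcupr bigcup_seq.
  have -> : (P A * (N%:R * expR (- (32^-1 * ((n - 2)%:R * (pmin * u)))))%:E)%E =
      (\sum_(k < N) P A * (expR (- (32^-1 * ((n - 2)%:R * (pmin * u)))))%:E)%E.
    rewrite -[P A]fineK ?fin_num_measure // -EFinM sumEFin sumr_const card_ord.
    by rewrite -mulr_natl; congr EFin; ring.
  elim: (index_enum _) => [|k r IH]; first by rewrite !big_nil measure0.
  rewrite !big_cons; apply: le_trans (measureU2 _ _ _) _.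
  + exact: measurableI.
  + by apply: bigsetU_measurable => l _; exact: measurableI.
  apply: leeD IH; apply: le_trans (chernoff_lower Z_iid ij mC (mF k) (Pq k) _ _) _.
  + by rewrite invr_gt0.
  + by rewrite invf_le1 // ler1n.
  apply: lee_wpmul2l => //; rewrite lee_fin ler_expR lerN2.
  rewrite (_ : 2^-1 ^+ 2 / 8 = 32^-1); last by field.
  by rewrite ler_wpM2l ?invr_ge0 // ler_wpM2l.
move=> w nB k; rewrite ltNge; apply/negP => hle; apply: nB.
rewrite -bigcup_seq; exists k; first by rewrite /= mem_index_enum.
apply: le_trans hle _; rewrite (_ : 1 - 2^-1 = 2^-1); last by field.
by rewrite ler_wpM2l ?invr_ge0 // ler_wpM2l.
Qed.

End family.

Let asbool_eq_cell s z (y : 'rV[R]_d) : `[< cell_set s z y >] = (cell s y == z).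
Proof. by apply/asboolP/eqP. Qed.

Lemma eps_edge_sym n (x : 'I_n -> 'rV[R]_d) eps : symmetric (eps_edge x eps).
Proof. by move=> a b; rewrite /eps_edge /= eq_sym edistanceC. Qed.

(* The exceptional event only involves the points other than the i-th and j-th,
   so it is independent of every event about these two. *)
Lemma commute_concentration : exists D C c : R, [/\ 0 < D, 0 < C, 0 < c &
  forall (dOmega : measure_display) (Omega : measurableType dOmega)
    (P : probability Omega R) (Z : nat -> Omega -> 'rV[R]_d),
  iid_with_density P p Z -> forall n eps (i j : 'I_n),
  0 < eps -> eps <= h -> i != j ->
  exists Bad : set Omega, [/\ measurable Bad,
    forall B, measurable B ->
      (P ([set w | B (Z i w, Z j w)] `&` Bad) <= P [set w | B (Z i w, Z j w)] *
        (C * expR (- (c * (n%:R * eps ^+ d))) / eps ^+ d)%:E)%E &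
    forall w, ~ Bad w -> deep_point X h (Z i w) -> deep_point X h (Z j w) ->
      8 * eps <= edistance (Z i w) (Z j w) ->
      let x := fun k : 'I_n => Z k w in components_meet X x eps ->
      commute_distance (eps_graph x eps) i j \is a fin_num /\
      `| scaled_commute x eps i j
         - (scaled_inverse_degree x eps i + scaled_inverse_degree x eps j) |
        <= D / (n%:R * eps ^+ d) * (if d == 2%N then eps^-1 else 1)]].
Proof.
have [C0 C00 det] := deterministic_bound d_ge2 p_density X_valid.
have [Cn [v [Cn0 v0 net]]] := region_net p_density X_valid.
have sd0 : 0 < 8 * Num.sqrt d%:R :> R by rewrite mulr_gt0 // sqrtr_gt0 ltr0n (leq_trans _ d_ge2).
pose cs : R := (8 * Num.sqrt d%:R)^-1 ^+ d.
have cs0 : 0 < cs by rewrite exprn_gt0 // invr_gt0.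
(* The 4 combines the 1/2 from Chernoff with n - 2 >= n/2; likewise the 64 in [c] is 32 * 2. *)
pose kappa := pmin * cs / 4; have ka0 : 0 < kappa by rewrite divr_gt0 // mulr_gt0.
pose mu := pmin * Num.min cs v.
have mu0 : 0 < mu by rewrite mulr_gt0 // lt_min cs0.
pose c := mu / 64; have c0 : 0 < c by rewrite divr_gt0.
pose CN := (pmin * cs)^-1 + Cn.
have CN0 : 0 < CN by rewrite addr_gt0 // invr_gt0 mulr_gt0.
(* [CN] bounds the number of sets times eps^d. The second summand makes the probability bound at
   least 1 when n < 4, where [Bad] is everything. *)
pose C := CN + h ^+ d * expR (c * (4 * h ^+ d)).
have hd0 : 0 < h ^+ d by rewrite exprn_gt0.
have CNC : CN <= C by rewrite lerDl mulr_ge0 ?expR_ge0 // ltW.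
exists (C0 / kappa ^+ 2), C, c; split => //.
- by rewrite divr_gt0 // exprn_gt0.
- exact: lt_le_trans CNC.
move=> dOmega Omega P Z Z_iid n eps i j e0 eh ij.
have ed0 : 0 < eps ^+ d by rewrite exprn_gt0.
have edh : eps ^+ d <= h ^+ d by rewrite lerXn2r ?nnegrE // ltW.
have [n4|n4] := ltnP n 4.
  exists setT; split=> // [B mB|w /(_ I)//]; rewrite setIT.
  have mA : measurable [set w | B (Z i w, Z j w)].
    rewrite -[X in measurable X]setTI; case: (Z_iid) => mZ _ _.
    have mp : measurable_fun setT (fun w => (Z i w, Z j w)).
      by apply/measurable_fun_pairP; split; exact: mZ.
    exact: (mp measurableT B mB).
  rewrite -[leLHS]mule1; apply: lee_wpmul2l => //; rewrite lee_fin ler_pdivlMr // mul1r.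
  apply: (le_trans edh); rewrite expRN ler_pdivlMr ?expR_gt0 //.
  apply: (@le_trans _ _ (h ^+ d * expR (c * (4 * h ^+ d)))); last by rewrite lerDr ltW.
  rewrite ler_wpM2l ?(ltW hd0) // ler_expR ler_wpM2l ?(ltW c0) //.
  by apply: ler_pM => //; [exact: ltW|rewrite ler_nat ltnW].
have nR : n%:R / 2 <= (n - 2)%:R :> R.
  by rewrite ler_pdivrMr // -natrM ler_nat leq_sub2_double.
have s0 := cell_side_gt0 d_ge2 e0.
have sE : cell_side d eps ^+ d = cs * eps ^+ d.
  by rewrite /cell_side exprMn mulrC.
have [N1 [z [N1le zX zall]]] := region_cells p_density X_valid s0.
have [N2 [S [N2le mSX Sv Sconn]]] := net eps e0 eh.
have [||||Bad1 [mBad1 PBad1 good1]] := @family_event _ _ P Z Z_iid n i j ij N1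
  (fun k => cell_set (cell_side d eps) (z k)) (cs * eps ^+ d).
- by rewrite mulr_ge0 ?ltW.
- by move=> k; exact: measurable_cell_set.
- exact: zX.
- by move=> k; rewrite volume_cell_set // sE.
have [||||Bad2 [mBad2 PBad2 good2]] := @family_event _ _ P Z Z_iid n i j ij N2
  S (v * eps ^+ d).
- by rewrite mulr_ge0 ?ltW.
- by move=> k; have [] := mSX k.
- by move=> k; have [] := mSX k.
- exact: Sv.
exists (Bad1 `|` Bad2); split.
- exact: measurableU.
- move=> B mB; set A := [set w | _].
  have mA : measurable A.
    rewrite -[X in measurable X]setTI; case: (Z_iid) => mZ _ _.
    have mp : measurable_fun setT (fun w => (Z i w, Z j w)).
      by apply/measurable_fun_pairP; split; exact: mZ.
    exact: (mp measurableT B mB).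
  rewrite setIUr; apply: le_trans (measureU2 _ _ _) _; [exact: measurableI|exact: measurableI|].
  apply: (le_trans (leeD (PBad1 B mB) (PBad2 B mB))).
  rewrite -/A -ge0_muleDr ?lee_fin ?mulr_ge0 ?expR_ge0 //.
  apply: lee_wpmul2l => //; rewrite -EFinD lee_fin.
  have exple w : mu * eps ^+ d <= pmin * w ->
      expR (- (32^-1 * ((n - 2)%:R * (pmin * w)))) <= expR (- (c * (n%:R * eps ^+ d))).
    move=> hw; rewrite ler_expR lerN2.
    have -> : c * (n%:R * eps ^+ d) = 32^-1 * (n%:R / 2 * (mu * eps ^+ d)) by rewrite /c; field.
    rewrite ler_wpM2l ?invr_ge0 //; apply: ler_pM => //.
    by rewrite mulr_ge0 // ltW.
  have e1 : mu * eps ^+ d <= pmin * (cs * eps ^+ d).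
    by rewrite mulrA ler_wpM2r ?(ltW ed0) // ler_wpM2l ?(ltW pm0) // ge_min lexx.
  have e2 : mu * eps ^+ d <= pmin * (v * eps ^+ d).
    by rewrite mulrA ler_wpM2r ?(ltW ed0) // ler_wpM2l ?(ltW pm0) // ge_min lexx orbT.
  have N1le' : N1%:R <= (pmin * cs)^-1 / eps ^+ d.
    by rewrite -invfM -[leRHS]mul1r ler_pdivlMr ?mulr_gt0 // -mulrA -sE.
  have N2le' : N2%:R <= Cn / eps ^+ d by rewrite ler_pdivlMr.
  apply: (@le_trans _ _ ((N1%:R + N2%:R) * expR (- (c * (n%:R * eps ^+ d))))).
    by rewrite mulrDl; apply: lerD; rewrite ler_wpM2l // exple.
  rewrite [leRHS]mulrAC; apply: ler_wpM2r; first exact: expR_ge0.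
  apply: (@le_trans _ _ (CN / eps ^+ d)); first by rewrite mulrDl lerD.
  by rewrite ler_wpM2r ?invr_ge0 // ltW.
move=> w /not_orP[nB1 nB2] di dj far x comp.
have n0 : 0 < n%:R :> R by rewrite ltr0n (leq_trans _ n4).
have m0 : 0 < kappa * (n%:R * eps ^+ d) by rewrite !mulr_gt0.
(* Each component meets [X], and the populated net connects all sample points of [X]. *)
have conn k l : connect (eps_edge x eps) k l.
  have [k' kk' Xk] := comp k; have [l' ll' Xl] := comp l.
  apply: (connect_trans kk'); apply: (connect_trans (y := l')).
    apply: Sconn Xk Xl => a; have := good2 w nB2 a => hlt.
    have : (0 < inner_count Z i j (S a) w)%N.
      rewrite -(ltr0n R); apply: le_lt_trans hlt.
      by rewrite !mulr_ge0 // ltW.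
    by case/card_gt0P => b; rewrite inE => /andP[_ /asboolP Sb]; exists b.
  by rewrite (sym_connect_sym (eps_edge_sym x eps)).
have [|fin dev] := det n x eps i j _ e0 eh ij di dj far m0 _ conn.
  move=> y yX; have [k ->] := zall y yX.
  apply: ltW; have := good1 w nB1 k; rewrite /inner_count.
  under eq_finset do rewrite asbool_eq_cell.
  apply: le_lt_trans.
  rewrite (_ : kappa * _ = 2^-1 * (n%:R / 2 * (pmin * (cs * eps ^+ d)))); last first.
    by rewrite /kappa; field.
  have w0 : 0 <= pmin * (cs * eps ^+ d) by apply: ltW; rewrite !mulr_gt0.
  by rewrite ler_wpM2l ?invr_ge0 // ler_wpM2r.
split=> //; rewrite /scaled_commute /scaled_inverse_degree.
move: dev; set Cd := fine _; set vol := graph_volume _; set di' := degree _ i; set dj' := degree _ j.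
move=> dev; have ne0 : 0 < n%:R * eps ^+ d by rewrite mulr_gt0.
have -> : n%:R * eps ^+ d / vol * Cd - (n%:R * eps ^+ d / di' + n%:R * eps ^+ d / dj') =
   n%:R * eps ^+ d * (Cd / vol - (di'^-1 + dj'^-1)) by ring.
rewrite normrM gtr0_norm //; apply: le_trans (ler_wpM2l (ltW ne0) dev) _.
rewrite le_eqVlt; apply/orP; left; apply/eqP.
set g := if _ then _ else _; field.
by rewrite !lt0r_neq0.
Qed.

End commute_concentration.

(** * Limits of the two bounds *)

Section limits.
Context {R : realType} (d : nat).
Implicit Types eps : nat -> R.

Lemma cvg_inv_pinfty (f : nat -> R) : f n @[n --> \oo] --> +oo ->
  (f n)^-1 @[n --> \oo] --> (0 : R).
Proof.
move=> fy; have fpos : \forall n \near \oo, 0 < f n by exact: cvgry_gt.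
exact/(gtr0_cvgV0 fpos).
Qed.

Lemma near_ln_ge1 : \forall n \near \oo, (1 : R) <= ln n%:R.
Proof.
have [N] : exists N : nat, expR 1 <= N%:R :> R.
  by exists (Num.bound (expR 1 : R)); rewrite ltW // archi_boundP ?expR_ge0.
move=> hN; exists N => // n /= Nn; rewrite -[leLHS](expRK 1) ler_ln ?posrE ?expR_gt0 //.
  by rewrite (le_trans hN) // ler_nat.
by apply: lt_le_trans (expR_gt0 1) _; rewrite (le_trans hN) // ler_nat.
Qed.

Lemma log_condition_near eps (M : R) : log_condition d eps ->
  \forall n \near \oo, M * ln n%:R <= n%:R * eps n ^+ d.
Proof.
move=> logc; have h1 := near_ln_ge1.
have h2 : \forall n \near \oo, M <= n%:R * eps n ^+ d / ln n%:R by exact: cvgry_ge.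
near=> n; have l1 : (1 : R) <= ln n%:R by near: n.
by rewrite -ler_pdivlMr ?(lt_le_trans ltr01 l1) //; near: n.
Unshelve. all: by end_near. Qed.

(** Eventually n * eps^d exceeds (k/c) * ln n, so the exponential beats any prescribed power of
    n. *)
Lemma log_condition_expR eps (c : R) (k : nat) : 0 < c -> log_condition d eps ->
  \forall n \near \oo, expR (- (c * (n%:R * eps n ^+ d))) <= n%:R ^- k.
Proof.
move=> c0 /(@log_condition_near eps (k%:R / c)) h; have h1 := near_ln_ge1.
near=> n; have n0 : 0 < n%:R :> R.
  rewrite ltNge; apply/negP => /ln0 e.
  have : (1 : R) <= ln n%:R by near: n.
  by rewrite e ler10.
rewrite expRN lef_pV2 ?posrE ?expR_gt0 ?exprn_gt0 //.
rewrite -[X in X ^+ k]lnK ?posrE // -expRM_natl ler_expR.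
have : k%:R / c * ln n%:R <= n%:R * eps n ^+ d by near: n.
by rewrite -(ler_pM2l c0) mulrA mulrCA mulrA divfK ?lt0r_neq0.
Unshelve. all: by end_near. Qed.

Lemma log_condition_inv eps : (forall n, 0 < eps n) -> log_condition d eps ->
  \forall n \near \oo, (eps n ^+ d)^-1 <= n%:R.
Proof.
move=> eps0 /(@log_condition_near eps 1) h; have h1 := near_ln_ge1.
near=> n; have e0 : 0 < eps n ^+ d by rewrite exprn_gt0.
rewrite -[leLHS]mul1r ler_pdivrMr //.
have l1 : (1 : R) <= ln n%:R by near: n.
by apply: (le_trans l1); rewrite -[leLHS]mul1r; near: n.
Unshelve. all: by end_near. Qed.

Lemma log_condition_pinfty eps : log_condition d eps ->
  (n%:R * eps n ^+ d) @[n --> \oo] --> +oo.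
Proof.
move=> logc; apply/cvgryPge => A; have h1 := near_ln_ge1.
have h2 := @log_condition_near eps `|A| logc.
near=> n; have l1 : (1 : R) <= ln n%:R by near: n.
have : `|A| * ln n%:R <= n%:R * eps n ^+ d by near: n.
by apply: le_trans; apply: (le_trans (ler_norm A)); rewrite ler_peMr.
Unshelve. all: by end_near. Qed.

Lemma failure_bound_cvg (c1 c2 c3 c4 : R) eps : 0 < c1 -> 0 < c2 -> 0 < c3 -> 0 < c4 ->
  (forall n, 0 < eps n) -> log_condition d eps ->
  (1 - failure_bound d c1 c2 c3 c4 n (eps n)) @[n --> \oo] --> (1 : R).
Proof.
move=> c10 c20 c30 c40 eps0 logc.
suff : failure_bound d c1 c2 c3 c4 n (eps n) @[n --> \oo] --> (0 : R).
  by move=> /(cvgB (cvg_cst (1 : R))); rewrite subr0.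
have h1 := log_condition_expR 2 c20 logc; have h2 := log_condition_expR 2 c40 logc.
have h3 := log_condition_inv eps0 logc.
apply: (@squeeze_cvgr _ _ _ _ (fun=> 0) (fun n => (c1 + c3) * n%:R^-1)).
- have hh : \forall n \near \oo, 0 <= failure_bound d c1 c2 c3 c4 n (eps n)
      <= (c1 + c3) * n%:R^-1.
    near=> n; have e0 : 0 < eps n ^+ d by rewrite exprn_gt0.
    have n0 : 0 < n%:R :> R.
      apply: (@lt_le_trans _ _ (eps n ^+ d)^-1); first by rewrite invr_gt0.
      by near: n.
    have e1 : expR (- (c2 * (n%:R * eps n ^+ d))) <= n%:R ^- 2 by near: n.
    have e2 : expR (- (c4 * (n%:R * eps n ^+ d))) <= n%:R ^- 2 by near: n.
    have e3 : (eps n ^+ d)^-1 <= n%:R by near: n.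
    rewrite /failure_bound; apply/andP; split.
      by rewrite addr_ge0 // mulr_ge0 ?expR_ge0 ?invr_ge0 ?mulr_ge0 ?expR_ge0 // ltW.
    rewrite mulrDl; apply: lerD.
      rewrite -mulrA ler_pM2l //; apply: le_trans (ler_wpM2l (ltW n0) e1) _.
      by rewrite expr2 invfM mulrA divff ?mul1r // lt0r_neq0.
    rewrite -mulrA ler_pM2l //; apply: le_trans (ler_pM _ _ e2 e3) _.
    - exact: expR_ge0.
    - by rewrite invr_ge0 ltW.
    by rewrite expr2 invfM -mulrA mulVf ?mulr1 // lt0r_neq0.
  exact: hh.
- exact: cvg_cst.
- rewrite -[0](mulr0 (c1 + c3)); apply: cvgMr.
  by rewrite -(cvg_shiftS (fun n => n%:R^-1 : R)); exact: cvg_harmonic.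
Unshelve. all: by end_near. Qed.

Lemma deviation_bound_cvg (c5 c6 c7 : R) eps : rate_condition d eps ->
  deviation_bound d c5 c6 c7 n (eps n) @[n --> \oo] --> (0 : R).
Proof.
rewrite /rate_condition /deviation_bound; case: ifP => _; last case: ifP => _.
- by move=> /cvg_inv_pinfty h; rewrite -[0](mulr0 c5); apply: cvgMr.
- move=> /cvg_inv_pinfty h; rewrite -[0](mulr0 c6).
  under eq_fun do rewrite -mulrA -[ln _ / _]invf_div.
  exact: cvgMr.
- by move=> /cvg_inv_pinfty h; rewrite -[0](mulr0 c7); apply: cvgMr.
Qed.

End limits.

(** * The finite-sample statement *)

Section deviation.
Context {R : realType} (d : nat) {dOmega : measure_display} {Omega : measurableType dOmega}.
Context (Z : nat -> Omega -> 'rV[R]_d).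
Hypothesis mZ : forall k, measurable_fun setT (Z k).

Lemma measurable_graph_event n (X : set 'rV[R]_d) eps (Q : 'M[R]_n -> Prop) :
  measurable X ->
  measurable [set w | components_meet X (fun k : 'I_n => Z k w) eps ->
    Q (eps_graph (fun k : 'I_n => Z k w) eps)].
Proof.
move=> mX; pose E (k : ('I_n * 'I_n) + 'I_n) : set Omega :=
  match k with
  | inl uv => [set w | edistance (Z uv.1 w) (Z uv.2 w) <= eps]
  | inr l => Z l @^-1` X
  end.
apply: (@measurable_finite_determined _ _ _ E) => [[[u v]|l]|w w' ww' /= H] /=.
- exact: measurable_edistance_le.
- by rewrite -[X in measurable X]setTI; exact: mZ.
have edgeE u v : eps_edge (fun k : 'I_n => Z k w) eps u v
    = eps_edge (fun k : 'I_n => Z k w') eps u v.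
  rewrite /eps_edge /=; congr (_ && _).
  by apply/idP/idP; [move/(ww' (inl (u, v)))|move/(ww' (inl (u, v)))].
move=> comp; rewrite (_ : eps_graph _ _ = eps_graph (fun k : 'I_n => Z k w) eps).
  apply: H => k; have [l kl Xl] := comp k; exists l.
    by rewrite (eq_connect edgeE).
  exact/(ww' (inr l)).
by apply/matrixP => u v; rewrite !mxE edgeE.
Qed.

End deviation.

(** For d = 3 the raw bound has no logarithm. Keeping eps <= epsmax < 1 bounds ln(1/eps) below by
    ln(1/epsmax) > 0, so a factor 1 can be traded for the logarithm. *)
Lemma raw_bound_le_deviation (R : realType) (d : nat) (D epsmax : R) :
  (2 <= d)%N -> (d = 3%N -> epsmax < 1) -> 0 < D ->
  exists2 c6 : R, 0 < c6 & forall (n : nat) eps, 0 < eps -> (d = 3%N -> eps <= epsmax) ->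
    D / (n%:R * eps ^+ d) * (if d == 2%N then eps^-1 else 1)
      <= deviation_bound d D c6 D n eps.
Proof.
move=> d2 em1 D0; rewrite /deviation_bound.
have [d3|] := ltnP 3 d.
  exists 1 => // n eps e0 _; case: eqP => [dE|_]; last by rewrite mulr1.
  by rewrite dE in d3.
rewrite leq_eqVlt => /orP[/eqP d3|d3]; last first.
  have -> : d = 2%N by apply/eqP; rewrite eqn_leq -ltnS d3.
  exists 1 => // n eps e0 _ /=.
  by rewrite -[leLHS]mulrA -invfM -[_ * eps ^+ 2 * eps]mulrA -exprSr.
rewrite d3 /= in em1 *.
(* No positive eps is then admissible. *)
have [em0|em0] := leP epsmax 0.
  exists 1 => // n eps e0 /(_ erefl) /(lt_le_trans e0); rewrite ltNge em0.
  by [].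
have em := em1 erefl.
have l0 : 0 < ln (epsmax^-1) by rewrite ln_gt0 // invf_gt1.
exists (D / ln (epsmax^-1)); first exact: divr_gt0.
move=> n eps e0 /(_ erefl) ee; rewrite mulr1 ler_wpM2r ?invr_ge0 ?mulr_ge0 ?exprn_ge0 ?(ltW e0) //.
rewrite -mulrA ler_peMr ?(ltW D0) // mulrC ler_pdivlMr // mul1r.
by rewrite ler_ln ?posrE ?invr_gt0 // lef_pV2 ?posrE.
Qed.

Section finite_sample.
Context {R : realType} (d : nat) (p : 'rV[R]_d -> R) (X : set 'rV[R]_d) (pmin h : R).
Hypothesis d_ge2 : (2 <= d)%N.
Hypothesis p_density : is_density p.
Hypothesis X_valid : valid_region p X pmin h.

Lemma measurable_far_deep_pairs (eps : R) : measurable [set xy : 'rV[R]_d * 'rV[R]_d |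
  [/\ deep_point X h xy.1, deep_point X h xy.2 & 8 * eps <= edistance xy.1 xy.2]].
Proof.
have mD := measurable_deep_point h (region_measurable X_valid).
have m1 : measurable ([set xy : 'rV[R]_d * 'rV[R]_d | deep_point X h xy.1]).
  by rewrite -[X in measurable X]setTI; exact: measurable_fst.
have m2 : measurable ([set xy : 'rV[R]_d * 'rV[R]_d | deep_point X h xy.2]).
  by rewrite -[X in measurable X]setTI; exact: measurable_snd.
have m3 := @measurable_edistance_ge _ ('rV[R]_d * 'rV[R]_d)%type R d fst snd (8 * eps)
  measurable_fst measurable_snd.
have := measurableI _ _ (measurableI _ _ m1 m2) m3.
by rewrite (_ : _ `&` _ = [set xy | [/\ deep_point X h xy.1, deep_point X h xy.2 &
  8 * eps <= edistance xy.1 xy.2]]) //; apply/seteqP; split=> xy /=; [case=> -[]|case].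
Qed.

Lemma finite_sample_bound (epsmax : R) : (d = 3%N -> epsmax < 1) ->
  exists c1 c2 c3 c4 c5 c6 c7 : R,
    [&& 0 < c1, 0 < c2, 0 < c3, 0 < c4, 0 < c5, 0 < c6 & 0 < c7] /\
    forall (dOmega : measure_display) (Omega : measurableType dOmega)
        (P : probability Omega R) (Z : nat -> Omega -> 'rV[R]_d),
        iid_with_density P p Z ->
        forall (n : nat) (eps : R) (i j : 'I_n),
        0 < eps -> eps <= h -> (d = 3%N -> eps <= epsmax) -> i != j ->
        let A := [set w | [/\ deep_point X h (Z i w), deep_point X h (Z j w) &
                              8 * eps <= edistance (Z i w) (Z j w)]] in
        let x := fun w (k : 'I_n) => Z k w in
        let good := [set w | components_meet X (x w) eps ->
          commute_distance (eps_graph (x w) eps) i j \is a fin_num /\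
          `| scaled_commute (x w) eps i j
             - (scaled_inverse_degree (x w) eps i
                + scaled_inverse_degree (x w) eps j) |
            <= deviation_bound d c5 c6 c7 n eps] in
        ((1 - failure_bound d c1 c2 c3 c4 n eps)%:E * P A
           <= P (A `&` good))%E.
Proof.
move=> em1.
have [D [C [c [D0 C0 c0 conc]]]] := commute_concentration d_ge2 p_density X_valid.
have [c6 c60 dev] := raw_bound_le_deviation d_ge2 em1 D0.
(* The exceptional event has the size of the second summand of [failure_bound], so [C] and [c]
   become [c3] and [c4]; [D] serves as [c5] and [c7]. *)
exists 1, 1, C, c, D, c6, D; split; first by rewrite !ltr01 C0 c0 D0 c60.
move=> dOmega Omega P Z Z_iid n eps i j e0 eh eem ij.
cbv zeta; set A := [set w | [/\ _, _ & _]]; set good := [set w | components_meet _ _ _ -> _].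
have [mZ _ _] := Z_iid.
have mC := measurable_far_deep_pairs eps.
have [Bad [mBad PBad goodP]] := conc _ _ P Z Z_iid n eps i j e0 eh ij.
have := PBad _ mC; rewrite -[[set w | _]]/A => {}PBad.
have mA : measurable A.
  rewrite -[X in measurable X]setTI.
  have mp : measurable_fun setT (fun w => (Z i w, Z j w)).
    by apply/measurable_fun_pairP; split; exact: mZ.
  exact: (mp measurableT _ mC).
have mgood : measurable good.
  exact: (@measurable_graph_event R d dOmega Omega Z mZ n X eps (fun W : 'M[R]_n =>
    commute_distance W i j \is a fin_num /\
    `| n%:R * eps ^+ d / graph_volume W * fine (commute_distance W i j)
       - (n%:R * eps ^+ d / degree W i + n%:R * eps ^+ d / degree W j) |
      <= deviation_bound d D c6 D n eps) (region_measurable X_valid)).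
have PA : P A \is a fin_num := fin_num_measure P A mA.
have mAg : measurable (A `&` good) by exact: measurableI.
have mAb : measurable (A `&` Bad) by exact: measurableI.
have sub : (P A <= P (A `&` good) + P (A `&` Bad))%E.
  apply: le_trans (measureU2 _ mAg mAb); apply: le_measure; rewrite ?inE //.
    exact: measurableU.
  move=> w Aw; have [Bw|nBw] := pselect (Bad w); [by right|left; split=> //].
  case: Aw => di dj far; move=> comp.
  have [fin le] := goodP w nBw di dj far comp.
  by split=> //; apply: le_trans le _; exact: dev.
have a0 : 0 <= fine (P A) by rewrite fine_ge0.
move: sub PBad; rewrite -(fineK PA) -(fineK (fin_num_measure P _ mAg)).
rewrite -(fineK (fin_num_measure P _ mAb)) -!EFinM -EFinD !lee_fin => sub Pb.
rewrite mulrBl mul1r lerBlDr; apply: (le_trans sub); rewrite lerD2l.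
apply: (le_trans Pb); rewrite mulrC ler_wpM2r // /failure_bound lerDr.
by rewrite mul1r mulr_ge0 ?expR_ge0.
Qed.

End finite_sample.

(** * Borel-Cantelli and countable families *)

Section almost_sure_tools.
Context {R : realType} {dOmega : measure_display} {Omega : measurableType dOmega}.
Context (P : probability Omega R).

Let sum_inv_sq (m : nat) : \sum_(k < m) k.+2%:R ^- 2 <= 1 :> R.
Proof.
suff H : \sum_(k < m) k.+2%:R ^- 2 <= 1 - m.+1%:R^-1 :> R.
  by apply: le_trans H _; rewrite gerBl invr_ge0 ler0n.
elim: m => [|m IH]; first by rewrite big_ord0 invr1 subrr.
rewrite big_ord_recr /=; apply: (le_trans (lerD IH (lexx _))).
have m1 : 0 < m.+1%:R :> R by rewrite ltr0n.
have m2 : 0 < m.+2%:R :> R by rewrite ltr0n.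
have e : m.+2%:R = m.+1%:R + 1 :> R by rewrite natr1.
suff h : m.+2%:R ^- 2 <= m.+1%:R^-1 - m.+2%:R^-1 :> R.
  by rewrite -lerBrDl (_ : 1 - _ - _ = m.+1%:R^-1 - m.+2%:R^-1) //; ring.
rewrite -[leLHS]mul1r ler_pdivrMr ?exprn_gt0 // e.
move: m1; set a := m.+1%:R => a0.
rewrite (_ : (a^-1 - (a + 1)^-1) * (a + 1) ^+ 2 = (a + 1) / a); last first.
  by field; rewrite !lt0r_neq0 // addr_gt0.
by rewrite ler_pdivlMr // mul1r lerDl.
Qed.

(** Stated with a measurable [F] covering the failures of [G n], so that it applies directly to
    statements quantified over all positions. *)
Lemma borel_cantelli_event (G : nat -> Omega -> Prop) (C : R) : 0 <= C ->
  (\forall n \near \oo, exists F : set Omega, [/\ measurable F,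
     (P F <= (C * n%:R ^- 2)%:E)%E & forall w, ~ F w -> G n w]) ->
  {ae P, forall w, \forall n \near \oo, G n w}.
Proof.
move=> C0 [N _ HN].
(* The shift by 2 makes the sum of the inverse squares at most 1; indices before [N] get the empty
   set. *)
have Fex n : exists F : set Omega, [/\ measurable F,
     (P F <= (C * n.+2%:R ^- 2)%:E)%E & forall w, ~ F w -> (N <= n.+2)%N -> G n.+2 w].
  have [/HN[F [mF PF FG]]|nN] := leqP N n.+2; first by exists F; split=> // w /FG.
  exists set0; split; [exact: measurable0| |by move=> w _].
  by rewrite measure0 lee_fin divr_ge0 // exprn_ge0.
have [F FP] := choice Fex.
have mF n : measurable (F n) by have [] := FP n.
have : P (lim_sup_set F) = 0.
  apply: lim_sup_set_cvg0 => //; apply: (@le_lt_trans _ _ C%:E); last exact: ltry.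
  apply: lime_le; first exact: is_cvg_nneseries.
  near=> m; rewrite big_mkord.
  apply: (@le_trans _ _ (\sum_(k < m) (C * k.+2%:R ^- 2)%:E)%E).
    by apply: lee_sum => k _; have [] := FP k.
  by rewrite sumEFin lee_fin -mulr_sumr ler_piMr.
move=> P0; exists (lim_sup_set F); split=> //.
  by apply: bigcap_measurable => // k _; exact: bigcup_measurable.
move=> w /= nG; apply: contrapT => nF; apply: nG.
move: nF => /existsNP[m /not_implyP[_ nF]].
exists (maxn N m.+2) => // -[|[|n]] /=; rewrite ?geq_max ?andbF //.
case/andP => Nn mn; have [_ _] := FP n; apply => //.
by move=> Fn; apply: nF; exists n.
Unshelve. all: by end_near. Qed.

Lemma ae_forall_countable (T : countType) (Q : T -> Omega -> Prop) :
  (forall t, {ae P, forall w, Q t w}) -> {ae P, forall w, forall t, Q t w}.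
Proof.
move=> H; have : {ae P, forall w, forall k : nat, if unpickle k is Some t then Q t w else True}.
  by apply: ae_foralln => k; case: (unpickle k) => [t|]; [exact: H|exact: aeW].
by apply: filterS => w Hw t; have := Hw (pickle t); rewrite pickleK.
Qed.

End almost_sure_tools.

(** * Counts near a point where the density is bounded on both sides *)

Section local_density.
Context {R : realType} (d : nat) (p : 'rV[R]_d -> R).
Hypothesis d_gt0 : (0 < d)%N.
Hypothesis p_density : is_density p.
Notation eta := (unit_ball_volume d).
Variables (c : 'rV[R]_d) (r a b : R).
Hypothesis r_gt0 : 0 < r.
Hypothesis a_gt0 : 0 < a.
Hypothesis p_bounds : forall x, eball c (2 * r) x -> a <= p x <= b.

Let eta0 := @unit_ball_volume_gt0 R d.

Let b_gt0 : 0 < b.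
Proof.
have /andP[ac cb] : a <= p c <= b by apply: p_bounds; rewrite /eball /= edistancexx mulr_gt0.
exact: lt_le_trans a_gt0 (le_trans ac cb).
Qed.

Let ball_sub y rho : eball c r y -> rho <= r -> eball y rho `<=` eball c (2 * r).
Proof.
move=> cy rr z yz; apply: le_lt_trans (edistance_triangle y _ _) _.
by move: cy yz rr; rewrite /eball /=; lra.
Qed.

Let ball_net sigma : 0 < sigma -> sigma <= r ->
  exists N (y : 'I_N -> 'rV[R]_d), [/\ forall k, eball c r (y k),
    N%:R <= (a * (eta * (sigma / 2) ^+ d))^-1 &
    forall x, eball c r x -> exists k, edistance x (y k) < sigma].
Proof.
move=> s0 sr; have s20 : 0 < sigma / 2 by rewrite divr_gt0.
have v0 : 0 < eta * (sigma / 2) ^+ d by rewrite mulr_gt0 // exprn_gt0.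
have [x Xx|y cy|N [y [cy Nle cover]]] := @maximal_packing R d p p_density (eball c (2 * r))
  a a_gt0 _ _ (eball c r) (fun y => eball y (sigma / 2)) _ v0.
- by have /andP[] := p_bounds Xx.
- split; [exact: measurable_eball| |by rewrite volume_eball].
  by apply: ball_sub cy _; move: sr s0; lra.
exists N, y; split=> //.
  by rewrite -[leRHS]mul1r ler_pdivlMr ?mulr_gt0 // exprn_gt0.
move=> x /cover[k [z [xz yz]]]; exists k.
apply: le_lt_trans (edistance_triangle z _ _) _.
by rewrite [sigma]splitr ltrD // edistanceC.
Qed.

Context {dOmega : measure_display} {Omega : measurableType dOmega}.
Context (P : probability Omega R) (Z : nat -> Omega -> 'rV[R]_d).
Hypothesis Z_iid : iid_with_density P p Z.

Let mZ k : measurable_fun setT (Z k). Proof. by case: Z_iid. Qed.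

Let mpre k B : measurable B -> measurable (Z k @^-1` B).
Proof. by move=> mB; rewrite -[X in measurable X]setTI; exact: mZ. Qed.

Let q y rho := fine (P (Z 0%N @^-1` eball y rho)).

Let Pq y rho k : P (Z k @^-1` eball y rho) = (q y rho)%:E.
Proof. by apply: (law_fine Z_iid); exact: measurable_eball. Qed.

Let q_bounds y rho : eball c r y -> 0 < rho -> rho <= r ->
  a * (eta * rho ^+ d) <= q y rho <= b * (eta * rho ^+ d).
Proof.
move=> cy r0 rr; case: (Z_iid) => _ law _.
have mB := measurable_eball y rho.
apply/andP; split; rewrite -lee_fin -(Pq y rho 0%N) law // EFinM -(volume_eball y r0).
  apply: (mass_ge p_density) => //; first exact: ltW.
  by move=> x /(ball_sub cy rr)/p_bounds/andP[].
apply: (mass_le p_density) => //; last exact: ltW.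
by move=> x /(ball_sub cy rr)/p_bounds/andP[].
Qed.

(** Every [x0] is within tau * eps of a net point, so its eps-ball lies between the balls of radii
    (1 - tau) * eps and (1 + 2 * tau) * eps around that point. Chernoff's bounds at the net points
    thus control all positions at once. *)
Lemma degree_event (tau eps : R) n (i j : 'I_n) : i != j ->
  0 < tau -> tau < 1 -> 0 < eps -> 3 * eps <= r ->
  exists Bad : set Omega, [/\ measurable Bad,
    (P Bad <= ((a * (eta * (tau * eps / 2) ^+ d))^-1 * (2 *
       expR (- (tau ^+ 2 / 8 * ((n - 2)%:R * (a * (eta * ((1 - tau) * eps) ^+ d)))))))%:E)%E &
    forall w, ~ Bad w -> forall x0, eball c r x0 ->
      (1 - tau) * ((n - 2)%:R * (a * (eta * ((1 - tau) * eps) ^+ d))) <=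
        (inner_count Z i j [set y | (edistance x0 y <= eps)%R] w)%:R <=
      (1 + tau) * ((n - 2)%:R * (b * (eta * ((1 + 2 * tau) * eps) ^+ d)))].
Proof.
move=> ij t0 t1 e0 er.
have te0 : 0 < tau * eps by rewrite mulr_gt0.
have tee : tau * eps < eps by rewrite gtr_pMl.
have ter : tau * eps <= r by move: tee er e0; lra.
have [N [y [cy Nle cover]]] := ball_net te0 ter.
pose rm := (1 - tau) * eps; pose rp := (1 + 2 * tau) * eps.
have rm0 : 0 < rm by rewrite mulr_gt0 // subr_gt0.
have rp0 : 0 < rp by rewrite mulr_gt0 // addr_gt0 // mulr_gt0.
have rmE : rm = eps - tau * eps by rewrite /rm; ring.
have rpE : rp = eps + 2 * (tau * eps) by rewrite /rp; ring.
have rmr : rm <= r by move: rmE er te0 e0; lra.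
have rpr : rp <= r by move: rpE er tee; lra.
pose Em k := [set w | (inner_count Z i j (eball (y k) rm) w)%:R
    <= (1 - tau) * ((n - 2)%:R * q (y k) rm)].
pose Ep k := [set w | (1 + tau) * ((n - 2)%:R * q (y k) rp) <=
    (inner_count Z i j (eball (y k) rp) w)%:R].
have mEm k : measurable (Em k).
  exact: (measurable_inner_count Z_iid i j (fun s => s%:R <= (1 - tau) * ((n - 2)%:R * q (y k) rm))
    (measurable_eball (y k) rm)).
have mEp k : measurable (Ep k).
  exact: (measurable_inner_count Z_iid i j (fun s => (1 + tau) * ((n - 2)%:R * q (y k) rp) <= s%:R)
    (measurable_eball (y k) rp)).
set ex := expR _.
have PEm k : (P (Em k) <= ex%:E)%E.
  have := chernoff_lower Z_iid ij measurableT (measurable_eball (y k) rm) (Pq (y k) rm) t0 (ltW t1).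
  rewrite preimage_setT setTI probability_setT mul1e => /le_trans; apply.
  rewrite lee_fin ler_expR lerN2 ler_wpM2l ?divr_ge0 ?sqr_ge0 // ler_wpM2l //.
  by have /andP[] := q_bounds (cy k) rm0 rmr.
have PEp k : (P (Ep k) <= ex%:E)%E.
  have := chernoff_upper Z_iid ij measurableT (measurable_eball (y k) rp) (Pq (y k) rp) t0 (ltW t1).
  rewrite preimage_setT setTI probability_setT mul1e => /le_trans; apply.
  rewrite lee_fin ler_expR lerN2 ler_wpM2l ?divr_ge0 ?sqr_ge0 // ler_wpM2l //.
  have /andP[+ _] := q_bounds (cy k) rp0 rpr; apply: le_trans.
  rewrite ler_wpM2l ?(ltW a_gt0) // ler_wpM2l ?(ltW eta0) // lerXn2r ?nnegrE ?(ltW rm0) ?(ltW rp0) //.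
  by rewrite -/rm rmE rpE; move: te0; lra.
exists (\big[setU/set0]_k (Em k `|` Ep k)); split.
- by apply: bigsetU_measurable => k _; exact: measurableU.
- apply: (@le_trans _ _ (N%:R * (2 * ex))%:E); last first.
    by rewrite lee_fin ler_wpM2r // mulr_ge0 // expR_ge0.
  have -> : (N%:R * (2 * ex))%:E = (\sum_(k < N) (ex%:E + ex%:E))%E.
    under eq_bigr do rewrite -EFinD.
    by rewrite sumEFin sumr_const card_ord; congr EFin; rewrite -[RHS]mulr_natl; ring.
  elim: (index_enum _) => [|k l IH]; first by rewrite !big_nil measure0.
  rewrite !big_cons; apply: le_trans (measureU2 _ _ _) _.
  + exact: measurableU.
  + by apply: bigsetU_measurable => s _; exact: measurableU.
  apply: leeD IH; apply: le_trans (measureU2 _ _ _) _ => //; exact: (leeD (PEm k) (PEp k)).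
move=> w nB x0 cx0; have [k xk] := cover x0 cx0.
have {nB} /not_orP[nm np] : ~ (Em k `|` Ep k) w.
  by move=> Bk; apply: nB; rewrite -bigcup_seq; exists k => //=; rewrite mem_index_enum.
have count_le (A B : set 'rV[R]_d) : A `<=` B ->
    (inner_count Z i j A w)%:R <= (inner_count Z i j B w)%:R :> R.
  move=> AB; rewrite ler_nat subset_leq_card //; apply/fintype.subsetP => s.
  by rewrite !inE => /andP[-> /asboolP/AB h]; apply/asboolP.
apply/andP; split.
  apply: le_trans (count_le (eball (y k) rm) _ _); last first.
    move=> z yz /=; apply: le_trans (edistance_triangle (y k) _ _) _.
    by move: yz xk; rewrite /eball /= rmE; lra.
  have : (1 - tau) * ((n - 2)%:R * q (y k) rm) < (inner_count Z i j (eball (y k) rm) w)%:R.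
    by rewrite ltNge; apply/negP.
  move/ltW; apply: le_trans; rewrite ler_wpM2l ?subr_ge0 ?(ltW t1) // ler_wpM2l //.
  by have /andP[] := q_bounds (cy k) rm0 rmr.
apply: le_trans (count_le _ (eball (y k) rp) _) _.
  move=> z /= xz; apply: le_lt_trans (edistance_triangle x0 _ _) _.
  by rewrite edistanceC; move: xz xk te0; rewrite rpE; lra.
have : (inner_count Z i j (eball (y k) rp) w)%:R < (1 + tau) * ((n - 2)%:R * q (y k) rp).
  by rewrite ltNge; apply/negP.
move/ltW/le_trans; apply; rewrite ler_wpM2l ?addr_ge0 ?(ltW t0) // ler_wpM2l //.
by have /andP[] := q_bounds (cy k) rp0 rpr.
Qed.

(** About sigma^-d balls of radius sigma cover the ball, and both points fall into a given one with
    probability of order sigma^(2d). The total, of order sigma^d, tends to 0. It ensures that two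
    given points are eventually far apart compared with eps. *)
Lemma coincidence_ae (i j : nat) : i != j ->
  {ae P, forall w, eball c r (Z i w) -> Z i w != Z j w}.
Proof.
move=> ij; pose E := [set w | edistance (Z i w) (Z j w) <= 0] `&` (Z i @^-1` eball c r).
have mE : measurable E.
  apply: measurableI; first exact: measurable_edistance_le.
  by apply: mpre; exact: measurable_eball.
pose n := (maxn i j).+1.
have ini : (i < n)%N by rewrite ltnS leq_maxl.
have jn : (j < n)%N by rewrite ltnS leq_maxr.
have ijo : Ordinal ini != Ordinal jn by [].
pose C := (b * eta) ^+ 2 / (a * (eta / 2 ^+ d)).
have C0 : 0 < C by rewrite divr_gt0 ?exprn_gt0 ?mulr_gt0 ?divr_gt0 ?exprn_gt0.
have bound sigma : 0 < sigma -> sigma <= r -> (P E <= (C * sigma ^+ d)%:E)%E.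
  move=> s0 sr; have [N [y [cy Nle cover]]] := ball_net s0 sr.
  have sub : E `<=` \big[setU/set0]_k ((Z i @^-1` eball (y k) sigma) `&` (Z j @^-1` eball (y k) sigma)).
    move=> w [/= ij0 ci]; rewrite -bigcup_seq; have [k ik] := cover _ ci.
    exists k; first by rewrite /= mem_index_enum.
    have yi : edistance (y k) (Z i w) < sigma by rewrite edistanceC.
    split=> //; apply: le_lt_trans (edistance_triangle (Z i w) _ _) _.
    by apply: le_lt_trans yi; rewrite gerDl.
  have mI k : measurable ((Z i @^-1` eball (y k) sigma) `&` (Z j @^-1` eball (y k) sigma)).
    by apply: measurableI; apply: mpre; exact: measurable_eball.
  apply: (@le_trans _ _ (N%:R * (b * (eta * sigma ^+ d)) ^+ 2)%:E); last first.
    rewrite lee_fin /C; apply: le_trans (ler_wpM2r (sqr_ge0 _) Nle) _.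
    rewrite expr_div_n le_eqVlt; apply/orP; left; apply/eqP; field.
    by rewrite !lt0r_neq0 ?exprn_gt0.
  apply: (@le_trans _ _ (P (\big[setU/set0]_k ((Z i @^-1` eball (y k) sigma) `&` (Z j @^-1` eball (y k) sigma))))).
    by apply: le_measure; rewrite ?inE //; exact: bigsetU_measurable.
  have -> : (N%:R * (b * (eta * sigma ^+ d)) ^+ 2)%:E =
      (\sum_(k < N) ((b * (eta * sigma ^+ d)) ^+ 2)%:E)%E.
    by rewrite sumEFin sumr_const card_ord -[in RHS]mulr_natl.
  elim: (index_enum _) => [|k l IH]; first by rewrite !big_nil measure0.
  rewrite !big_cons; apply: le_trans (measureU2 _ _ _) _ => //.
    exact: bigsetU_measurable.
  apply: leeD IH.
  have := two_independent Z_iid ijo (measurable_eball (y k) sigma) (measurable_eball (y k) sigma).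
  move=> /= ->; rewrite !Pq -EFinM lee_fin expr2.
  have /andP[q1 q2] := q_bounds (cy k) s0 sr.
  have q0 : 0 <= q (y k) sigma by apply: le_trans q1; rewrite !mulr_ge0 ?exprn_ge0 // ltW.
  exact: ler_pM.
have PE0 : P E = 0.
  have PEf : P E \is a fin_num := fin_num_measure P _ mE.
  rewrite -(fineK PEf); congr EFin; apply/eqP; rewrite eq_le fine_ge0 // andbT.
  rewrite leNgt; apply/negP => e0; set e := fine _ in e0.
  (* sigma <= 1 gives sigma^d <= sigma, and then C * sigma^d <= e/2 contradicts [e] being the
     probability. *)
  pose sigma := Num.min r (Num.min 1 (e / (2 * C))).
  have s0 : 0 < sigma by rewrite !lt_min r_gt0 ltr01 divr_gt0 // mulr_gt0.
  have s1 : sigma <= 1 by rewrite !ge_min lexx orbT.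
  have se : sigma <= e / (2 * C) by rewrite !ge_min lexx !orbT.
  have := bound sigma s0 _; rewrite ge_min lexx -(fineK PEf) lee_fin -/e => /(_ isT) h.
  have : sigma ^+ d <= sigma by rewrite -[leRHS]expr1 ler_wiXn2l // ltW.
  rewrite -(ler_pM2l C0) => h2.
  have : C * sigma <= C * (e / (2 * C)) by rewrite ler_pM2l.
  rewrite (_ : C * (e / (2 * C)) = e / 2); last by field; exact: lt0r_neq0.
  by move: h h2 e0; lra.
exists E; split=> // w /= nw; split; last first.
  by apply: contrapT => nb; apply: nw.
apply: contrapT => n0; apply: nw => _; apply/eqP => e; apply: n0.
by rewrite /= e edistancexx.
Qed.

End local_density.

(** * Almost sure limit of the scaled counts *)

Section degree_limit.
Context {R : realType} (d : nat) (p : 'rV[R]_d -> R).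
Hypothesis d_gt0 : (0 < d)%N.
Hypothesis p_density : is_density p.
Notation eta := (unit_ball_volume d).
Let eta0 := @unit_ball_volume_gt0 R d.

(** Selects tau = 1/(k+2). In the exponent d + 2, d comes from the shrunken radius, one factor from
    Chernoff and one from n - 2 >= (1 - tau) * n. *)
Let slack_near (a b lo hi : R) : lo < a -> b < hi -> exists k : nat,
  lo <= (1 - k.+2%:R^-1) ^+ d.+2 * a /\
  (1 + k.+2%:R^-1) * (1 + 2 * k.+2%:R^-1) ^+ d * b <= hi.
Proof.
move=> loa bhi.
have hc : (k.+2%:R^-1 : R) @[k --> \oo] --> (0 : R).
  by rewrite (cvg_shiftS (fun k => k.+1%:R^-1 : R)); exact: cvg_harmonic.
have pow (f : nat -> R) (m : nat) : f k @[k --> \oo] --> (1 : R) ->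
    f k ^+ m @[k --> \oo] --> (1 : R).
  move=> f1; elim: m => [|m IH]; first by under eq_fun do rewrite expr0; exact: cvg_cst.
  under eq_fun do rewrite exprS; rewrite -[1]mulr1; exact: cvgM.
have c1 : (1 - k.+2%:R^-1) ^+ d.+2 * a @[k --> \oo] --> 1 * a.
  apply: cvgMl; apply: pow; have := cvgB (cvg_cst (1 : R)) hc; rewrite subr0; exact.
have c2 : (1 + k.+2%:R^-1) * (1 + 2 * k.+2%:R^-1) ^+ d * b @[k --> \oo] --> 1 * 1 * b.
  apply: cvgMl; apply: cvgM.
    by have := cvgD (cvg_cst (1 : R)) hc; rewrite addr0; exact.
  have hc2 : (2 * k.+2%:R^-1 : R) @[k --> \oo] --> (2 * 0 : R) by exact: cvgMr.
  by apply: pow; have := cvgD (cvg_cst (1 : R)) hc2; rewrite mulr0 addr0; exact.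
rewrite mul1r in c1; rewrite !mul1r in c2.
have n1 : \forall k \near \oo, lo < (1 - k.+2%:R^-1) ^+ d.+2 * a by exact: cvgr_gt loa.
have n2 : \forall k \near \oo, (1 + k.+2%:R^-1) * (1 + 2 * k.+2%:R^-1) ^+ d * b < hi.
  by exact: cvgr_lt bhi.
have : \forall k \near \oo, lo <= (1 - k.+2%:R^-1) ^+ d.+2 * a /\
  (1 + k.+2%:R^-1) * (1 + 2 * k.+2%:R^-1) ^+ d * b <= hi.
  by near=> k; split; apply: ltW; near: k.
by case=> N _ /(_ N (leqnn N)); exists N.
Unshelve. all: by end_near. Qed.

Context {dOmega : measure_display} {Omega : measurableType dOmega}.
Context (P : probability Omega R) (Z : nat -> Omega -> 'rV[R]_d).
Hypothesis Z_iid : iid_with_density P p Z.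
Hypothesis p_cont : continuous p.
Variable eps : nat -> R.
Hypothesis eps_gt0 : forall n, 0 < eps n.
Hypothesis eps_log : log_condition d eps.
Hypothesis eps_cvg0 : eps n @[n --> \oo] --> (0 : R).
Variables i j : nat.
Hypothesis ij : i != j.

Let near_ord : \forall n \near \oo, [/\ (i < n)%N, (j < n)%N & (4 <= n)%N].
Proof.
exists (maxn (maxn i j).+1 4) => // n /=; rewrite geq_max => /andP[h1 h2]; split => //.
  by apply: leq_trans h1; rewrite ltnS leq_maxl.
by apply: leq_trans h1; rewrite ltnS leq_maxr.
Qed.

Let near_eps (rho : R) : 0 < rho -> \forall n \near \oo, eps n < rho.
Proof. by move=> r0; exact: (cvgr_lt _ eps_cvg0 _ r0). Qed.

Let count n (u v : 'I_n) (x0 : 'rV[R]_d) w : R :=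
  (inner_count Z u v [set y | edistance x0 y <= eps n] w)%:R.

(** Reduces the continuum of positions and precisions to countably many local statements, whose null
    sets can be united. *)
Let rational_ball (x0 : 'rV[R]_d) (lo hi : R) : lo < p x0 -> p x0 < hi ->
  exists (c : 'rV[rat]_d) (r a b : rat),
    [/\ 0 < ratr r :> R, lo < ratr a, ratr b < hi, eball (map_mx ratr c) (ratr r) x0 &
     forall x, eball (map_mx ratr c) (2 * ratr r) x -> ratr a <= p x <= ratr b].
Proof.
move=> lt1 lt2.
have [a] := rat_in_itvoo lt1; rewrite in_itv /= => /andP[a2 a3].
have [b] := rat_in_itvoo lt2; rewrite in_itv /= => /andP[b1 b2].
have [r1 r10 r1P] : exists2 r1 : R, 0 < r1 & eball x0 r1 `<=` [set x | ratr a < p x < ratr b].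
  apply/nbhs_eball.
  have h1 : \forall x \near x0, ratr a < p x by have h := cvgr_gt (p x0) (@p_cont x0) _ a3; exact: h.
  have h2 : \forall x \near x0, p x < ratr b by have h := cvgr_lt (p x0) (@p_cont x0) _ b1; exact: h.
  by near=> x; apply/andP; split; near: x.
have r13 : 0 < r1 / 3 by rewrite divr_gt0.
have [r] := rat_in_itvoo r13; rewrite in_itv /= => /andP[r0 rr1].
have [c hc] : exists c : 'rV[rat]_d, edistance (map_mx ratr c) x0 < ratr r.
  pose s := Num.sqrt d%:R + 1 : R.
  have s0 : 0 < s by rewrite ltr_wpDl ?sqrtr_ge0.
  have H l : exists q : rat, `|ratr q - x0 ord0 l| <= ratr r / s.
    have rs0 : 0 < ratr r / s by rewrite divr_gt0.
    have [|q] := @rat_in_itvoo R (x0 ord0 l - ratr r / s) (x0 ord0 l + ratr r / s).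
      by rewrite ltrBlDr -addrA ltrDl addr_gt0.
    rewrite in_itv /= => /andP[h1 h2]; exists q.
    by rewrite ler_norml; apply/andP; split; move: h1 h2; lra.
  have [q hq] := choice H; exists (\row_l q l).
  apply: (@le_lt_trans _ _ (Num.sqrt d%:R * (ratr r / s))).
    by apply: ler_enorm_coord => [|l]; [rewrite divr_ge0 // ltW|rewrite !mxE].
  by rewrite mulrCA gtr_pMr // ltr_pdivrMr // mul1r ltrDl.
exists c, r, a, b; split=> // x cx; have /andP[h1 h2] : ratr a < p x < ratr b.
  apply: r1P; apply: le_lt_trans (edistance_triangle (map_mx ratr c) _ _) _.
  by rewrite edistanceC; move: cx hc rr1; rewrite /eball /=; lra.
by rewrite !ltW.
Unshelve. all: by end_near. Qed.

Let local_count_ae (c : 'rV[R]_d) (r a b tau : R) :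
  0 < r -> 0 < a -> (forall x, eball c (2 * r) x -> a <= p x <= b) ->
  0 < tau -> tau < 1 ->
  {ae P, forall w, \forall n \near \oo, forall (u v : 'I_n), u = i :> nat -> v = j :> nat ->
    forall x0, eball c r x0 ->
      (1 - tau) * ((n - 2)%:R * (a * (eta * ((1 - tau) * eps n) ^+ d))) <= count u v x0 w <=
      (1 + tau) * ((n - 2)%:R * (b * (eta * ((1 + 2 * tau) * eps n) ^+ d)))}.
Proof.
move=> r0 a0 pb t0 t1.
have s0 : 0 < 1 - tau by rewrite subr_gt0.
pose K := (a * (eta * (tau / 2) ^+ d))^-1.
have K0 : 0 < K by rewrite invr_gt0 !mulr_gt0 // exprn_gt0 // divr_gt0.
pose c1 := tau ^+ 2 / 16 * (a * (eta * (1 - tau) ^+ d)).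
have c10 : 0 < c1 by rewrite mulr_gt0 ?divr_gt0 ?exprn_gt0 // !mulr_gt0 // exprn_gt0.
(* The net has at most K * eps^-d <= K * n balls, and each of the two Chernoff tails is at most
   n^-3. *)
apply: (@borel_cantelli_event _ _ _ P _ (2 * K)); first by rewrite mulr_ge0 // ltW.
have e1 := log_condition_expR 3 c10 eps_log.
have e2 := log_condition_inv eps_gt0 eps_log.
have e3 : \forall n \near \oo, 3 * eps n <= r.
  have h : 0 < r / 3 by rewrite divr_gt0.
  have h' := near_eps h; near=> n; have : eps n < r / 3 by near: n.
  by rewrite ltr_pdivlMr // mulrC => /ltW.
near=> n; have [ni nj n4] : [/\ (i < n)%N, (j < n)%N & (4 <= n)%N] by near: n.
have ijo : Ordinal ni != Ordinal nj by [].
have er : 3 * eps n <= r by near: n.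
have [F [mF PF HF]] := degree_event p_density r0 a0 pb Z_iid ijo t0 t1 (eps_gt0 n) er.
exists F; split=> //; last first.
  move=> w /HF H u v ui vj x0 cx0; rewrite /count.
  have -> : u = Ordinal ni by exact: val_inj.
  have -> : v = Ordinal nj by exact: val_inj.
  exact: H.
apply: (le_trans PF); rewrite lee_fin.
have n0 : 0 < n%:R :> R by rewrite ltr0n (leq_trans _ n4).
have ed0 : 0 < eps n ^+ d by rewrite exprn_gt0.
have -> : (a * (eta * (tau * eps n / 2) ^+ d))^-1 = K * (eps n ^+ d)^-1.
  by rewrite /K mulrAC exprMn -invfM; congr (_^-1); ring.
have l1 : (eps n ^+ d)^-1 <= n%:R by near: n.
have l2 : expR (- (tau ^+ 2 / 8 * ((n - 2)%:R * (a * (eta * ((1 - tau) * eps n) ^+ d))))) <= n%:R ^- 3.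
  apply: (@le_trans _ _ (expR (- (c1 * (n%:R * eps n ^+ d))))); last by near: n.
  rewrite ler_expR lerN2.
  have -> : c1 * (n%:R * eps n ^+ d) =
     tau ^+ 2 / 8 * (n%:R / 2 * (a * (eta * ((1 - tau) * eps n) ^+ d))).
    by rewrite /c1 exprMn; field.
  rewrite ler_wpM2l ?divr_ge0 ?sqr_ge0 // ler_wpM2r //.
    by rewrite !mulr_ge0 ?exprn_ge0 ?mulr_ge0 // ltW.
  by rewrite ler_pdivrMr // -natrM ler_nat leq_sub2_double.
have nE (y : R) : 2 * y * n%:R ^- 2 = y * n%:R * (2 * n%:R ^- 3).
  by field; rewrite pnatr_eq0 -lt0n (leq_trans _ n4).
rewrite nE.
apply: ler_pM.
- by apply: mulr_ge0; [exact: ltW|rewrite invr_ge0 ltW].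
- by rewrite mulr_ge0 // expR_ge0.
- by apply: ler_wpM2l => //; exact: ltW.
- by rewrite ler_wpM2l.
Unshelve. all: by end_near. Qed.

(** The null set precedes the choice of [x0] and [rho], so [x0] may later be the random point
    [Z i w] itself. *)
Lemma inner_count_ae : {ae P, forall w, forall x0, 0 < p x0 -> forall rho, 0 < rho ->
  \forall n \near \oo, forall (u v : 'I_n), u = i :> nat -> v = j :> nat ->
    `|p x0 - (inner_count Z u v [set y | edistance x0 y <= eps n] w)%:R
        / (eta * (n%:R * eps n ^+ d))| < rho}.
Proof.
pose T : countType := ('rV[rat]_d * rat * rat * rat * nat)%type.
pose cc (t : T) : 'rV[R]_d := map_mx ratr t.1.1.1.1.
pose rr (t : T) : R := ratr t.1.1.1.2.
pose aa (t : T) : R := ratr t.1.1.2.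
pose bb (t : T) : R := ratr t.1.2.
pose tt (t : T) : R := t.2.+2%:R^-1.
pose G (t : T) w := 0 < rr t -> 0 < aa t ->
  (forall x, eball (cc t) (2 * rr t) x -> aa t <= p x <= bb t) ->
  \forall n \near \oo, forall (u v : 'I_n), u = i :> nat -> v = j :> nat ->
    forall x0, eball (cc t) (rr t) x0 ->
      (1 - tt t) * ((n - 2)%:R * (aa t * (eta * ((1 - tt t) * eps n) ^+ d))) <= count u v x0 w <=
      (1 + tt t) * ((n - 2)%:R * (bb t * (eta * ((1 + 2 * tt t) * eps n) ^+ d))).
have : {ae P, forall w, forall t, G t w}.
  apply: ae_forall_countable => t; rewrite /G.
  have [r0|] := boolP (0 < rr t); last by move=> _; apply: aeW.
  have [a0|] := boolP (0 < aa t); last by move=> _; apply: aeW.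
  have [pb|npb] := pselect (forall x, eball (cc t) (2 * rr t) x -> aa t <= p x <= bb t).
    have t0 : 0 < tt t by rewrite invr_gt0 ltr0n.
    have t1 : tt t < 1 by rewrite invf_lt1 ?ltr0n // ltr1n.
    by apply: filterS (local_count_ae r0 a0 pb t0 t1) => w.
  by apply: aeW => w _ _ /npb.
apply: filterS => w Gw x0 p0 rho rho0.
(* The first argument keeps the rational lower bound positive, the second one keeps it within
   rho/2. *)
have lt1 : Num.max (p x0 / 2) (p x0 - rho / 2) < p x0.
  rewrite gt_max; apply/andP; split; first by rewrite ltr_pdivrMr // ltr_pMr // ltr1n.
  by rewrite gtrBl divr_gt0.
have lt2 : p x0 < p x0 + rho / 2 by rewrite ltrDl divr_gt0.
have [c [r [a [b [r0 a12 b2 hc pb]]]]] := rational_ball lt1 lt2.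
move: a12; rewrite gt_max => /andP[a1 a2].
have [k [k1 k2]] := slack_near a2 b2.
have := Gw (c, r, a, b, k); rewrite /G /cc /rr /aa /bb /tt /=.
have a0 : 0 < ratr a :> R by apply: lt_trans a1; rewrite divr_gt0.
move=> /(_ r0 a0) H.
have {}H := H pb.
set tau : R := k.+2%:R^-1 in k1 k2 H.
have t0 : 0 < tau by rewrite invr_gt0 ltr0n.
have t1 : tau < 1 by rewrite invf_lt1 ?ltr0n // ltr1n.
(* This is 2 <= tau * n, that is (1 - tau) * n <= n - 2. *)
have nt : \forall n \near \oo, (2 * k.+2 <= n)%N by exists (2 * k.+2)%N.
have no := near_ord.
near=> n => u v ui vj.
have [ni nj n4] : [/\ (i < n)%N, (j < n)%N & (4 <= n)%N] by near: n.
have Hn : forall (u v : 'I_n), u = i :> nat -> v = j :> nat ->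
    forall x0, eball (map_mx ratr c) (ratr r) x0 ->
      (1 - tau) * ((n - 2)%:R * (ratr a * (eta * ((1 - tau) * eps n) ^+ d))) <= count u v x0 w <=
      (1 + tau) * ((n - 2)%:R * (ratr b * (eta * ((1 + 2 * tau) * eps n) ^+ d))) by near: n.
have /andP[h1 h2] := Hn u v ui vj x0 hc.
have nk : (2 * k.+2 <= n)%N by near: n.
have n0 : 0 < n%:R :> R by rewrite ltr0n (leq_trans _ n4).
have ed0 : 0 < eps n ^+ d by rewrite exprn_gt0.
have E0 : 0 < eta * (n%:R * eps n ^+ d) by rewrite !mulr_gt0.
have n2 : (1 - tau) * n%:R <= (n - 2)%:R.
  rewrite natrB ?(leq_trans _ n4) // mulrBl mul1r lerD2l lerN2.
  by rewrite /tau mulrC ler_pdivlMr ?ltr0n // -natrM ler_nat.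
have n2' : (n - 2)%:R <= n%:R :> R by rewrite ler_nat leq_subr.
move: h1 h2; rewrite -/(count u v x0 w); set cnt := count u v x0 w => h1 h2.
have lo : (p x0 - rho / 2) * (eta * (n%:R * eps n ^+ d)) <= cnt.
  apply: le_trans h1.
  apply: (@le_trans _ _ ((1 - tau) ^+ d.+2 * ratr a * (eta * (n%:R * eps n ^+ d)))).
    by rewrite ler_pM2r.
  have -> : (1 - tau) ^+ d.+2 * ratr a * (eta * (n%:R * eps n ^+ d)) =
     (1 - tau) * ((1 - tau) * n%:R * (ratr a * (eta * ((1 - tau) * eps n) ^+ d))).
    by rewrite exprMn !exprS; ring.
  rewrite ler_wpM2l ?subr_ge0 ?(ltW t1) // ler_wpM2r //.
  have s0 : 0 < 1 - tau by rewrite subr_gt0.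
  exact: ltW (mulr_gt0 a0 (mulr_gt0 eta0 (exprn_gt0 d (mulr_gt0 s0 (eps_gt0 n))))).
have hi : cnt <= (p x0 + rho / 2) * (eta * (n%:R * eps n ^+ d)).
  apply: (le_trans h2).
  apply: (@le_trans _ _ ((1 + tau) * (1 + 2 * tau) ^+ d * ratr b * (eta * (n%:R * eps n ^+ d)))); last first.
    by rewrite ler_pM2r.
  have -> : (1 + tau) * (1 + 2 * tau) ^+ d * ratr b * (eta * (n%:R * eps n ^+ d)) =
     (1 + tau) * (n%:R * (ratr b * (eta * ((1 + 2 * tau) * eps n) ^+ d))).
    by rewrite exprMn; ring.
  have b0 : 0 < ratr b :> R.
    have /andP[ab1 ab2] : ratr a <= p x0 <= ratr b.
      by apply: pb; apply: (lt_trans hc); rewrite ltr_pMl // ltr1n.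
    exact: lt_le_trans p0 ab2.
  rewrite ler_wpM2l ?addr_ge0 ?(ltW t0) // ler_wpM2r //.
  have s0 : 0 < 1 + 2 * tau by rewrite addr_gt0 // mulr_gt0.
  exact: ltW (mulr_gt0 b0 (mulr_gt0 eta0 (exprn_gt0 d (mulr_gt0 s0 (eps_gt0 n))))).
rewrite -(ler_pdivlMr _ _ E0) in lo; rewrite -(ler_pdivrMr _ _ E0) in hi.
move: lo hi; rewrite /cnt /count; move: (_ / (eta * (n%:R * eps n ^+ d))) => y lo hi.
by rewrite ltr_norml; apply/andP; split; move: lo hi rho0; lra.
Unshelve. all: by end_near. Qed.

Lemma distinct_ae : {ae P, forall w, 0 < p (Z i w) -> Z i w != Z j w}.
Proof.
pose T : countType := ('rV[rat]_d * rat * rat * rat)%type.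
pose G (t : T) w := 0 < ratr t.1.1.2 :> R -> 0 < ratr t.1.2 :> R ->
  (forall x, eball (map_mx ratr t.1.1.1) (2 * ratr t.1.1.2) x ->
     ratr t.1.2 <= p x <= ratr t.2) ->
  eball (map_mx ratr t.1.1.1) (ratr t.1.1.2) (Z i w) -> Z i w != Z j w.
have : {ae P, forall w, forall t, G t w}.
  apply: ae_forall_countable => t; rewrite /G.
  have [r0|] := boolP (0 < ratr t.1.1.2 :> R); last by move=> _; apply: aeW.
  have [a0|] := boolP (0 < ratr t.1.2 :> R); last by move=> _; apply: aeW.
  have [pb|npb] := pselect (forall x, eball (map_mx ratr t.1.1.1) (2 * ratr t.1.1.2) x ->
     ratr t.1.2 <= p x <= ratr t.2).
    by apply: filterS (coincidence_ae d_gt0 p_density r0 a0 pb Z_iid ij) => w.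
  by apply: aeW => w _ _ /npb.
apply: filterS => w Gw p0.
have lt1 : p (Z i w) / 2 < p (Z i w) by rewrite ltr_pdivrMr // ltr_pMr // ltr1n.
have lt2 : p (Z i w) < p (Z i w) + 1 by rewrite ltrDl.
have [c [r [a [b [r0 a1 b2 hc pb]]]]] := rational_ball lt1 lt2.
apply: (Gw (c, r, a, b)) => //=.
by apply: lt_trans a1; rewrite divr_gt0.
Qed.

End degree_limit.

(** * Almost sure convergence of the commute distance *)

Section almost_sure_limit.
Context {R : realType} (d : nat) (p : 'rV[R]_d -> R) (X : set 'rV[R]_d) (pmin h : R).
Hypothesis d_ge2 : (2 <= d)%N.
Hypothesis p_density : is_density p.
Hypothesis X_valid : valid_region p X pmin h.
Notation eta := (unit_ball_volume d).
Let eta0 := @unit_ball_volume_gt0 R d.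

Let raw_bound_cvg (D : R) (eps : nat -> R) :
  log_condition d eps -> rate_condition d eps ->
  D / (n%:R * eps n ^+ d) * (if d == 2%N then (eps n)^-1 else 1) @[n --> \oo] --> (0 : R).
Proof.
move=> logc; rewrite /rate_condition; have [d2|dN2] := eqVneq d 2%N.
  rewrite d2 /= => /cvg_inv_pinfty hinv; rewrite -[0](mulr0 D).
  under eq_fun => n.
    rewrite -mulrA -invfM -[_ * eps n ^+ 2 * eps n]mulrA -exprSr; over.
  exact: cvgMr.
move=> _; under eq_fun do rewrite mulr1.
by rewrite -[0](mulr0 D); apply: cvgMr; apply: cvg_inv_pinfty; exact: log_condition_pinfty.
Qed.

Let inv_close (P0 delta : R) : 0 < P0 -> 0 < delta -> exists2 rho : R, 0 < rho &
  forall y, `|P0 - y| < rho -> `|(eta * y)^-1 - (eta * P0)^-1| < delta.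
Proof.
move=> P00 d0.
have c1 : (eta * y)^-1 @[y --> P0] --> (eta * P0)^-1.
  by apply: cvgV; [rewrite lt0r_neq0 // mulr_gt0|apply: cvgMr; exact: cvg_id].
have near_P0 : \forall y \near P0, `|(eta * P0)^-1 - (eta * y)^-1| < delta.
  by have h' := cvgr_dist_lt _ _ c1 _ d0; exact: h'.
have /nbhs_ballP[rho /= rho0 hr] := near_P0.
by exists rho => // y /hr; rewrite distrC.
Qed.

(** [u] and [v] are not adjacent and the graph has no loops, so leaving them out of the count loses
    no neighbour of either. *)
Lemma degree_inner_count n (x : 'I_n -> 'rV[R]_d) eps (u v k : 'I_n) :
  eps < edistance (x u) (x v) -> k \in [:: u; v] ->
  degree (eps_graph x eps) k =
  #|[set l : 'I_n | (l \notin [:: u; v]) && `[< edistance (x k) (x l) <= eps >]]%SET|%:R.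
Proof.
move=> far ku; rewrite degree_neighbors; congr (_%:R); apply: eq_card => l.
rewrite !inE asboolb /eps_edge /=; move: ku; rewrite !inE => /orP[] /eqP ->.
  rewrite negb_or [u == l]eq_sym; have [->|_] := eqVneq l u => //=.
  by have [->|//] := eqVneq l v; rewrite leNgt far.
rewrite negb_or [v == l]eq_sym; have [->|_] := eqVneq l v; first by rewrite andbF.
by rewrite andbT /=; have [->|//] := eqVneq l u; rewrite edistanceC leNgt far.
Qed.

Hypothesis p_cont : continuous p.
Context {dOmega : measure_display} {Omega : measurableType dOmega}.
Context (P : probability Omega R) (Z : nat -> Omega -> 'rV[R]_d).
Hypothesis Z_iid : iid_with_density P p Z.
Variable eps : nat -> R.
Hypothesis eps_gt0 : forall n, 0 < eps n.
Hypothesis eps_log : log_condition d eps.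
Hypothesis eps_rate : rate_condition d eps.
Hypothesis eps_cvg0 : eps n @[n --> \oo] --> (0 : R).
Variables i j : nat.
Hypothesis ij : i != j.

Let deviation_ae (D C c : R) : 0 < C -> 0 < c ->
  (forall n e (u v : 'I_n), 0 < e -> e <= h -> u != v ->
   exists Bad : set Omega, [/\ measurable Bad,
    forall B, measurable B ->
      (P ([set w | B (Z u w, Z v w)] `&` Bad) <= P [set w | B (Z u w, Z v w)] *
        (C * expR (- (c * (n%:R * e ^+ d))) / e ^+ d)%:E)%E &
    forall w, ~ Bad w -> deep_point X h (Z u w) -> deep_point X h (Z v w) ->
      8 * e <= edistance (Z u w) (Z v w) ->
      let x := fun k : 'I_n => Z k w in components_meet X x e ->
      commute_distance (eps_graph x e) u v \is a fin_num /\
      `| scaled_commute x e u v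
         - (scaled_inverse_degree x e u + scaled_inverse_degree x e v) |
        <= D / (n%:R * e ^+ d) * (if d == 2%N then e^-1 else 1)]) ->
  {ae P, forall w, \forall n \near \oo, forall u v : 'I_n, u = i :> nat -> v = j :> nat ->
    deep_point X h (Z i w) -> deep_point X h (Z j w) ->
    8 * eps n <= edistance (Z i w) (Z j w) ->
    let x := fun k : 'I_n => Z k w in components_meet X x (eps n) ->
    commute_distance (eps_graph x (eps n)) u v \is a fin_num /\
    `| scaled_commute x (eps n) u v
       - (scaled_inverse_degree x (eps n) u + scaled_inverse_degree x (eps n) v) |
      <= D / (n%:R * eps n ^+ d) * (if d == 2%N then (eps n)^-1 else 1)}.
Proof.
(* With the trivial event for the pair, the exceptional probability is at most C * n^-3 * n. *)
move=> C0 c0 conc; apply: (@borel_cantelli_event _ _ _ P _ C); first exact: ltW.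
have e1 := log_condition_expR 3 c0 eps_log.
have e2 := log_condition_inv eps_gt0 eps_log.
have e3 : \forall n \near \oo, eps n < h.
  by have hh := cvgr_lt _ eps_cvg0 _ (region_h_gt0 X_valid); exact: hh.
have e4 : \forall n \near \oo, ((maxn i j).+1 <= n)%N by exists (maxn i j).+1.
near=> n; have nij : ((maxn i j).+1 <= n)%N by near: n.
have ni : (i < n)%N by apply: leq_trans nij; rewrite ltnS leq_maxl.
have nj : (j < n)%N by apply: leq_trans nij; rewrite ltnS leq_maxr.
have ijo : Ordinal ni != Ordinal nj by [].
have eh : eps n <= h by apply: ltW; near: n.
have [Bad [mBad PBad goodP]] := conc n (eps n) _ _ (eps_gt0 n) eh ijo.
exists Bad; split=> //; last first.
  move=> w /goodP H u v ui vj di dj far.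
  have -> : u = Ordinal ni by exact: val_inj.
  have -> : v = Ordinal nj by exact: val_inj.
  exact: H.
have := PBad _ measurableT;
have -> : [set w | [set: 'rV[R]_d * 'rV[R]_d] (Z (Ordinal ni) w, Z (Ordinal nj) w)] = setT.
  by apply/seteqP; split.
rewrite setTI probability_setT mul1e => /le_trans; apply; rewrite lee_fin.
have n0 : n%:R != 0 :> R by rewrite pnatr_eq0 -lt0n (leq_trans _ nij).
rewrite -mulrA ler_pM2l //.
have l1 : expR (- (c * (n%:R * eps n ^+ d))) <= n%:R ^- 3 by near: n.
have l2 : (eps n ^+ d)^-1 <= n%:R by near: n.
apply: le_trans (ler_pM _ _ l1 l2) _; [exact: expR_ge0|by rewrite invr_ge0 exprn_ge0 // ltW|].
by rewrite le_eqVlt; apply/orP; left; apply/eqP; field.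
Unshelve. all: by end_near. Qed.

Let three_close (s du dv si sj delta : R) : `|s - (du + dv)| < delta / 3 ->
  `|du - si| < delta / 3 -> `|dv - sj| < delta / 3 -> `|s - (si + sj)| < delta.
Proof. by rewrite !ltr_norml => /andP[? ?] /andP[? ?] /andP[? ?]; apply/andP; split; lra. Qed.

(** One third of [delta] goes to the deviation bound and one third to each inverse degree. The
    points are almost surely distinct, so the separation 8 * eps holds from some n on. *)
Lemma commute_ae : {ae P, forall w, deep_point X h (Z i w) -> deep_point X h (Z j w) ->
  forall delta : R, 0 < delta ->
  \forall n \near \oo, forall u v : 'I_n, u = i :> nat -> v = j :> nat ->
    let x := fun k : 'I_n => Z k w in
    components_meet X x (eps n) ->
    commute_distance (eps_graph x (eps n)) u v \is a fin_num /\
    `| scaled_commute x (eps n) u v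
       - ((eta * p (Z i w))^-1 + (eta * p (Z j w))^-1) | < delta}.
Proof.
have d_gt0 : (0 < d)%N by exact: leq_trans d_ge2.
have [D [C [c [D0 C0 c0 conc]]]] := commute_concentration d_ge2 p_density X_valid.
have dev := deviation_ae C0 c0 (fun n e u v => conc _ _ P Z Z_iid n e u v).
have cnt := inner_count_ae p_density Z_iid p_cont eps_gt0 eps_log eps_cvg0 ij.
have dist := distinct_ae d_gt0 p_density Z_iid p_cont ij.
move: dev cnt dist; apply: filterS3 => w devw cntw distw di dj delta delta0.
have pi0 : 0 < p (Z i w).
  by apply: lt_le_trans (region_pmin_gt0 X_valid) (region_density X_valid di.1).
have pj0 : 0 < p (Z j w).
  by apply: lt_le_trans (region_pmin_gt0 X_valid) (region_density X_valid dj.1).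
have far0 : 0 < edistance (Z i w) (Z j w).
  rewrite lt_neqAle edistance_ge0 andbT eq_sym; apply: contraNneq (distw pi0) => e0.
  apply/eqP/rowP => l; apply/eqP; rewrite -subr_eq0 -normr_eq0 eq_le normr_ge0 andbT.
  by have := ler_coord_enorm (Z i w - Z j w) l; rewrite -[enorm _]/(edistance _ _) e0 !mxE.
have d3 : 0 < delta / 3 by rewrite divr_gt0.
have [ri ri0 hi] := inv_close pi0 d3; have [rj rj0 hj] := inv_close pj0 d3.
have ni := cntw _ pi0 _ ri0; have nj := cntw _ pj0 _ rj0.
have nfar : \forall n \near \oo, 8 * eps n < edistance (Z i w) (Z j w).
  have f8 : 0 < edistance (Z i w) (Z j w) / 8 by rewrite divr_gt0.
  have hh : \forall n \near \oo, eps n < edistance (Z i w) (Z j w) / 8.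
    by have h' := cvgr_lt _ eps_cvg0 _ f8; exact: h'.
  near=> n; have : eps n < edistance (Z i w) (Z j w) / 8 by near: n.
  by rewrite ltr_pdivlMr // mulrC.
have nbound : \forall n \near \oo,
    `|D / (n%:R * eps n ^+ d) * (if d == 2%N then (eps n)^-1 else 1)| < delta / 3.
  by have h' := cvgr0_norm_lt _ (raw_bound_cvg D eps_log eps_rate) _ d3; exact: h'.
have npos : \forall n \near \oo, (1 <= n)%N by exists 1%N.
near=> n; move=> u v ui vj; pose x := fun k : 'I_n => Z k w; move=> comp.
have far : 8 * eps n < edistance (Z i w) (Z j w) by near: n.
have far1 : eps n < edistance (x u) (x v).
  rewrite /x ui vj; apply: lt_trans far; rewrite -[ltLHS]mul1r ltr_pM2r //.
  by rewrite ltr1n.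
have devn : forall u v : 'I_n, u = i :> nat -> v = j :> nat ->
    deep_point X h (Z i w) -> deep_point X h (Z j w) ->
    8 * eps n <= edistance (Z i w) (Z j w) ->
    let x := fun k : 'I_n => Z k w in components_meet X x (eps n) ->
    commute_distance (eps_graph x (eps n)) u v \is a fin_num /\
    `| scaled_commute x (eps n) u v
       - (scaled_inverse_degree x (eps n) u + scaled_inverse_degree x (eps n) v) |
      <= D / (n%:R * eps n ^+ d) * (if d == 2%N then (eps n)^-1 else 1) by near: n.
have [fin le] := devn u v ui vj di dj (ltW far) comp; split=> //.
have n0 : (1 <= n)%N by near: n.
have E0 : 0 < n%:R * eps n ^+ d by rewrite mulr_gt0 ?ltr0n // exprn_gt0.
have degE k : k \in [:: u; v] -> scaled_inverse_degree x (eps n) k =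
   (eta * ((inner_count Z u v [set y | edistance (x k) y <= eps n] w)%:R
      / (eta * (n%:R * eps n ^+ d))))^-1.
  move=> kuv; rewrite /scaled_inverse_degree (degree_inner_count far1 kuv) /inner_count.
  rewrite -[LHS]invf_div; congr (_^-1); field.
  by rewrite !lt0r_neq0 ?exprn_gt0 ?ltr0n.
have cn_i : forall (u v : 'I_n), u = i :> nat -> v = j :> nat ->
    `|p (Z i w) - (inner_count Z u v [set y | edistance (Z i w) y <= eps n] w)%:R
        / (eta * (n%:R * eps n ^+ d))| < ri by near: n.
have cn_j : forall (u v : 'I_n), u = i :> nat -> v = j :> nat ->
    `|p (Z j w) - (inner_count Z u v [set y | edistance (Z j w) y <= eps n] w)%:R
        / (eta * (n%:R * eps n ^+ d))| < rj by near: n.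
have := hi _ (cn_i u v ui vj); have := hj _ (cn_j u v ui vj).
have xu : x u = Z i w by rewrite /x ui.
have xv : x v = Z j w by rewrite /x vj.
rewrite -{1}xv -{1}xu -!degE ?inE ?eqxx ?orbT //.
have : `|D / (n%:R * eps n ^+ d) * (if d == 2%N then (eps n)^-1 else 1)| < delta / 3.
  by near: n.
move/(le_lt_trans (ler_norm _))/(le_lt_trans le).
move=> h1 h2 h3; exact: three_close h1 h3 h2.
Unshelve. all: by end_near. Qed.

End almost_sure_limit.

Theorem theorem1 (R : realType) (d : nat) (hd : (2 <= d)%N)
    (p : 'rV[R]_d -> R) (hp : is_density p)
    (X : set 'rV[R]_d) (pmin h : R) (hX : valid_region p X pmin h)
    (epsmax : R) (hepsmax : d = 3%N -> epsmax < 1) :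
  (exists c1 c2 c3 c4 c5 c6 c7 : R,
    [/\ [&& 0 < c1, 0 < c2, 0 < c3, 0 < c4, 0 < c5, 0 < c6 & 0 < c7],
      (* the deviation bound *)
      forall (dOmega : measure_display) (Omega : measurableType dOmega)
        (P : probability Omega R) (Z : nat -> Omega -> 'rV[R]_d),
        iid_with_density P p Z ->
        forall (n : nat) (eps : R) (i j : 'I_n),
        0 < eps -> eps <= h -> (d = 3%N -> eps <= epsmax) -> i != j ->
        let A := [set w | [/\ deep_point X h (Z i w), deep_point X h (Z j w) &
                              8 * eps <= edistance (Z i w) (Z j w)]] in
        let x := fun w (k : 'I_n) => Z k w in
        let good := [set w | components_meet X (x w) eps ->
          commute_distance (eps_graph (x w) eps) i j \is a fin_num /\
          `| scaled_commute (x w) eps i j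
             - (scaled_inverse_degree (x w) eps i
                + scaled_inverse_degree (x w) eps j) |
            <= deviation_bound d c5 c6 c7 n eps] in
        ((1 - failure_bound d c1 c2 c3 c4 n eps)%:E * P A
           <= P (A `&` good))%E,
      (* the probability tends to 1 *)
      forall eps : nat -> R, (forall n, 0 < eps n) -> log_condition d eps ->
        (1 - failure_bound d c1 c2 c3 c4 n (eps n)) @[n --> \oo] --> (1 : R) &
      (* the deviation bound tends to 0 *)
      forall eps : nat -> R, (forall n, 0 < eps n) -> rate_condition d eps ->
        deviation_bound d c5 c6 c7 n (eps n) @[n --> \oo] --> (0 : R)])
  /\
  (* almost sure convergence *)
  (continuous p ->
    forall (dOmega : measure_display) (Omega : measurableType dOmega)
      (P : probability Omega R) (Z : nat -> Omega -> 'rV[R]_d),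
    iid_with_density P p Z ->
    forall eps : nat -> R, (forall n, 0 < eps n) ->
    log_condition d eps -> rate_condition d eps ->
    eps n @[n --> \oo] --> (0 : R) ->
    forall i j : nat, i != j ->
    {ae P, forall w, deep_point X h (Z i w) -> deep_point X h (Z j w) ->
      forall delta : R, 0 < delta ->
      \forall n \near \oo, forall u v : 'I_n, u = i :> nat -> v = j :> nat ->
        let x := fun k : 'I_n => Z k w in
        components_meet X x (eps n) ->
        commute_distance (eps_graph x (eps n)) u v \is a fin_num /\
        `| scaled_commute x (eps n) u v
           - ((unit_ball_volume d * p (Z i w))^-1
              + (unit_ball_volume d * p (Z j w))^-1) | < delta}).
Proof.
split.
  have [c1 [c2 [c3 [c4 [c5 [c6 [c7 [c_gt0 bound]]]]]]]] :=
    finite_sample_bound hd hp hX hepsmax.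
  exists c1, c2, c3, c4, c5, c6, c7; split => //.
  - case/and5P: c_gt0 => c1_gt0 c2_gt0 c3_gt0 c4_gt0 _ eps eps_gt0 logc.
    exact: failure_bound_cvg.
  - by move=> eps _; exact: deviation_bound_cvg.
move=> p_cont dOmega Omega P Z Z_iid eps eps_gt0 logc ratec eps0 i j ij.
exact: (commute_ae hd hp hX p_cont Z_iid eps_gt0 logc ratec eps0 ij).
Qed.
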